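(* Let $1 \le p \le \infty$ and $n \ge 1$. Among $n$-dimensional subspaces of $L_p$, the space $\ell_p^n$ has exactly maximal volume ratio; that is, for every $n$-dimensional linear subspace $X$ of $L_p$, $$vr(X) \le vr(\ell_p^n).$$
   Context: All normed spaces are real. $L_p$ denotes the usual Lebesgue space $L_p[0,1]$ with its norm, and subspaces carry the induced norm. $\ell_p^n$ is $\mathbb{R}^n$ with the norm $\|x\|_p = (\sum_{i=1}^n |x_i|^p)^{1/p}$ for $p<\infty$ and $\|x\|_\infty = \max_i |x_i|$ for $p = \infty$. For a convex body $C$ in $\mathbb{R}^n$ (compact, convex, non-empty interior), its volume ratio is $vr(C) = \left(\frac{|C|}{|\mathcal{E}|}\right)^{1/n}$, where $\mathcal{E}$ is the ellipsoid of maximal volume included in $C$ and $|\cdot|$ denotes $n$-dimensional volume. For an $n$-dimensional normed space $X$, $vr(X)$ is defined to be $vr(C)$ for any convex body $C \subset \mathbb{R}^n$ which is the unit ball of $X$ in some representation of $X$ on $\mathbb{R}^n$ (i.e. the image of the unit ball of $X$ under some linear isomorphism $X \to \mathbb{R}^n$); this does not depend on the representation. *)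

(* Defs.v *)
From HB Require Import structures.
From mathcomp Require Import all_boot all_order all_algebra generic_quotient.
From mathcomp Require Import all_classical all_reals all_analysis measurable_realfun ess_sup_inf.
Set Implicit Arguments.
Unset Strict Implicit.
Unset Printing Implicit Defensive.
Import Order.TTheory GRing.Theory Num.Theory.
Import numFieldNormedType.Exports.

Local Open Scope classical_set_scope.
Local Open Scope ring_scope.

Section cons_measure.
Local Open Scope ereal_scope.
Context d (T : measurableType d) (R : realType) (n : nat).
Variables (m1 : {sigma_finite_measure set T -> \bar R}).
Variables (m2 : {sigma_finite_measure set (n.-tuple T) -> \bar R}).

Let consf (xt : T * n.-tuple T) : n.+1.-tuple T := [tuple of xt.1 :: xt.2].
Let unconsf (t : n.+1.-tuple T) : T * n.-tuple T :=
  (thead t, [tuple of behead t]).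

Let mconsf : measurable_fun setT consf.
Proof. exact: measurable_cons. Qed.

Let munconsf : measurable_fun setT unconsf.
Proof.
apply/measurable_fun_pairP; split; first exact: measurable_tnth.
exact: measurable_behead.
Qed.

(* The product of [m1] and [m2], carried over to [n.+1.-tuple T]. *)
Definition cons_measure : set (n.+1.-tuple T) -> \bar R :=
  pushforward (m1 \x m2) consf.

Let cons_measure0 : cons_measure set0 = 0.
Proof. by rewrite /cons_measure /pushforward preimage_set0 measure0. Qed.

Let cons_measure_ge0 A : 0 <= cons_measure A.
Proof. exact: measure_ge0. Qed.

Let cons_measure_sigma_additive : semi_sigma_additive cons_measure.
Proof.
move=> F mF tF mUF; rewrite /cons_measure /pushforward preimage_bigcup.
apply: (measure_semi_sigma_additive (fun k => consf @^-1` F k)).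
- by move=> k; rewrite -[X in measurable X]setTI; exact: mconsf.
- apply/trivIsetP => i j _ _ ij; rewrite -preimage_setI.
  by move/trivIsetP : tF => /(_ _ _ I I ij) ->; rewrite preimage_set0.
- by rewrite -preimage_bigcup -[X in measurable X]setTI; exact: mconsf.
Qed.

HB.instance Definition _ := isMeasure.Build _ _ _ cons_measure
  cons_measure0 cons_measure_ge0 cons_measure_sigma_additive.

Let cons_measure_sigma_finite : sigma_finite setT cons_measure.
Proof.
have /sigma_finiteP[F [TF ndF Foo]] := sigma_finiteT m1.
have /sigma_finiteP[G [TG ndG Goo]] := sigma_finiteT m2.
exists (fun k => unconsf @^-1` (F k `*` G k)).
  rewrite -preimage_bigcup (_ : \bigcup_k (F k `*` G k) = setT) ?preimage_setT//.
  apply/seteqP; split => // -[x t] _.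
  have : setT x by []. have : setT t by [].
  rewrite [in X in X -> _]TG [in X in _ -> X -> _]TF => -[k _ Gkt] [j _ Fjx].
  exists (maxn j k) => //; split => /=.
    by move: x Fjx; exact/subsetPset/ndF/leq_maxl.
  by move: t Gkt; exact/subsetPset/ndG/leq_maxr.
move=> k; have [mF ltF] := Foo k; have [mG ltG] := Goo k.
have mFG := measurableX mF mG; split.
  by rewrite -[X in measurable X]setTI; exact: munconsf.
rewrite /cons_measure /pushforward -comp_preimage (_ : unconsf \o consf = id).
  by rewrite preimage_id product_measure1E// lte_mul_pinfty// ge0_fin_numE.
by apply/funext => -[x t]; congr (_, _); exact/val_inj.
Qed.

HB.instance Definition _ := Measure_isSigmaFinite.Build _ _ _ cons_measure
  cons_measure_sigma_finite.

End cons_measure.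

Fixpoint lebesgue_tuple (R : realType) (n : nat) :
    {sigma_finite_measure set (n.-tuple (measurableTypeR R)) -> \bar R} :=
  if n is m.+1 then cons_measure lebesgue_measure (lebesgue_tuple R m)
  else dirac [tuple].

Lemma box_measurable (R : realType) (n : nat)
    (D : 'I_n -> set (measurableTypeR R)) : (forall i, measurable (D i)) ->
  measurable [set t : n.-tuple (measurableTypeR R) | forall i, D i (tnth t i)].
Proof.
move=> mD.
have -> : [set t : n.-tuple (measurableTypeR R) | forall i, D i (tnth t i)] =
    \bigcap_(i in [set: 'I_n]) ((fun t => tnth t i) @^-1` D i).
  by apply/seteqP; split => t /= H i; [move=> _; exact: H| exact: H].
apply: fin_bigcap_measurable => // i _.
by rewrite -[X in measurable X]setTI; exact: (@measurable_tnth _ (measurableTypeR R)).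
Qed.

Lemma lebesgue_tuple_box (R : realType) (n : nat)
    (D : 'I_n -> set (measurableTypeR R)) : (forall i, measurable (D i)) ->
  (lebesgue_tuple R n [set t | forall i, D i (tnth t i)] =
   \prod_(i < n) lebesgue_measure (D i))%E.
Proof.
elim: n D => [|n IH] D mD.
  rewrite big_ord0 /= diracE mem_set//=; by case.
rewrite big_ord_recl /= /cons_measure /pushforward.
rewrite (_ : _ @^-1` _ = D ord0 `*`
    [set t : n.-tuple _ | forall i, D (lift ord0 i) (tnth t i)]); last first.
  apply/seteqP; split => -[x t] /= H.
    split; first by have := H ord0.
    by move=> i; have := H (lift ord0 i); rewrite tnthS.
  by case: H => H0 H1 i; case: (unliftP ord0 i) => [j ->|->] //; rewrite tnthS; exact: H1.
apply: etrans.
  apply: (product_measure1E _ (lebesgue_tuple R n)) => //.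
  exact: (box_measurable (D := fun i => D (lift ord0 i))).
by rewrite /= (IH (fun i => D (lift ord0 i))).
Qed.

(* The library's L_p space (classes of functions modulo almost everywhere
   equality) comes without vector space operations: they are the pointwise
   ones, see [LspaceDE] and [LspaceZE]. *)
Section Lspace_lmodule.
Context d (T : measurableType d) (R : realType).
Variables (mu : {measure set T -> \bar R}) (p : \bar R) (p1 : (1 <= p)%E).
Local Notation L := (LspaceType mu p1).
Implicit Types f g h : L.

HB.instance Definition _ := gen_eqMixin L.
HB.instance Definition _ := gen_choiceMixin L.

Let eq_Lnorm_ae (f g : T -> R) : measurable_fun setT f ->
  measurable_fun setT g -> f = g %[ae mu] ->
  ('N[mu]_p[EFin \o f] = 'N[mu]_p[EFin \o g])%E.
Proof.
move=> mf mg fg; rewrite unlock /Lnorm; case: p p1 => [r r1|_|//].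
  have mpow (h : T -> R) : measurable_fun setT h ->
      measurable_fun setT (fun x => (`|(EFin \o h) x| `^ r)%E).
    move=> mh; apply: (@measurableT_comp _ _ _ _ _ _ (@poweR R ^~ r)).
      exact: measurable_poweR.
    by apply: measurableT_comp => //; exact/measurable_EFinP.
  congr poweR; apply: ge0_ae_eq_integral => //; do ?exact: mpow.
  - by move=> x _; exact: poweR_ge0.
  - by move=> x _; exact: poweR_ge0.
  - by apply: filterS fg => x /= /(_ I) ->.
case: ifP => // _; apply: eq_ess_sup.
by apply: filterS fg => x /= /(_ I) ->.
Qed.

Lemma Lspace_Lfun f : (f : T -> R) \in Lfun mu p.
Proof.
rewrite inE; apply/andP; split; rewrite inE/=; last exact: Lebesgue_finite.
exact: (@measurable_funPT _ _ _ _ (repr (f : {mfun_ mu, T >-> measurableTypeR R}))).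
Qed.

Section class.
Variables (f : T -> R) (fP : f \in Lfun mu p).

Let fm : measurable_fun setT (f : T -> measurableTypeR R).
Proof. by move: fP => /andP[]; rewrite inE. Qed.
Let mf : {mfun T >-> measurableTypeR R} :=
  HB.pack_for {mfun T >-> measurableTypeR R} (f : T -> measurableTypeR R)
    (isMeasurableFun.Build _ _ T (measurableTypeR R) f fm).
Let c : {mfun_ mu, T >-> measurableTypeR R} :=
  \pi_({mfun_ mu, T >-> measurableTypeR R})%qT mf.

Let cE : (c : T -> R) = f %[ae mu].
Proof.
have : (repr c = mf %[mod {mfun_ mu, T >-> measurableTypeR R}])%qT by rewrite reprK.
by move=> /eqP; rewrite eqmodE => /asboolP.
Qed.

Let c_finite : finite_norm mu p c.
Proof.
have e := eq_Lnorm_ae (measurable_funPT (repr c)) fm cE.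
by rewrite /finite_norm e; move: fP => /andP[_]; rewrite inE.
Qed.

Definition Lclass : L :=
  HB.pack_for L c (isFinLebesgue.Build d T R mu p p1 c c_finite).

Lemma LclassE : (Lclass : T -> R) = f %[ae mu].
Proof. exact: cE. Qed.

End class.

Lemma Lspace_eqP f g : (f : T -> R) = g %[ae mu] -> f = g.
Proof.
case: f g => f [[ff]] [g [[gf]]] /= fg.
have e : f = g by rewrite -(reprK f) -(reprK g); apply/eqmodP/asboolP.
by subst g; rewrite (Prop_irrelevance ff gf).
Qed.

Let Lfun_linear a (f g : T -> R) : f \in Lfun mu p -> g \in Lfun mu p ->
  (fun x => a * f x + g x) \in Lfun mu p.
Proof. exact: (Lfun_submod_closed mu p1).2. Qed.

Let Lfun0 : (fun=> 0) \in Lfun mu p.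
Proof. exact: (Lfun_submod_closed mu p1).1. Qed.

Let LfunZ a (f : T -> R) : f \in Lfun mu p -> (fun x => a * f x) \in Lfun mu p.
Proof.
by move=> /(Lfun_linear a)/(_ Lfun0); under eq_fun do rewrite addr0.
Qed.

Let LfunD (f g : T -> R) : f \in Lfun mu p -> g \in Lfun mu p ->
  (fun x => f x + g x) \in Lfun mu p.
Proof.
by move=> /(Lfun_linear 1)/[apply]; under eq_fun do rewrite mul1r.
Qed.

Let zero : L := Lclass Lfun0.
Let add f g : L := Lclass (LfunD (Lspace_Lfun f) (Lspace_Lfun g)).
Let scale a f : L := Lclass (LfunZ a (Lspace_Lfun f)).
Let opp f : L := scale (-1) f.

Let zeroE : \forall x \ae mu, (zero : T -> R) x = 0.
Proof. by apply: filterS (LclassE Lfun0) => x /(_ I). Qed.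

Let addE f g : \forall x \ae mu, (add f g : T -> R) x = f x + g x.
Proof.
by apply: filterS (LclassE (LfunD (Lspace_Lfun f) (Lspace_Lfun g))) => x /(_ I).
Qed.

Let scaleE a f : \forall x \ae mu, (scale a f : T -> R) x = a * f x.
Proof.
by apply: filterS (LclassE (LfunZ a (Lspace_Lfun f))) => x /(_ I).
Qed.

Let addA : associative add.
Proof.
move=> f g h; apply: Lspace_eqP; near=> x => _.
rewrite (near (addE f (add g h)) x)// (near (addE g h) x)//.
by rewrite (near (addE (add f g) h) x)// (near (addE f g) x)// addrA.
Unshelve. all: by end_near. Qed.

Let addC : commutative add.
Proof.
move=> f g; apply: Lspace_eqP; near=> x => _.
by rewrite (near (addE f g) x)// (near (addE g f) x)// addrC.
Unshelve. all: by end_near. Qed.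

Let add0 : left_id zero add.
Proof.
move=> f; apply: Lspace_eqP; near=> x => _.
by rewrite (near (addE zero f) x)// (near zeroE x)// add0r.
Unshelve. all: by end_near. Qed.

Let addN : left_inverse zero opp add.
Proof.
move=> f; apply: Lspace_eqP; near=> x => _.
rewrite (near (addE (opp f) f) x)// (near zeroE x)// (near (scaleE (-1) f) x)//.
by rewrite mulN1r addNr.
Unshelve. all: by end_near. Qed.

HB.instance Definition _ := GRing.isZmodule.Build L addA addC add0 addN.

Let scaleA a b f : scale a (scale b f) = scale (a * b) f.
Proof.
apply: Lspace_eqP; near=> x => _.
rewrite (near (scaleE a (scale b f)) x)// (near (scaleE b f) x)//.
by rewrite (near (scaleE (a * b) f) x)// mulrA.
Unshelve. all: by end_near. Qed.

Let scale1 : left_id 1 scale.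
Proof.
move=> f; apply: Lspace_eqP; near=> x => _.
by rewrite (near (scaleE 1 f) x)// mul1r.
Unshelve. all: by end_near. Qed.

Let scaleDr : right_distributive scale +%R.
Proof.
move=> a f g; apply: Lspace_eqP; near=> x => _.
rewrite (near (scaleE a (f + g)) x)// (near (addE f g) x)//.
rewrite (near (addE (scale a f) (scale a g)) x)//.
by rewrite (near (scaleE a f) x)// (near (scaleE a g) x)// mulrDr.
Unshelve. all: by end_near. Qed.

Let scaleDl f : {morph scale^~ f : a b / a + b}.
Proof.
move=> a b; apply: Lspace_eqP; near=> x => _.
rewrite (near (scaleE (a + b) f) x)//.
rewrite (near (addE (scale a f) (scale b f)) x)//.
by rewrite (near (scaleE a f) x)// (near (scaleE b f) x)// mulrDl.
Unshelve. all: by end_near. Qed.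

HB.instance Definition _ :=
  GRing.Zmodule_isLmodule.Build R L scaleA scale1 scaleDr scaleDl.

Lemma LspaceDE f g :
  ((f + g : L) : T -> R) = (fun x => f x + g x) %[ae mu].
Proof. by apply: filterS (addE f g) => x -> _. Qed.

Lemma LspaceZE a f :
  ((a *: f : L) : T -> R) = (fun x => a * f x) %[ae mu].
Proof. by apply: filterS (scaleE a f) => x -> _. Qed.

End Lspace_lmodule.

Definition Lspace_norm d (T : measurableType d) (R : realType)
    (mu : {measure set T -> \bar R}) (p : \bar R) (p1 : (1 <= p)%E)
    (f : LspaceType mu p1) : R :=
  fine ('N[mu]_p[EFin \o (f : T -> R)])%E.
Arguments Lspace_norm {d T R mu p p1} f.

(* L_p[0,1]: classes of functions on the line modulo equality almost everywhere
   on [0,1]. *)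
Definition Lebesgue01 (R : realType) :
    {measure set (measurableTypeR R) -> \bar R} :=
  mrestr lebesgue_measure (measurable_itv `[0%R : R, 1%R]).

Definition Lp01 (R : realType) (p : \bar R) (p1 : (1 <= p)%E) :=
  LspaceType (Lebesgue01 R) p1.

(* Only used for [1 <= p], so that the last case is [p = +oo]. *)
Definition lp_norm (R : realType) (p : \bar R) (n : nat) (x : 'rV[R]_n) : R :=
  if p is r%:E then (\sum_(i < n) `|x ord0 i| `^ r) `^ r^-1
  else \big[Num.max/0]_(i < n) `|x ord0 i|.
Arguments lp_norm {R} p {n} x.

Section volume_ratio.
Context (R : realType) (n : nat).
Implicit Types C E : set 'rV[R]_n.

Definition volume C : \bar R :=
  lebesgue_tuple R n [set t | C (\row_i tnth t i)].

Definition ellipsoid E : Prop :=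
  exists (A : 'M[R]_n) (c : 'rV[R]_n), A \in unitmx /\
    E = [set c + u *m A | u in [set u : 'rV[R]_n | \sum_i u ord0 i ^+ 2 <= 1]].

Definition max_volume_ellipsoid C E : Prop :=
  [/\ ellipsoid E, E `<=` C &
      forall E', ellipsoid E' -> E' `<=` C -> (volume E' <= volume E)%E].

(* Every convex body contains exactly one ellipsoid of maximal volume; the
   default value of [xget] is for the other sets only. *)
Definition vr_body C : R :=
  (fine (volume C) / fine (volume (xget set0 (max_volume_ellipsoid C))))
    `^ n%:R^-1.

End volume_ratio.

Section normed_space.
Context (R : realType) (V : lmodType R).
Implicit Types (N : V -> R) (X : set V) (n : nat).

Definition is_subspace X : Prop :=
  X 0 /\ forall a u v, X u -> X v -> X (a *: u + v).

Definition has_dim X n : Prop :=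
  exists b : 'I_n -> V,
    (forall c : 'I_n -> R, \sum_i c i *: b i = 0 -> forall i, c i = 0) /\
    X = [set \sum_i c i *: b i | c in [set: 'I_n -> R]].

(* [C] is the image of the unit ball of [X], with norm [N], under the inverse
   of the linear isomorphism [f] from R^n onto [X]. *)
Definition represents_unit_ball N X n (C : set 'rV[R]_n) : Prop :=
  exists f : {linear 'rV[R]_n -> V},
    [/\ injective f, range f = X & C = [set v | N (f v) <= 1]].

(* The volume ratio of the [n]-dimensional space [X] with norm [N]. It does not
   depend on the representation of the unit ball picked by [xget]. *)
Definition vr N X n : R := vr_body (xget set0 (represents_unit_ball N X (n := n))).

End normed_space.

(* Main.v *)
(* For 1 <= p < oo, Lewis' theorem puts an n-dimensional subspace of L_p in a
   position where the norm is |x|^p = \int |<x,u>|^p rho dmu, with unit vectors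
   u(s) and \int <x,u>^2 rho dmu = |x|_2^2.  In this position:
   - the unit ball contains the same multiple of the Euclidean ball as the unit
     ball of l_p^n does, and by Ball's argument (the Hilbert-Schmidt norm of an
     ellipsoid contained in the unit ball of l_p^n is bounded, and arithmetic-
     geometric means) no ellipsoid in the latter is larger;
   - the volume of the unit ball is a constant times \int exp(-|x|^p) dx, which
     the Brascamp-Lieb inequality bounds by (\int exp(-|t|^p) dt)^n, its value
     for l_p^n.
   The Brascamp-Lieb inequality is proved by Barthe's transport: if tau carries
   exp(-|t|^p) to a multiple of exp(-t^2), then
   Phi(x) = \int tau(<x,u>) u rho dmu satisfies
   |Phi(x)|_2^2 <= \int tau(<x,u>)^2 rho dmu and
   ln det DPhi(x) >= \int ln tau'(<x,u>) rho dmu.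
   For p = oo, the unit ball is the intersection of the unit balls for finite
   exponents, and a limit of the corresponding ellipsoids is taken. *)
From HB Require Import structures.
Require Import Defs.
From mathcomp Require Import all_boot all_order all_algebra all_fingroup.
From mathcomp Require Import all_classical all_reals all_analysis measurable_realfun ess_sup_inf.
From mathcomp Require Import ring lra.
From mathcomp Require complex spectral sesquilinear.
Import Order.TTheory GRing.Theory Num.Theory.
Import numFieldNormedType.Exports.
Local Open Scope classical_set_scope.
Local Open Scope ring_scope.
Set Implicit Arguments.
Unset Strict Implicit.
Unset Printing Implicit Defensive.

(** * Symmetric matrices and determinants *)

(** The Gaussian target makes the two inequalities for Phi match. With c the quotient of the total
    masses, ln tau' = ln c - |t|^p + tau^2, and the weight rho dmu has total mass n, so the terms in
    tau^2 cancel: exp(-|Phi(x)|^2) det DPhi(x) >= c^n exp(-|x|^p). As Phi is injective, the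
    left-hand side integrates to at most the Gaussian integral. Both inequalities rest on the
    isotropy of u: one is Bessel's inequality, the other comes from the concavity of ln. The
    ellipsoid and the volume are estimated in the same position, so the determinant of the matrix
    leading to it cancels in the ratio. For p = oo the norm is no integral. The weights rho are not
    passed to the limit, only the matrices: [0,1] has measure 1, so the balls decrease as the
    exponent grows; from exponent 2 on, the ellipsoids found in them are images of the same
    Euclidean ball, and the volume of the limit ball, if positive, keeps the determinants away from
    0. *)

Section spectral_real.
Import complex spectral sesquilinear.
Local Open Scope complex_scope.
Local Open Scope sesquilinear_scope.
Variable R : rcfType.

Lemma Re_sum I (r : seq I) (P : pred I) (F : I -> R[i]) :
  Re (\sum_(i <- r | P i) F i) = \sum_(i <- r | P i) Re (F i).
Proof. by apply: (big_morph (@Re R)) => // -[? ?] [? ?]. Qed.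

(** A real symmetric matrix is Hermitian over R[i], so a unitary matrix P diagonalizes it, with real
    eigenvalues [d k]. [a k] and [b k] are the real and imaginary parts of the rows of P; the last
    three clauses are the real parts of P M P^* = diag d, P P^* = 1 and P^* P = 1. *)
Lemma sym_spectral n (M : 'M[R]_n) : M^T = M ->
  exists (d : 'I_n -> R) (a b : 'I_n -> 'rV[R]_n),
  [/\ \det M = \prod_k d k,
     forall k, (a k *m M *m (a k)^T) 0 0 + (b k *m M *m (b k)^T) 0 0 = d k,
     forall k, (a k *m (a k)^T) 0 0 + (b k *m (b k)^T) 0 0 = 1 &
     \sum_k ((a k)^T *m a k + (b k)^T *m b k) = 1%:M].
Proof.
move=> Ms.
pose MC : 'M[R[i]]_n := map_mx (real_complex R) M.
have MCh : MC \is hermsymmx.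
  apply: realsym_hermsym.
    apply/is_hermitianmxP; rewrite expr0 scale1r map_mx_id //. by rewrite map_trmx Ms.
  by apply/mxOverP => i j; rewrite mxE complex_real.
have MCn := hermitian_normalmx MCh.
have /orthomx_spectralP E := MCn.
set P := spectralmx MC in E.
set D := spectral_diag MC in E.
have Pu : P \is unitarymx := spectral_unitarymx MC.
have Pi := unitarymx_unit Pu.
have /mxOverP Dr : D \is a realmx := hermitian_spectral_diag_real MCh.
have Drr k : (Re (D 0 k))%:C = D 0 k by apply: RRe_real.
have conjE (z : R[i]) : Num.conj z = conjc z by case: z.
pose a k : 'rV[R]_n := \row_j Re (P k j).
pose b k : 'rV[R]_n := \row_j Im (P k j).
exists (fun k => Re (D 0 k)), a, b; split.
- apply: (@complexI R); rewrite rmorph_prod/= (eq_bigr (fun k => D 0 k)) //.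
  rewrite -[LHS]det_map_mx -/MC E !det_mulmx det_diag mulrAC det_inv mulVr ?mul1r//.
- move=> k.
  have F : P *m MC *m P^t* = diag_mx D.
    by rewrite E -(invmx_unitary Pu) !mulmxA mulmxV// mul1mx mulmxK.
  move/matrixP/(_ k k): F; rewrite !mxE eqxx mulr1n => /(congr1 (@Re R)) <-.
  rewrite Re_sum -big_split/=; apply: eq_bigr => i _; rewrite !mxE conjE.
  rewrite !mulr_suml -big_split/= Re_sum; apply: eq_bigr => j _; rewrite !mxE.
  by case: (P k j) (P k i) => [? ?] [? ?] /=; ring.
- move=> k; move/unitarymxP : Pu => /matrixP/(_ k k); rewrite !mxE eqxx => /(congr1 (@Re R)) /= <-.
  rewrite Re_sum -big_split/=; apply: eq_bigr => i _; rewrite !mxE conjE.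
  by case: (P k i) => [? ?] /=; ring.
- apply/matrixP => i j.
  have F : P^t* *m P = 1%:M by rewrite -(invmx_unitary Pu) mulVmx.
  move/matrixP/(_ i j): F => /(congr1 (@Re R)); rewrite !mxE Re_sum summxE => H.
  transitivity (Re ((i == j)%:R : R[i])); last by case: eqP.
  rewrite -H; apply: eq_bigr => k _; rewrite !mxE !big_ord1 !mxE conjE.
  by case: (P k j) (P k i) => [? ?] [? ?] /=; ring.
Qed.
End spectral_real.

Section det_ineq.
Variable R : rcfType.

(** Arithmetic-geometric means for the eigenvalues, which are nonnegative as sums of two values of
    the quadratic form; the resolution of the identity identifies their sum with the trace. *)
Lemma det_le_trace n (M : 'M[R]_n) : M^T = M ->
  (forall x : 'rV[R]_n, 0 <= (x *m M *m x^T) 0 0) ->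
  \det M <= (\tr M / n%:R) ^+ n.
Proof.
move=> Ms Mp; have [d [a [b [-> hd h1 hs]]]] := sym_spectral Ms.
have d0 k : 0 <= d k by rewrite -hd addr_ge0.
have -> : \tr M = \sum_k d k.
  rewrite -[M in LHS]mul1mx -hs mulmx_suml raddf_sum; apply: eq_bigr => k _ /=.
  rewrite mulmxDl mxtraceD -!mulmxA !(mxtrace_mulC (_ k)^T) -hd.
  by rewrite /mxtrace !big_ord1.
have := @Num.Theory.leif_AGM R 'I_n predT d.
rewrite card_ord => /(_ (fun i _ => d0 i))[].
by rewrite expr_div_n.
Qed.

(** [det_le_trace] for A A^T, whose trace is the squared Hilbert-Schmidt norm of A. *)
Lemma det_gram_le n (A : 'M[R]_n) :
  (\det A) ^+ 2 <= ((\sum_i \sum_j A i j ^+ 2) / n%:R) ^+ n.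
Proof.
have -> : \det A ^+ 2 = \det (A *m A^T) by rewrite det_mulmx det_tr expr2.
apply: le_trans (det_le_trace _ _) _; first by rewrite trmx_mul trmxK.
  move=> x; rewrite mulmxA -mulmxA -trmx_mul mxE; apply: sumr_ge0 => i _.
  by rewrite [X in _ * X]mxE -expr2 sqr_ge0.
rewrite le_eqVlt; apply/orP; left; apply/eqP; congr ((_ / _) ^+ _).
apply: eq_bigr => i _; rewrite mxE; apply: eq_bigr => j _.
by rewrite mxE expr2.
Qed.
End det_ineq.

(** * Integrals against an isotropic weight *)

Section weighted_integral.
Context d (T : measurableType d) (R : realType).
Variable mu : {measure set T -> \bar R}.
Variable rho : T -> R.
Hypothesis rho_ge0 : forall s, 0 <= rho s.
Hypothesis rho_int : mu.-integrable setT (EFin \o rho).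

(** This class is closed under sums and products, and its members are integrable against the
    integrable weight [rho]; the integrands of the transport argument belong to it. *)
Definition bounded_measurable (f : T -> R) :=
  measurable_fun setT f /\ exists K, forall s, `|f s| <= K.

Local Notation bm := bounded_measurable.

Definition wint (f : T -> R) : R := \int[mu]_s (rho s * f s).

Lemma bmM f g : bm f -> bm g -> bm (fun s => f s * g s).
Proof.
move=> [mf [K hK]] [mg [L hL]]; split; first exact: measurable_funM.
by exists (K * L) => s; rewrite normrM ler_pM.
Qed.

Lemma bmD f g : bm f -> bm g -> bm (fun s => f s + g s).
Proof.
move=> [mf [K hK]] [mg [L hL]]; split; first exact: measurable_funD.
by exists (K + L) => s; rewrite (le_trans (ler_normD _ _))// lerD.
Qed.

Lemma bmC c : bm (fun=> c).
Proof. by split => //; exists `|c|. Qed.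

Lemma bmZ c f : bm f -> bm (fun s => c * f s).
Proof. by move=> bf; apply: bmM => //; exact: bmC. Qed.

Lemma bmB f g : bm f -> bm g -> bm (fun s => f s - g s).
Proof.
move=> bf bg; have := bmD bf (bmZ (-1) bg).
by under [X in bm X -> _]eq_fun do rewrite mulN1r.
Qed.

Lemma bm_sum I (r : seq I) (f : I -> T -> R) : (forall i, bm (f i)) ->
  bm (fun s => \sum_(i <- r) f i s).
Proof.
move=> bf; elim: r => [|i r IH].
  by under eq_fun do rewrite big_nil; exact: bmC.
by under eq_fun do rewrite big_cons; exact: bmD.
Qed.

Lemma bmX f k : bm f -> bm (fun s => f s ^+ k).
Proof.
move=> bf; elim: k => [|k IH]; first by under eq_fun do rewrite expr0; exact: bmC.
by under eq_fun do rewrite exprS; exact: bmM.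
Qed.

Lemma bm_comp f (h : R -> R) (K L : R) : bm f -> measurable_fun setT h ->
  (forall s, `|f s| <= K) -> (forall x, `|x| <= K -> `|h x| <= L) ->
  bm (h \o f).
Proof.
move=> [mf _] mh fK hK; split; first exact: measurableT_comp.
by exists L => s; exact: hK.
Qed.

Lemma wint_integrable f : bm f -> mu.-integrable setT (EFin \o (fun s => rho s * f s)).
Proof.
move=> [mf [K hK]].
have mr : measurable_fun setT rho by case/integrableP : rho_int => /measurable_EFinP.
apply: (@le_integrable _ _ _ _ _ measurableT _ (fun s => (K * rho s)%:E)).
- by apply/measurable_EFinP; exact: measurable_funM.
- move=> s _ /=; rewrite lee_fin normrM (ger0_norm (rho_ge0 s)) mulrC.
  rewrite [leRHS]ger0_norm; first exact: ler_wpM2r.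
  by rewrite mulr_ge0// (le_trans _ (hK s)).
- have := @integrableZl _ _ _ mu _ measurableT K _ rho_int.
  by apply: eq_integrable => // s _.
Qed.

Lemma wintD f g : bm f -> bm g -> wint (fun s => f s + g s) = wint f + wint g.
Proof.
move=> bf bg; rewrite /wint -RintegralD//; [|exact: wint_integrable..].
by apply: eq_Rintegral => s _; rewrite mulrDr.
Qed.

Lemma wintZ c f : bm f -> wint (fun s => c * f s) = c * wint f.
Proof.
move=> bf; rewrite /wint -RintegralZl//; last exact: wint_integrable.
by apply: eq_Rintegral => s _; rewrite mulrCA.
Qed.

Lemma wintB f g : bm f -> bm g -> wint (fun s => f s - g s) = wint f - wint g.
Proof.
move=> bf bg; rewrite -[- wint g]mulN1r -wintZ// -wintD//; last exact: bmZ.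
by congr wint; apply/funext => s; rewrite mulN1r.
Qed.

Lemma le_wint f g : bm f -> bm g -> (forall s, f s <= g s) -> wint f <= wint g.
Proof.
move=> bf bg fg; apply: le_Rintegral => //; [exact: wint_integrable..|].
by move=> s _; rewrite ler_wpM2l.
Qed.

Lemma wint0 : wint (fun=> 0) = 0.
Proof.
have h := wintZ 0 (bmC 1); rewrite [RHS]mul0r in h; rewrite -[RHS]h.
by congr wint; apply/funext => s; rewrite mul0r.
Qed.

Lemma wint_sum I (r : seq I) (f : I -> T -> R) : (forall i, bm (f i)) ->
  wint (fun s => \sum_(i <- r) f i s) = \sum_(i <- r) wint (f i).
Proof.
move=> bf; elim: r => [|i r IH].
  by rewrite big_nil -[RHS]wint0; congr wint; apply/funext => s; rewrite big_nil.
rewrite big_cons -IH -wintD//; last exact: bm_sum.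
by congr wint; apply/funext => s; rewrite big_cons.
Qed.

Lemma wint_cst c : wint (fun=> c) = c * wint (fun=> 1).
Proof.
by rewrite -wintZ; [congr wint; apply/funext => s; rewrite mulr1|exact: bmC].
Qed.

Section frame.
Variables (n : nat) (u : 'I_n -> T -> R).
Hypothesis mu_ : forall i, measurable_fun setT (u i).
Hypothesis u1 : forall s, \sum_i u i s ^+ 2 = 1.

Definition ip (x : 'rV[R]_n) s := \sum_i x 0 i * u i s.

Lemma u_le1 i s : `|u i s| <= 1.
Proof.
rewrite -(@expr_le1 _ 2)// -normrX ger0_norm ?sqr_ge0// -(u1 s) (bigD1 i)//= lerDl.
by apply: sumr_ge0 => j _; exact: sqr_ge0.
Qed.

Lemma bmu i : bm (u i).
Proof. by split => //; exists 1 => s; exact: u_le1. Qed.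

Lemma bm_ip x : bm (ip x).
Proof. by apply: bm_sum => i; apply: bmZ; exact: bmu. Qed.

Lemma ip_le x s : `|ip x s| <= \sum_i `|x 0 i|.
Proof.
rewrite (le_trans (ler_norm_sum _ _ _))//; apply: ler_sum => i _.
by rewrite normrM ler_piMr// u_le1.
Qed.

(** Cauchy-Schwarz against the unit vector u(s), read off from |x - <x,u> u|^2 >= 0. *)
Lemma ip_sqr_le x s : ip x s ^+ 2 <= \sum_i x 0 i ^+ 2.
Proof.
pose v : 'rV[R]_n := \row_i u i s.
have : 0 <= \sum_i (x 0 i - ip x s * u i s) ^+ 2 by apply: sumr_ge0 => i _; exact: sqr_ge0.
have -> : \sum_i (x 0 i - ip x s * u i s) ^+ 2 =
   \sum_i (x 0 i ^+ 2 + (ip x s) ^+ 2 * (u i s ^+ 2) - 2 * ip x s * (x 0 i * u i s)).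
  by apply: eq_bigr => i _; ring.
rewrite sumrB big_split/= -mulr_sumr u1 -mulr_sumr -/(ip x s) mulr1.
by move=> h; move: h; nra.
Qed.

Lemma ipD x y s : ip (x + y) s = ip x s + ip y s.
Proof. by rewrite /ip -big_split/=; apply: eq_bigr => i _; rewrite !mxE mulrDl. Qed.

Lemma ipZ c x s : ip (c *: x) s = c * ip x s.
Proof. by rewrite /ip mulr_sumr; apply: eq_bigr => i _; rewrite !mxE mulrA. Qed.

Lemma ipB x y s : ip (x - y) s = ip x s - ip y s.
Proof. by rewrite ipD -scaleN1r ipZ mulN1r. Qed.

(** Weighted second moments of u: the identity for t = 1, and the derivative of the transport map at
    x for t = tau'(<x,u>). *)
Definition frame_mx (t : T -> R) : 'M[R]_n :=
  \matrix_(i, j) wint (fun s => t s * (u i s * u j s)).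

Lemma wint_ip (f : T -> R) x : bm f ->
  wint (fun s => f s * ip x s) = \sum_i x 0 i * wint (fun s => f s * u i s).
Proof.
move=> bf; transitivity (wint (fun s => \sum_i x 0 i * (f s * u i s))).
  by congr wint; apply/funext => s; rewrite mulr_sumr; apply: eq_bigr => i _; rewrite mulrCA.
rewrite wint_sum => [|i]; last by apply/bmZ/bmM => //; exact: bmu.
by apply: eq_bigr => i _; rewrite wintZ//; apply: bmM => //; exact: bmu.
Qed.

Lemma wint_ip_ip (t : T -> R) x y : bm t ->
  wint (fun s => t s * (ip x s * ip y s)) = (x *m frame_mx t *m y^T) 0 0.
Proof.
move=> bt; transitivity (wint (fun s => (t s * ip x s) * ip y s)).
  by congr wint; apply/funext => s; rewrite mulrA.
rewrite wint_ip; last by apply: bmM => //; exact: bm_ip.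
rewrite mxE; apply: eq_bigr => j _; rewrite mxE [y^T _ _]mxE mulrC; congr (_ * _).
transitivity (wint (fun s => (t s * u j s) * ip x s)).
  by congr wint; apply/funext => s; rewrite mulrAC.
rewrite wint_ip; last by apply: bmM => //; exact: bmu.
apply: eq_bigr => i _; rewrite mxE; congr (_ * wint _).
by apply/funext => s; rewrite -mulrA [u j s * _]mulrC.
Qed.

Hypothesis iso : forall i j, wint (fun s => u i s * u j s) = (i == j)%:R.

Lemma frame_mx1 : frame_mx (fun=> 1) = 1%:M.
Proof.
apply/matrixP => i j; rewrite !mxE -iso; congr wint.
by apply/funext => s; rewrite mul1r.
Qed.

Lemma wint_ip2 x y : wint (fun s => ip x s * ip y s) = (x *m y^T) 0 0.
Proof.
rewrite -[x in RHS]mulmx1 -frame_mx1 -wint_ip_ip; last exact: bmC.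
by congr wint; apply/funext => s; rewrite mul1r.
Qed.

Lemma dot_row (x : 'rV[R]_n) : (x *m x^T) 0 0 = \sum_i x 0 i ^+ 2.
Proof. by rewrite mxE; apply: eq_bigr => i _; rewrite mxE expr2. Qed.

Lemma wint_ip_sqr x : wint (fun s => ip x s ^+ 2) = \sum_i x 0 i ^+ 2.
Proof. by rewrite -dot_row -wint_ip2. Qed.

(** The trace of the isotropy condition. *)
Lemma wint1 : wint (fun=> 1) = n%:R.
Proof.
transitivity (wint (fun s => \sum_i u i s * u i s)).
  by congr wint; apply/funext => s; rewrite -(u1 s); apply: eq_bigr => i _; rewrite expr2.
rewrite wint_sum => [|i]; last by apply: bmM; exact: bmu.
rewrite (eq_bigr (fun=> 1)) => [|i _]; last by rewrite iso eqxx.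
by rewrite sumr_const card_ord.
Qed.

Lemma tr_frame_mx t : (frame_mx t)^T = frame_mx t.
Proof.
apply/matrixP => i j; rewrite !mxE; congr wint; apply/funext => s.
by rewrite [u i s * _]mulrC.
Qed.

(* With an orthonormal basis [e_k] diagonalizing [frame_mx t], the k-th
   eigenvalue is the mean of [t] for the probability weight [rho <e_k, u>^2],
   so concavity of [ln] applies; [e_k = a k + i b k] is complex. *)
Lemma det_frame_mx_ge (t : T -> R) (m : R) : bm t -> 0 < m -> (forall s, m <= t s) ->
  0 < \det (frame_mx t) /\ wint (fun s => ln (t s)) <= ln (\det (frame_mx t)).
Proof.
move=> bt m0 mt; have [K tK] := bt.2.
have [dd [a [b [-> hd h1 hs]]]] := sym_spectral (tr_frame_mx t).
pose q k s := ip (a k) s ^+ 2 + ip (b k) s ^+ 2.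
have bq k : bm (q k) by apply: bmD; apply: bmX; exact: bm_ip.
have btq k : bm (fun s => t s * q k s) by exact: bmM.
have q1 k : wint (q k) = 1 by rewrite wintD ?wint_ip_sqr -?dot_row ?h1//; apply: bmX; exact: bm_ip.
have qd k : wint (fun s => t s * q k s) = dd k.
  rewrite -hd -!wint_ip_ip// -wintD; [|by do !apply: bmM => //; exact: bm_ip..].
  by congr wint; apply/funext => s; rewrite mulrDr !expr2.
have q0 k s : 0 <= q k s by rewrite addr_ge0 ?sqr_ge0.
(* The resolution of the identity, tested on the unit vector u(s). *)
have sq s : \sum_k q k s = 1.
  pose v : 'rV[R]_n := \row_i u i s.
  have ipE x : ip x s = (x *m v^T) 0 0 by rewrite mxE; apply: eq_bigr => i _; rewrite !mxE.
  transitivity ((v *m (\sum_k ((a k)^T *m a k + (b k)^T *m b k)) *m v^T) 0 0).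
    rewrite mulmx_sumr mulmx_suml summxE; apply: eq_bigr => k _.
    rewrite mulmxDr mulmxDl mxE /q !ipE !mulmxA.
    have tr x : v *m x^T = (x *m v^T)^T by rewrite trmx_mul trmxK.
    rewrite !tr -!mulmxA.
    by rewrite ![(_^T *m _) 0 0]mxE !big_ord1 [(_ k *m _)^T 0 0]mxE [(b k *m _)^T 0 0]mxE -!expr2.
  by rewrite hs mulmx1 dot_row -(u1 s); apply: eq_bigr => i _; rewrite mxE.
have d0 k : 0 < dd k.
  apply: (lt_le_trans m0); rewrite -qd -[m]mulr1 -(q1 k) -wintZ//.
  by apply: le_wint => //; [exact: bmZ|move=> s; rewrite ler_wpM2r].
split; first by apply: prodr_gt0.
have K0 s : `|t s| <= K by [].
have tp s : 0 < t s by exact: lt_le_trans (mt s).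
have bln : bm (fun s => ln (t s)).
  split; first by apply: (measurableT_comp (@measurable_ln R)); exact: bt.1.
  exists (`|ln m| + `|ln K|) => s /=.
  have lm : ln m <= ln (t s) by rewrite ler_ln// posrE.
  have lK : ln (t s) <= ln K.
    have tsK : t s <= K by rewrite (le_trans (ler_norm _)).
    by rewrite ler_ln// posrE// (lt_le_trans (tp s)).
  have hK := ler_norm (ln K); have pK := normr_ge0 (ln K).
  have pm := normr_ge0 (ln m); have hm := ler_norm (- ln m); rewrite normrN in hm.
  by rewrite ler_norml; apply/andP; split; lra.
have lnprod : ln (\prod_k dd k) = \sum_k ln (dd k).
  apply/expR_inj; rewrite lnK ?posrE ?prodr_gt0// expR_sum.
  by apply: eq_bigr => k _; rewrite lnK ?posrE.
rewrite lnprod.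
have -> : wint (fun s => ln (t s)) = \sum_k wint (fun s => q k s * ln (t s)).
  rewrite -wint_sum => [|k]; last exact: bmM.
  by congr wint; apply/funext => s; rewrite -mulr_suml sq mul1r.
apply: ler_sum => k _.
(* The tangent of ln at [dd k], times [q k]. Since [q k] has mass 1 and gives [t] the mean [dd k],
   it integrates to exactly ln (dd k). *)
pose g s := (ln (dd k) - 1) * q k s + (dd k)^-1 * (t s * q k s).
apply: (@le_trans _ _ (wint g)).
  apply: le_wint; [exact: bmM|by apply: bmD; exact: bmZ|] => s; rewrite /g.
  have : ln (t s / dd k) <= t s / dd k - 1.
    have := @le_ln1Dx R (t s / dd k - 1).
    rewrite [1 + _]addrC subrK; apply; rewrite ltrBrDl subrr.
    by rewrite divr_gt0.
  rewrite ln_div ?posrE// => h.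
  have := q0 k s; set qq := q k s => hq.
  have -> : (ln (dd k) - 1) * qq + (dd k)^-1 * (t s * qq) = qq * ((ln (dd k) - 1) + t s / dd k) by ring.
  by apply: ler_wpM2l => //; lra.
rewrite wintD; [|exact: bmZ..].
by rewrite !wintZ// q1 qd mulr1 mulVf ?gt_eqF// subrK.
Qed.

End frame.
End weighted_integral.

(** * Transport between densities on the line *)

Section primitive.
Variable R : realType.
Variable f : R -> R.
Notation leb := (@lebesgue_measure R).
Hypothesis cf : continuous f.
Hypothesis f_gt0 : forall x, 0 < f x.
Hypothesis f_int : leb.-integrable setT (EFin \o f).

Definition prim x := \int[leb]_(t in `]-oo, x]) f t.
Definition mass := \int[leb]_t f t.

Lemma prim_derive (x : R) : is_derive x (1 : R) prim (f x).
Proof.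
have x1 : x < x + 1 by rewrite ltrDl.
have [|||h1 h2] := @continuous_FTC1 R f -oo%O x (x + 1) x1.
- exact: integrableS f_int.
- by rewrite ltNyr.
- exact: cf.
- by rewrite -h2 derive1E; apply: DeriveDef.
Qed.

Lemma prim_cts : continuous prim.
Proof. by move=> x; apply/differentiable_continuous/derivable1_diffP; case: (prim_derive x). Qed.

Lemma prim_lt a b : a < b -> prim a < prim b.
Proof.
move=> ab; have [||c _ h] := @MVT R prim f a b ab.
- by move=> x _; exact: prim_derive.
- exact/continuous_subspaceT/prim_cts.
- by rewrite -subr_gt0 h mulr_gt0// subr_gt0.
Qed.

Lemma prim_inj : injective prim.
Proof. by move=> a b; case: (ltgtP a b) => // /prim_lt h1 h2; rewrite h2 ltxx in h1. Qed.

Lemma prim_compl x : prim x + \int[leb]_(t in `]x, +oo[) f t = mass.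
Proof.
rewrite /prim /mass -Rintegral_setU//=.
- congr Rintegral; first by rewrite -itv_bndbnd_setU// set_itvNyy.
- by rewrite -itv_bndbnd_setU// set_itvNyy.
- apply/disj_set2P; rewrite -subset0 => y /=; rewrite !in_itv/= andbT => -[h1 h2].
  by rewrite ltNge h1 in h2.
Qed.

Let mf D : measurable D -> measurable_fun D (EFin \o f).
Proof. by move=> mD; apply: measurable_funS (measurable_int _ f_int). Qed.

Let cvg_incr (E : nat -> set R) : (forall i, measurable (E i)) ->
  nondecreasing_seq E -> \bigcup_i E i = setT ->
  (\int[leb]_(t in E i) f t) @[i --> \oo] --> mass.
Proof.
move=> mE ndE E1.
have h0 (i : nat) x : E i x -> (0 <= (EFin \o f) x)%E by move=> _; rewrite lee_fin ltW.
have := @ge0_nondecreasing_set_cvg_integral _ (measurableTypeR R) R E (EFin \o f) lebesgue_measure ndE mE (fun i => mf (mE i)) h0.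
rewrite E1 => h.
apply: fine_cvg; rewrite /mass /Rintegral fineK //.
exact: integrable_fin_num.
Qed.

Lemma prim_lo e : 0 < e -> exists x, prim x < e.
Proof.
move=> e0; have : (\int[leb]_(t in `]- (i%:R), +oo[) f t) @[i --> \oo] --> mass.
  apply: (cvg_incr (E := fun i => `]- (i%:R), +oo[%classic)) => //.
    move=> i j ij; rewrite subsetEset; apply: subset_itvr; rewrite bnd_simp.
    by rewrite lerN2 ler_nat.
  apply/seteqP; split => // x _; exists (Num.bound `|x|) => //=.
  by rewrite in_itv/= andbT ltrNl (le_lt_trans (ler_norm _))// normrN archi_boundP ?normr_ge0.
move/cvgrPdist_lt => /(_ _ e0)[N _ /(_ N (leqnn _))] /= h.
exists (- N%:R); move: h; rewrite -(prim_compl (- N%:R)) addrK.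
exact: le_lt_trans (ler_norm _).
Qed.

Lemma prim_hi e : 0 < e -> exists x, mass - e < prim x.
Proof.
move=> e0; have : (\int[leb]_(t in `]-oo, i%:R]) f t) @[i --> \oo] --> mass.
  apply: (cvg_incr (E := fun i => `]-oo, i%:R]%classic)) => //.
    by move=> i j ij; rewrite subsetEset; apply: subset_itvl; rewrite bnd_simp ler_nat.
  apply/seteqP; split => // x _; exists (Num.bound `|x|) => //=.
  by rewrite in_itv/= ltW// (le_lt_trans (ler_norm _))// archi_boundP ?normr_ge0.
move/cvgrPdist_lt => /(_ _ e0)[N _ /(_ N (leqnn _))] /= h.
exists N%:R; move: (le_lt_trans (ler_norm _) h); rewrite /prim; lra.
Qed.

Lemma prim_gt0 x : 0 < prim x.
Proof.
apply: le_lt_trans (prim_lt (_ : x - 1 < x)); last by rewrite ltrBlDr ltrDl.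
by apply: Rintegral_ge0 => y _; rewrite ltW.
Qed.

Lemma prim_lt_mass x : prim x < mass.
Proof.
apply: lt_le_trans (prim_lt (_ : x < x + 1)) _; first by rewrite ltrDl.
by rewrite -(prim_compl (x + 1)) lerDl; apply: Rintegral_ge0 => y _; rewrite ltW.
Qed.

Lemma mass_gt0 : 0 < mass.
Proof. exact: lt_trans (prim_gt0 0) (prim_lt_mass 0). Qed.

Lemma prim_surj v : 0 < v < mass -> exists x, prim x = v.
Proof.
move=> /andP[v0 vm]; have [a ha] := prim_lo v0.
have [b] : exists b, mass - (mass - v) < prim b by apply: prim_hi; rewrite subr_gt0.
rewrite opprB addrC subrK => hb.
have ab : a <= b by rewrite leNgt; apply/negP => /prim_lt; lra.
have [||c _ h] := @IVT R prim a b v ab; last by exists c.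
- exact/continuous_subspaceT/prim_cts.
- by rewrite ge_min le_max (ltW ha) (ltW hb) orbT.
Qed.

End primitive.

Section transport.
Variable R : realType.
Notation leb := (@lebesgue_measure R).

(** The monotone rearrangement: tau x is the point up to which g has the same proportion of its mass
    as f has up to x. The derivative is that of an inverse function. *)
Lemma transport_exists (f g : R -> R) : continuous f -> (forall x, 0 < f x) ->
  leb.-integrable setT (EFin \o f) -> continuous g -> (forall x, 0 < g x) ->
  leb.-integrable setT (EFin \o g) ->
  exists tau : R -> R, forall x : R,
    is_derive x (1 : R) tau (mass g / mass f * (f x / g (tau x))).
Proof.
move=> cf f0 If cg g0 Ig.
pose c := mass g / mass f.
have mf0 := mass_gt0 cf f0 If; have mg0 := mass_gt0 cg g0 Ig.
have c0 : 0 < c by rewrite divr_gt0.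
(* An inverse of [prim g]; the default 0 concerns only v outside ]0, mass g[, and c * prim f x
   always lies inside. *)
pose h v := xget 0 [set y | prim g y = v].
have hK : cancel (prim g) h.
  move=> y; rewrite /h; apply: (prim_inj cg g0 Ig).
  by apply: (@xgetPex _ 0 [set z | prim g z = prim g y]); exists y.
have ex x : exists y, prim g y = c * prim f x.
  apply: prim_surj => //; rewrite mulr_gt0 ?prim_gt0//=.
  by rewrite /c mulrAC ltr_pdivrMr// ltr_pM2l// prim_lt_mass.
exists (fun x => h (c * prim f x)) => x.
have [y hy] := ex x.
have d1 : is_derive (c * prim f x) 1 h (g y)^-1.
  rewrite -hy; apply: is_derive_inverse.
  - exact: (@filterE _ (nbhs y) _ _ hK).
  - exact: (@filterE _ (nbhs y) _ _ (prim_cts cg Ig)).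
  - exact: prim_derive.
  - by rewrite gt_eqF.
have d2 : is_derive x 1 (fun x => c * prim f x) (c * f x).
  have d3 := prim_derive cf If x.
  have := @is_deriveZ R R^o R^o (prim f) c x 1 (f x) d3.
  by [].
have := is_derive1_comp (f := h) (g := fun x => c * prim f x) d1 d2.
rewrite -/c; set D := _^-1 * _; have -> : D = c * (f x / g (h (c * prim f x))).
  by rewrite /D -hy hK [(g y)^-1 * _]mulrC mulrA.
by [].
Qed.

(** Uniform continuity with only x confined to [-L, L]: the covering uses neighbourhoods of half the
    radius of continuity, which leaves room for y outside the segment. *)
Lemma unif_cts_segment (f : R -> R) (L e : R) : continuous f -> 0 < e ->
  exists2 dl : R, 0 < dl & forall x y, `|x| <= L -> `|y - x| < dl ->
    `|f y - f x| < e.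
Proof.
move=> cf e0.
pose P (dl : R) (x : R) := forall y, `|y - x| < dl -> `|f y - f x| < e.
have /compact_near_coveringP cpt := @segment_compact R (- L) L.
have : \forall dl \near (0 : R)^'+, `[- L, L] `<=` P dl.
  apply: cpt => x _.
  have /cvgrPdist_lt /(_ _ (divr_gt0 e0 (ltr0n R 2))) := cf x.
  move=> /nbhs_ballP[r /= r0 hr].
  exists (ball x (r / 2), [set dl | dl < r / 2]); first split => /=.
  - by apply: nbhsx_ballx; rewrite divr_gt0.
  - by apply: nbhs_right_lt; rewrite divr_gt0.
  - move=> [x' dl] [/= bx dlr] y yx.
    have h1 : `|f x - f x'| < e / 2.
      by apply: hr; apply: le_ball bx; lra.
    have h2 : `|f x - f y| < e / 2.
      apply: hr; rewrite /ball/=.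
      have := ler_distD x' x y; move: bx; rewrite /ball/= => bx.
      rewrite (distrC x' y) => h; rewrite (le_lt_trans h)// [ltRHS](splitr r).
      by rewrite ltrD// (lt_trans yx).
    have := ler_distD (f x) (f y) (f x').
    rewrite (distrC (f y) (f x)) => h; rewrite (le_lt_trans h)// [ltRHS](splitr e).
    by rewrite ltrD.
move=> h; near (0 : R)^'+ => dl; exists dl => // x y xL yx.
by have := near h dl; apply => //=; rewrite in_itv/= -ler_norml.
Unshelve. all: by end_near. Qed.

(* One-dimensional transport onto the Gaussian: the estimates are uniform on
   bounded sets, and only these survive in the change of variables. *)
Lemma transport_bounds (tau dtau : R -> R) (L e : R) :
  (forall x : R, is_derive x (1 : R) tau (dtau x)) -> continuous dtau ->
  (forall x, 0 < dtau x) -> 0 <= L -> 0 < e ->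
  exists m K dl : R, [/\ 0 < m, 0 < dl,
   forall x, `|x| <= L -> m <= dtau x <= K /\ `|tau x| <= K,
   forall x y, `|x| <= L -> `|y| <= L -> m * (y - x) ^+ 2 <= (tau y - tau x) * (y - x) &
   forall x y, `|x| <= L -> `|y - x| < dl ->
     `|tau y - tau x - dtau x * (y - x)| <= e * `|y - x| ].
Proof.
move=> dt cd d0 L0 e0.
have LL : - L <= L by rewrite ge0_cp.
have ct : continuous tau.
  by move=> x; apply/differentiable_continuous/derivable1_diffP; case: (dt x).
have [m0 _ hm] := EVT_min LL (continuous_subspaceT cd).
have [M0 _ hM] := EVT_max LL (continuous_subspaceT cd).
have [t0 _ ht0] := EVT_min LL (continuous_subspaceT ct).
have [t1 _ ht1] := EVT_max LL (continuous_subspaceT ct).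
have [dl dl0 hdl] := unif_cts_segment L cd e0.
have inL x : `|x| <= L -> x \in `[- L, L] by rewrite in_itv/= -ler_norml.
have mvt x y : exists2 c, (x <= c <= y) || (y <= c <= x) & tau y - tau x = dtau c * (y - x).
  have aux a b : a <= b -> exists2 c, a <= c <= b & tau b - tau a = dtau c * (b - a).
    move=> ab; have [|c] := @MVT_segment R tau dtau a b ab (fun x _ => dt x).
      exact: continuous_subspaceT.
    by rewrite in_itv/= => cab h; exists c.
  have [/aux[c h1 h2]|/ltW/aux[c h1 h2]] := leP x y; first by exists c => //; rewrite h1.
  exists c; first by rewrite h1 orbT.
  by rewrite -opprB h2 -mulrN opprB.
exists (dtau m0), (dtau M0 + (`|tau t0| + `|tau t1|)), dl; split => //.
- move=> x /inL xL; rewrite hm//=; split; first by rewrite (le_trans (hM _ xL))// lerDl addr_ge0.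
  have h1 := ht0 _ xL; have h2 := ht1 _ xL.
  have h3 := ler_norm (tau t1); have h4 := ler_norm (- tau t0); rewrite normrN in h4.
  have h5 := d0 M0; have h6 := normr_ge0 (tau t1); have h7 := normr_ge0 (tau t0).
  by rewrite ler_norml; apply/andP; split; lra.
- move=> x y /inL xL /inL yL; have [c cxy ->] := mvt x y.
  rewrite -mulrA -expr2 ler_wpM2r ?sqr_ge0// hm//.
  move: xL yL cxy; rewrite !in_itv/= => /andP[? ?] /andP[? ?] /orP[] /andP[? ?]; apply/andP; split; lra.
- move=> x y xL yx; have [c cxy ->] := mvt x y.
  rewrite -mulrBl normrM ler_wpM2r// ltW// hdl// (le_lt_trans _ yx)//.
  by case/orP: cxy => /andP[h1 h2]; [rewrite !ger0_norm; lra|rewrite !ler0_norm; lra].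
Qed.
End transport.

(** * The densities exp(-|t|^r) *)

Section pexp.
Variable (R : realType) (r : R).
Hypothesis r1 : 1 <= r.
Notation leb := (@lebesgue_measure R).

Lemma cts_abs_powR : continuous (fun x : R => `|x| `^ r).
Proof.
have r0 : 0 < r by exact: lt_le_trans r1.
(* At 0 the power is compared with |y|, as |y|^r <= |y| for |y| <= 1; elsewhere it is
   differentiable. *)
move=> x; have [->|x0] := eqVneq x 0.
  rewrite /continuous_at normr0 powR0 ?gt_eqF//.
  apply/cvgrPdist_lt => e e0; near=> y.
  rewrite sub0r normrN ger0_norm ?powR_ge0//.
  have [->|y0] := eqVneq y 0; first by rewrite normr0 powR0 ?gt_eqF.
  have y1 : `|y| <= 1.
    near: y; apply/nbhs_ballP; exists 1 => //= y; rewrite /ball/= sub0r normrN; exact: ltW.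
  have ye : `|y| < e.
    by near: y; apply/nbhs_ballP; exists e => //= y; rewrite /ball/= sub0r normrN.
  by rewrite (le_lt_trans _ ye)// ge1r_powR// y1 normr_gt0 y0.
apply: (@continuous_comp _ _ _ (fun x : R => `|x|) (fun y => y `^ r)).
  exact: norm_continuous.
apply/differentiable_continuous/derivable1_diffP; apply: derivable_powR.
by rewrite in_itv/= andbT normr_gt0.
Unshelve. all: by end_near. Qed.

Definition pexp (x : R) := expR (- (`|x| `^ r)).

Lemma pexp_gt0 x : 0 < pexp x. Proof. exact: expR_gt0. Qed.

Lemma cts_pexp : continuous pexp.
Proof.
move=> x; apply: (@continuous_comp _ _ _ (fun x : R => - (`|x| `^ r)) expR); last exact: continuous_expR.
by apply: cvgN; exact: cts_abs_powR.
Qed.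

Lemma measurable_pexp : measurable_fun setT pexp.
Proof. by apply: continuous_measurable_fun; exact: cts_pexp. Qed.

(** The function that dominates [pexp]: the factor expR 1 accounts for |x|^r >= |x| - 1. On the
    half-line, exp(-x) is the exponential density of rate 1. *)
Let absexp_int : leb.-integrable setT (fun x => (expR 1 * expR (- `|x|))%:E).
Proof.
have mf : measurable_fun setT (fun x : R => expR (- `|x|)).
  by apply: measurableT_comp => //; apply: measurableT_comp => //; exact: measurableT_comp.
have : leb.-integrable setT (EFin \o (fun x => expR (- `|x|))).
  apply/integrableP; split; first exact/measurable_EFinP.
  under eq_integral do rewrite /= ger0_norm ?expR_ge0//.
  rewrite (@ge0_symfun_integralT R (fun x => expR (- `|x|))) //.
  - rewrite [X in (_ * X)%E](_ : _ = \int[leb]_(x in [set x | (0 <= x)%R]) (exponential_pdf 1 x)%:E)%E; last first.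
      apply: eq_integral => x; rewrite inE/= => x0.
      by rewrite exponential_pdfE// ger0_norm// mul1r mulN1r.
    rewrite lte_mul_pinfty//.
    apply: (@le_lt_trans _ _ 1%E); last exact: ltry.
    rewrite -[leRHS](@integral_exponential_pdf R 1)//.
    apply: ge0_subset_integral => //.
      by rewrite -set_itvcy.
      by apply/measurable_EFinP; exact: measurable_exponential_pdf.
    by move=> x _; rewrite lee_fin exponential_pdf_ge0.
  - move=> x; apply: (@continuous_comp _ _ _ (fun x : R => - `|x|) expR); last exact: continuous_expR.
    by apply: cvgN; exact: norm_continuous.
  - by move=> x; rewrite /= normrN.
move=> /(@integrableZl _ _ _ leb _ measurableT (expR 1)).
by apply: eq_integrable => // x _.
Qed.

Lemma pexp_integrable : leb.-integrable setT (EFin \o pexp).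
Proof.
apply: le_integrable absexp_int => //; first by apply/measurable_EFinP; exact: measurable_pexp.
move=> x _ /=; rewrite lee_fin [leLHS]ger0_norm ?expR_ge0// [leRHS]ger0_norm ?mulr_ge0 ?expR_ge0//.
rewrite -expRD ler_expR.
rewrite lerNl opprD opprK.
have [x1|x1] := leP 1 `|x|.
  by rewrite (le_trans _ (le1r_powR x1 r1))// gerDr lerN10.
by rewrite (le_trans _ (powR_ge0 _ _))// addrC subr_le0 ltW.
Qed.

End pexp.

(** * Integration on R^n *)

Section affine1.
Variable R : realType.
Notation leb := (@lebesgue_measure R).
Local Open Scope ereal_scope.

Definition affine1 (a b : R) (x : measurableTypeR R) : measurableTypeR R := (a * x + b)%R.

Lemma measurable_affine1 (a b : R) : measurable_fun setT (affine1 a b).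
Proof. by apply: measurable_funD => //; exact: measurable_funM. Qed.

(** Both sides are measures in A and agree on the intervals ]u, v]. For a < 0 the preimage of such
    an interval is closed on the left instead, with the same length. *)
Lemma lebesgue_measure_affine (a b : R) (A : set (measurableTypeR R)) : a != 0%R -> measurable A ->
  `|a|%:E * leb (affine1 a b @^-1` A) = leb A.
Proof.
move=> a0 mA.
have [nu nuE] : exists nu : {measure set (measurableTypeR R) -> \bar R}, forall B, nu B = `|a|%:E * leb (affine1 a b @^-1` B).
  unshelve eexists (mscale (`|a|%:nng)%R (pushforward leb (affine1 a b))); first exact: measurable_affine1.
  by [].
rewrite -nuE; apply/esym; apply: lebesgue_measure_unique => //= _ [[u v]] _ <-.
rewrite nuE.
case: (ltgtP a 0%R) a0 => // [an|ap] _.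
- rewrite (_ : _ @^-1` _ = `[((v - b) / a)%R, ((u - b) / a)%R[%classic); last first.
    by apply/seteqP; split => x /=; rewrite /affine1 !in_itv/= ler_ndivrMr// ltr_ndivlMr// ltrBlDr lerBrDr (mulrC x) andbC.
  rewrite !lebesgue_measure_itv/= !lte_fin ltr_ndivrMr// divfK ?lt_eqF// ltrD2r.
  case: ifP => // uv; last by rewrite mule0.
  rewrite -!EFinB -EFinM ltr0_norm// -mulrBl; congr _%:E.
  by rewrite [X in (_ = - a * (X / a))%R](_ : _ = - (v - u))%R; [field; rewrite lt_eqF|ring].
- rewrite (_ : _ @^-1` _ = `]((u - b) / a)%R, ((v - b) / a)%R]%classic); last first.
    by apply/seteqP; split => x /=; rewrite /affine1 !in_itv/= ltr_pdivrMr// ler_pdivlMr// ltrBlDr lerBrDr (mulrC x).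
  rewrite !lebesgue_measure_itv/= !lte_fin ltr_pdivlMr// divfK ?gt_eqF// ltrD2r.
  case: ifP => // uv; last by rewrite mule0.
  rewrite -!EFinB -EFinM gtr0_norm// -mulrBl; congr _%:E.
  by field; rewrite gt_eqF.
Qed.

Lemma ge0_integral_affine (a b : R) (f : measurableTypeR R -> \bar R) : a != 0%R ->
  measurable_fun setT f -> (forall x, 0 <= f x) ->
  `|a|%:E * \int[leb]_x f (a * x + b)%R = \int[leb]_x f x.
Proof.
move=> a0 mf f0.
have mphi := measurable_affine1 a b.
rewrite -(ge0_integral_pushforward mphi leb measurableT mf)//.
rewrite (eq_measure_integral (mscale (`|a|^-1%:nng)%R leb)) => [|A mA _].
  by rewrite ge0_integral_mscale//= muleA -EFinM mulfV ?mul1e// normr_eq0.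
transitivity ((`|a|^-1)%:E * leb A); last by [].
by rewrite -(lebesgue_measure_affine b a0 mA) muleA -EFinM mulVf ?mul1e// normr_eq0.
Qed.
End affine1.

Section vectors.
Variable R : realType.
Notation tup n := (n.-tuple (measurableTypeR R)).

Definition rowt n (t : tup n) : 'rV[R]_n := \row_i tnth t i.
Definition trow n (x : 'rV[R]_n) : tup n := [tuple x 0 i | i < n].

Lemma trowK n : cancel (@trow n) (@rowt n).
Proof. by move=> x; apply/rowP => i; rewrite mxE tnth_mktuple. Qed.

(** Measures live on tuples and linear algebra on row vectors. Measurability on row vectors is
    therefore understood through the bijection [rowt]. *)
Definition vmeas n d (S : measurableType d) (f : 'rV[R]_n -> S) :=
  measurable_fun setT (f \o @rowt n).
Definition vset n (C : set 'rV[R]_n) := measurable (@rowt n @^-1` C).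

Lemma measurable_trow n d (T : measurableType d) (h : T -> 'rV[R]_n) :
  (forall i, measurable_fun setT (fun s => h s 0 i)) ->
  measurable_fun setT (@trow n \o h).
Proof.
move=> mh; apply/measurable_fun_tnthP => i.
by apply: eq_measurable_fun (mh i) => s _ /=; rewrite tnth_mktuple.
Qed.

Lemma vmeas_comp n d (T : measurableType d) d' (S : measurableType d')
    (h : T -> 'rV[R]_n) (f : 'rV[R]_n -> S) :
  (forall i, measurable_fun setT (fun s => h s 0 i)) -> vmeas f ->
  measurable_fun setT (f \o h).
Proof.
move=> mh mf; rewrite (_ : f \o h = (f \o @rowt n) \o (@trow n \o h)).
  by apply: measurableT_comp => //; exact: measurable_trow.
by apply/funext => s /=; rewrite trowK.
Qed.

Lemma measurable_coord n i : measurable_fun setT (fun t : tup n => rowt t 0 i : measurableTypeR R).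
Proof.
rewrite (_ : (fun t => _) = (@tnth _ _)^~ i); first exact: measurable_tnth.
by apply/funext => t; rewrite mxE.
Qed.

Lemma measurable_affine m n (A : 'M[R]_(m, n)) (c : 'rV[R]_n) d (T : measurableType d) (h : T -> 'rV[R]_m) i :
  (forall i, measurable_fun setT (fun s => h s 0 i)) ->
  measurable_fun setT (fun s => (h s *m A + c) 0 i).
Proof.
move=> mh; rewrite (_ : (fun s => _) = fun s => \sum_j (h s 0 j * A j i) + c 0 i).
  by apply: measurable_funD => //; apply: measurable_sum => j; exact: measurable_funM.
by apply/funext => s; rewrite !mxE.
Qed.

Lemma vmeas_affine m n (A : 'M[R]_(m, n)) (c : 'rV[R]_n) d (S : measurableType d) (f : 'rV[R]_n -> S) :
  vmeas f -> vmeas (fun x : 'rV[R]_m => f (x *m A + c)).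
Proof.
move=> mf; apply: (vmeas_comp (h := fun t => rowt t *m A + c)) => // i.
by apply: measurable_affine => j; exact: measurable_coord.
Qed.

Local Open Scope ereal_scope.

Definition vint n (f : 'rV[R]_n -> \bar R) := \int[lebesgue_tuple R n]_t f (rowt t).

Lemma eq_vint n (f g : 'rV[R]_n -> \bar R) : f =1 g -> vint f = vint g.
Proof. by move=> fg; apply: eq_integral => t _; rewrite fg. Qed.

Lemma rowt_cons n (x : measurableTypeR R) (t : tup n) :
  rowt [tuple of x :: t] = row_mx (x%:M : 'M[R]_1) (rowt t) :> 'rV[R]_(1 + n).
Proof.
apply/rowP => i; rewrite !mxE; case: splitP => j ij.
  by rewrite !mxE (ord1 j) eqxx mulr1n (_ : i = ord0)//; apply/val_inj; rewrite /= ij (ord1 j).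
rewrite mxE (_ : i = lift ord0 j) ?tnthS//.
by apply/val_inj; rewrite /= ij.
Qed.

Lemma measurable_row_mx n i :
  measurable_fun setT (fun z : measurableTypeR R * tup n =>
    (row_mx (z.1%:M : 'M[R]_1) (rowt z.2) : 'rV[R]_(1 + n)) 0%R i).
Proof.
case: (splitP i) => j ij.
  have -> : i = lshift n j by apply/val_inj.
  rewrite (_ : (fun z => _) = fst)//.
  by apply/funext => z; rewrite row_mxEl mxE (ord1 j).
have -> : i = rshift 1 j by apply/val_inj.
rewrite (_ : (fun z => _) = (fun t => rowt t 0%R j) \o snd).
  by apply: measurableT_comp => //; exact: measurable_coord.
by apply/funext => z; rewrite row_mxEr.
Qed.

Lemma vmeas_row_mx n d (S : measurableType d) (f : 'rV[R]_(1 + n) -> S) : vmeas f ->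
  measurable_fun setT (fun z : measurableTypeR R * tup n =>
    f (row_mx (z.1%:M : 'M[R]_1) (rowt z.2))).
Proof. by move=> mf; apply: (vmeas_comp (@measurable_row_mx n)). Qed.

Lemma vintS n (f : 'rV[R]_(1 + n) -> \bar R) : vmeas f -> (forall x, 0 <= f x) ->
  vint f = \int[(@lebesgue_measure R \x lebesgue_tuple R n)%E]_z f (row_mx (z.1%:M : 'M[R]_1) (rowt z.2)).
Proof.
move=> mf f0; rewrite /vint/=.
have mconsf : measurable_fun setT (fun xt : measurableTypeR R * tup n => [tuple of xt.1 :: xt.2]).
  exact: measurable_cons.
transitivity (\int[pushforward (@lebesgue_measure R \x lebesgue_tuple R n)%E (fun xt => [tuple of xt.1 :: xt.2])]_t f (rowt t)).
  by [].
rewrite ge0_integral_pushforward//.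
by apply: eq_integral => z _ /=; rewrite rowt_cons.
Qed.

Lemma vintSl n (f : 'rV[R]_(1 + n) -> \bar R) : vmeas f -> (forall x, 0 <= f x) ->
  vint f = \int[@lebesgue_measure R]_x vint (fun y => f (row_mx (x%:M : 'M[R]_1) y)).
Proof.
move=> mf f0; rewrite vintS// fubini_tonelli1//.
exact: vmeas_row_mx.
Qed.

Lemma vintSr n (f : 'rV[R]_(1 + n) -> \bar R) : vmeas f -> (forall x, 0 <= f x) ->
  vint f = vint (fun y => \int[@lebesgue_measure R]_x f (row_mx (x%:M : 'M[R]_1) y)).
Proof.
move=> mf f0; rewrite vintS// fubini_tonelli2//.
exact: vmeas_row_mx.
Qed.

Lemma vmeas_int_head n (f : 'rV[R]_(1 + n) -> \bar R) : vmeas f -> (forall x, 0 <= f x) ->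
  vmeas (fun y => \int[@lebesgue_measure R]_x f (row_mx (x%:M : 'M[R]_1) y)).
Proof.
move=> mf f0.
apply: (measurable_fun_fubini_tonelli_G (m1 := @lebesgue_measure R)) (vmeas_row_mx mf) _ => z; exact: f0.
Qed.

End vectors.

Section integration_vectors.
Variable R : realType.
Notation tup n := (n.-tuple (measurableTypeR R)).
Local Open Scope ereal_scope.

Lemma emeasurable_prod d (T : measurableType d) I (r : seq I) (h : I -> T -> \bar R) :
  (forall i, measurable_fun setT (h i)) ->
  measurable_fun setT (fun t => \prod_(i <- r) h i t).
Proof.
move=> mh; elim: r => [|i r IH].
  by under eq_fun do rewrite big_nil; exact: measurable_cst.
by under eq_fun do rewrite big_cons; exact: emeasurable_funM.
Qed.

Lemma vint_prod n (g : 'I_n -> measurableTypeR R -> \bar R) :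
  (forall i, measurable_fun setT (g i)) -> (forall i x, 0 <= g i x) ->
  vint (fun x => \prod_(i < n) g i (x 0%R i)) = \prod_(i < n) \int[@lebesgue_measure R]_x g i x.
Proof.
elim: n g => [|n IH] g mg g0.
  rewrite /vint/= (eq_integral (cst 1)) => [|t _]; last by rewrite big_ord0.
  by rewrite integral_cst//= mul1e diracT big_ord0.
have mt m (h : 'I_m -> measurableTypeR R -> \bar R) : (forall i, measurable_fun setT (h i)) ->
    vmeas (fun x : 'rV[R]_m => \prod_(i < m) h i (x 0%R i)).
  move=> mh; apply: (@emeasurable_prod _ _ _ _ (fun i t => h i (rowt t 0%R i))) => i.
  exact: (measurableT_comp (mh i) (measurable_coord i)).
rewrite (@vintSl R n) => [|//|x]; last 2 first.
- exact: mt.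
- by apply: prode_ge0 => i _.
have P0 : 0 <= vint (fun y : 'rV[R]_n => \prod_(i < n) g (lift ord0 i) (y 0%R i)).
  by apply: integral_ge0 => t _; apply: prode_ge0 => i _.
rewrite big_ord_recl/= -(IH (fun i => g (lift ord0 i)))//.
rewrite -(ge0_integralZr lebesgue_measure measurableT (mg ord0))//.
apply: eq_integral => x _.
rewrite -ge0_integralZl//; last 2 first.
- by apply: (mt n (fun i => g (lift ord0 i))).
- by move=> t _; apply: prode_ge0 => i _.
apply: eq_integral => t _; rewrite big_ord_recl.
have e0 : (row_mx (x%:M : 'M[R]_1) (rowt t) : 'rV[R]_(1 + n)) 0%R (ord0 : 'I_(1 + n)) = x.
  have -> : (ord0 : 'I_(1 + n)) = lshift n (ord0 : 'I_1) by apply/eqP.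
  by rewrite row_mxEl mxE eqxx mulr1n.
rewrite e0; congr (_ * _); apply: eq_bigr => i _; congr (g _ _).
have -> : lift ord0 i = rshift 1 i by apply: val_inj.
by rewrite (row_mxEr (x%:M : 'M[R]_1) (rowt t) 0%R i).
Qed.

Definition box n (D : 'I_n -> set (measurableTypeR R)) : set (tup n) :=
  [set t | forall i, D i (tnth t i)].

Definition boxes n : set (set (tup n)) :=
  [set B | exists2 D : 'I_n -> set (measurableTypeR R), (forall i, measurable (D i)) & B = box D].

Lemma measurable_boxes n : @measurable _ (tup n) = <<s @boxes n>>.
Proof.
apply/seteqP; split.
  apply: smallest_sub; first exact: smallest_sigma_algebra.
  rewrite -bigcup_seq; apply: bigcup_sub => i _ _ [Y mY <-].
  apply: sub_sigma_algebra; exists (fun j => if j == i then Y else setT).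
    by move=> j; case: ifP.
  rewrite setTI; apply/seteqP; split => t /=.
    by move=> Yt j; case: eqP => [->|].
  by move=> /(_ i); rewrite eqxx.
apply: smallest_sub; first exact: sigma_algebra_measurable.
by move=> _ [D mD ->]; exact: box_measurable.
Qed.

(** Boxes form a generating class stable under intersection, and R^n is exhausted by the boxes
    [-k, k]^n of finite measure. *)
Lemma lebesgue_tuple_unique n (m : {measure set (tup n) -> \bar R}) :
  (forall D, (forall i, measurable (D i)) -> m (box D) = lebesgue_tuple R n (box D)) ->
  forall A, measurable A -> m A = lebesgue_tuple R n A.
Proof.
move=> mE A mA.
pose g (k : nat) := box (fun _ : 'I_n => `[(- (k%:R))%R : R, (k%:R)%R]%classic).
apply: (@measure_unique _ _ _ (@boxes n) g) => //.
- exact: measurable_boxes.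
- move=> _ _ [D mD ->] [E mE' ->]; exists (fun i => D i `&` E i).
    by move=> i; exact: measurableI.
  apply/seteqP; split => t /=; first by move=> [h1 h2] i; split; [exact: h1|exact: h2].
  by move=> h; split => i; case: (h i).
- by move=> k; exists (fun _ : 'I_n => `[(- (k%:R))%R : R, (k%:R)%R]%classic).
- apply/seteqP; split => // t _.
  exists (\sum_(i < n) Num.bound `|tnth t i|)%N => //= i.
  rewrite /= in_itv/= -ler_norml (le_trans (ltW (archi_boundP (normr_ge0 _))))//.
  by rewrite ler_nat (bigD1 i)//= leq_addr.
- by move=> _ [D mD ->]; exact: mE.
- move=> k; rewrite mE// lebesgue_tuple_box//.
  rewrite ltey_eq prode_fin_num// => i _.
  by rewrite lebesgue_measure_itv/=; case: ifP.
Qed.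

(** The image of Lebesgue measure under a permutation of the coordinates has the same values on
    boxes, as only the order of the factors changes. *)
Lemma vint_perm n (s : 'S_n) (f : 'rV[R]_n -> \bar R) : vmeas f -> (forall x, 0 <= f x) ->
  vint (fun x => f (x *m perm_mx s)) = vint f.
Proof.
move=> mf f0.
pose phi : tup n -> tup n := @trow R n \o (fun t => rowt t *m perm_mx s).
have mphi : measurable_fun setT phi.
  apply: measurable_trow => i.
  have := @measurable_affine R n n (perm_mx s) 0%R _ _ (@rowt R n) i (@measurable_coord R n).
  by under eq_fun do rewrite addr0.
have phiE t i : tnth (phi t) (s i) = tnth t i.
  rewrite tnth_mktuple mxE (bigD1 i)//= !mxE eqxx mulr1 big1 ?addr0// => j ji.
  by rewrite !mxE (inj_eq perm_inj) (negbTE ji) mulr0.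
rewrite /vint.
transitivity (\int[pushforward (lebesgue_tuple R n) phi]_t f (rowt t)).
  rewrite ge0_integral_pushforward//.
  by apply: eq_integral => t _ /=; rewrite trowK.
apply: eq_measure_integral => A mA _.
have [nu nuE] : exists nu : {measure set (tup n) -> \bar R}, forall B, nu B = pushforward (lebesgue_tuple R n) phi B.
  by unshelve eexists (pushforward (lebesgue_tuple R n) phi); first exact: mphi.
apply: etrans (esym (nuE A)) _; apply: lebesgue_tuple_unique => // D mD.
rewrite nuE lebesgue_tuple_box// /pushforward.
rewrite (_ : phi @^-1` box D = box (fun i => D (s i))); last first.
  apply/seteqP; split => t /= h i; first by rewrite -phiE; exact: h.
  by have := h (s^-1%g i); rewrite -phiE permKV.
rewrite lebesgue_tuple_box//.
by rewrite [RHS](reindex_inj (@perm_inj _ s)).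
Qed.

(** Induction on n. Vectors are rows, so a lower triangular A maps the tail y of the vector to a
    tail that does not involve the head x, while the head becomes a x plus a constant depending on
    y. Integrating over x first gives the factor |a|, and the induction hypothesis treats the
    tail. *)
Lemma vint_affine1 n (f : 'rV[R]_n -> \bar R) : vmeas f -> (forall x, 0 <= f x) ->
 forall (A : 'M[R]_n) (c : 'rV[R]_n), is_trig_mx A -> \det A != 0%R ->
  `|\det A|%:E * vint (fun x => f (x *m A + c)%R) = vint f.
Proof.
elim: n f => [|n IH] f mf f0 A c.
  move=> _ _; rewrite det_mx00 normr1 mul1e; apply: eq_vint => x.
  by congr f; apply/rowP; case.
move: A c => /= A c At.
have [a [l [L AE]]] : exists (a : R) (l : 'cV[R]_n) (L : 'M[R]_n), (A : 'M[R]_(1 + n)) = block_mx a%:M 0%R l L.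
  exists (A ord0 ord0), (dlsubmx (A : 'M[R]_(1 + n))), (drsubmx (A : 'M[R]_(1 + n))).
  rewrite -[LHS](@submxK _ 1 n 1 n); congr block_mx.
    apply/matrixP => i j; rewrite !mxE (ord1 i) (ord1 j) eqxx mulr1n.
    by congr (A _ _); apply: val_inj.
  apply/matrixP => i j; rewrite !mxE; apply: (is_trig_mxP At).
  by rewrite /= (ord1 i).
have Lt : is_trig_mx L.
  apply/is_trig_mxP => i j ij; have := is_trig_mxP At (rshift 1 i) (rshift 1 j) ij.
  by move=> h; have := AE; move=> /matrixP/(_ (rshift 1 i) (rshift 1 j)); rewrite block_mxEdr => <-.
have -> : \det A = (a * \det L)%R.
  by transitivity (\det (block_mx a%:M 0%R l L)); [rewrite -AE|rewrite det_lblock det_scalar1].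
rewrite mulf_eq0 => /norP[a0 L0].
have [c0 [c1 cE]] : exists (c0 : R) (c1 : 'rV[R]_n), (c : 'rV[R]_(1 + n)) = row_mx c0%:M c1.
  exists (c 0%R ord0), (rsubmx (c : 'rV[R]_(1 + n))).
  rewrite -[LHS](@hsubmxK _ 1 1 n); congr row_mx.
  apply/matrixP => i j; rewrite !mxE (ord1 i) (ord1 j) eqxx mulr1n.
  by congr (c _ _); apply: val_inj.
have AxE x (y : 'rV[R]_n) : ((row_mx (x%:M : 'M[R]_1) y : 'rV[R]_(1 + n)) *m A + c =
   row_mx ((a * x + ((y *m l) 0 0 + c0))%:M : 'M[R]_1) (y *m L + c1) :> 'rV[R]_(1 + n))%R.
  transitivity (row_mx (x%:M : 'M[R]_1) y *m block_mx a%:M 0%R l L + row_mx c0%:M c1)%R.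
    by rewrite -AE -cE.
  rewrite mul_row_block add_row_mx mulmx0 add0r; congr row_mx.
  apply/matrixP => i j; rewrite (ord1 i) (ord1 j) !mxE eqxx !mulr1n big_ord1 !mxE eqxx !mulr1n.
  by rewrite (mulrC x a) addrA.
rewrite (@vintSr R n) => [||//]; last exact: (@vmeas_affine R n.+1 n.+1).
rewrite [RHS](@vintSr R n)//.
rewrite -(IH _ (vmeas_int_head mf f0) _ L c1 Lt L0); last first.
  by move=> x; apply: integral_ge0.
rewrite normrM EFinM -!muleA (muleCA (`|a|%:E)); congr (_ * _).
have mfz (y : 'rV[R]_n) : measurable_fun setT (fun x : measurableTypeR R => f (row_mx (x%:M : 'M[R]_1) y)).
  apply: (@vmeas_comp R (1 + n) _ (measurableTypeR R) _ _ (fun x => row_mx (x%:M : 'M[R]_1) y) f _ mf) => i.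
  case: (splitP i) => j ij.
    have -> : i = lshift n j by apply/val_inj.
    by under eq_fun do rewrite row_mxEl mxE (ord1 j) eqxx mulr1n; exact: measurable_id.
  have -> : i = rshift 1 j by apply/val_inj.
  by under eq_fun do rewrite row_mxEr; exact: measurable_cst.
rewrite /vint -ge0_integralZl//; last 2 first.
- have := @vmeas_int_head R n (fun x => f (x *m A + c)%R) (vmeas_affine A c mf) (fun x => f0 _).
  by [].
- by move=> t _; apply: integral_ge0.
apply: eq_integral => t _.
under eq_integral do rewrite AxE.
by rewrite (ge0_integral_affine _ a0 (mfz _)).
Qed.

End integration_vectors.

Section linear_change_of_variables.
Variable R : realType.
Notation tup n := (n.-tuple (measurableTypeR R)).
Local Open Scope ereal_scope.

Definition scales_vint n (A : 'M[R]_n) := forall (f : 'rV[R]_n -> \bar R) (c : 'rV[R]_n),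
  vmeas f -> (forall x, 0 <= f x) -> `|\det A|%:E * vint (fun x => f (x *m A + c)%R) = vint f.

Lemma scales_vintM n (A B : 'M[R]_n) : scales_vint A -> scales_vint B -> scales_vint (A *m B).
Proof.
move=> hA hB f c mf f0; rewrite -[RHS](hB f c mf f0).
have <- := hA (fun y => f (y *m B + c)%R) 0%R (vmeas_affine _ _ mf) (fun=> f0 _).
rewrite det_mulmx normrM EFinM -muleA muleCA; do 2 congr (_ * _).
by apply: eq_vint => x; rewrite addr0 mulmxA.
Qed.

Lemma scales_vint_perm n (s : 'S_n) : scales_vint (perm_mx s).
Proof.
move=> f c mf f0; rewrite det_perm normr_sign mul1e.
have E : (fun x => f (x + c)%R) = (fun x => f (x *m 1%:M + c)%R).
  by apply/funext => x; rewrite mulmx1.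
have mfc : vmeas (fun x => f (x + c)%R) by rewrite E; exact: vmeas_affine.
rewrite (vint_perm s mfc (fun=> f0 _)) E.
have := vint_affine1 mf f0 c (scalar_mx_is_trig n 1%R).
by rewrite det1 normr1 mul1e; apply; exact: oner_neq0.
Qed.

Lemma scales_vint_trig n (A : 'M[R]_n) : is_trig_mx A -> \det A != 0%R -> scales_vint A.
Proof. by move=> At A0 f c mf f0; exact: vint_affine1. Qed.

(** The LUP decomposition writes A as a product of a permutation, a lower and an upper triangular
    matrix; conjugation by the order-reversing permutation [w] makes the upper one lower
    triangular. *)
Lemma scales_vint_unit n (A : 'M[R]_n) : A \in unitmx -> scales_vint A.
Proof.
case: n A => [|n] A.
  by move=> _; apply: scales_vint_trig; [apply/is_trig_mxP; case|rewrite det_mx00 oner_neq0].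
move=> Au; have := cormen_lup_correct A; have := cormen_lup_perm A.
have := cormen_lup_detL A; have := @cormen_lup_lower _ _ A; have := @cormen_lup_upper _ _ A.
case: cormen_lup => [[P L] U] /= hU hL dL /is_perm_mxP[s Ps] PA.
have AE : A = perm_mx s^-1 *m (L *m U).
  by rewrite -mulmxE in PA; rewrite -PA Ps mulmxA -perm_mxM mulVg perm_mx1 mul1mx.
have Udet : \det U != 0%R.
  by move: Au; rewrite AE unitmxE !det_mulmx dL mul1r unitfE mulf_eq0 => /norP[].
rewrite AE; apply: scales_vintM; first exact: scales_vint_perm.
apply: scales_vintM.
  apply: scales_vint_trig; last by rewrite dL oner_neq0.
  by apply/is_trig_mxP => i j ij; rewrite hL 1?ltnW// (_ : (i == j) = false)//; apply/eqP => ij'; rewrite ij' ltnn in ij.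
pose w := perm (@rev_ord_inj n.+1).
have ww : (w * w = 1)%g by apply/permP => i; rewrite permM !permE rev_ordK.
have wV : (w^-1 = w)%g by apply/eqP; rewrite eq_invg_mul ww.
pose V := perm_mx w *m U *m perm_mx w.
have UE : U = perm_mx w *m (V *m perm_mx w).
  by rewrite /V -!mulmxA -perm_mxM ww perm_mx1 mulmx1 mulmxA -perm_mxM ww perm_mx1 mul1mx.
rewrite UE; apply: scales_vintM; first exact: scales_vint_perm.
apply: scales_vintM; last exact: scales_vint_perm.
apply: scales_vint_trig.
  apply/is_trig_mxP => i j ij; rewrite /V -row_permE -[w in X in _ *m X]invgK -col_permE !mxE wV !permE.
  by apply: hU; rewrite /= !subSS; apply: ltn_sub2l => //; rewrite (leq_trans ij)// -ltnS.
by rewrite /V !det_mulmx !det_perm !mulf_neq0// signr_eq0.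
Qed.

Lemma vint_affine n (A : 'M[R]_n) (c : 'rV[R]_n) (f : 'rV[R]_n -> \bar R) : A \in unitmx ->
  vmeas f -> (forall x, 0 <= f x) -> `|\det A|%:E * vint (fun x => f (x *m A + c)%R) = vint f.
Proof. by move=> /scales_vint_unit; exact. Qed.

Lemma measurable_vset_preimage n d (T : measurableType d) (h : T -> 'rV[R]_n) (C : set 'rV[R]_n) :
  (forall i, measurable_fun setT (fun s => h s 0%R i)) -> vset C -> measurable (h @^-1` C).
Proof.
move=> /measurable_trow mh mC.
have := mh measurableT _ mC; rewrite setTI.
by rewrite -comp_preimage (_ : _ \o _ = h)//; apply/funext => s /=; rewrite trowK.
Qed.

Lemma vset_affine n (A : 'M[R]_n) (c : 'rV[R]_n) (C : set 'rV[R]_n) : vset C ->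
  vset ((fun x => x *m A + c)%R @^-1` C).
Proof.
move=> mC; apply: (@measurable_vset_preimage _ _ _ (fun t => rowt t *m A + c)%R) => // i.
by apply: measurable_affine => j; exact: measurable_coord.
Qed.

Lemma vmeas_indic n (C : set 'rV[R]_n) : vset C -> vmeas (fun x => (\1_C x : R)%:E).
Proof.
move=> mC; apply/measurable_EFinP.
rewrite /vset in mC.
have := @measurable_indic _ (tup n) R setT (@rowt R n @^-1` C) mC.
by [].
Qed.

Lemma volumeE n (C : set 'rV[R]_n) : vset C -> volume C = vint (fun x => (\1_C x : R)%:E).
Proof.
move=> mC; transitivity (\int[lebesgue_tuple R n]_t (\1_(@rowt R n @^-1` C) t)%:E); last by apply: eq_integral.
by rewrite integral_indic// setIT.
Qed.

Lemma volume_image n (A : 'M[R]_n) (c : 'rV[R]_n) (C : set 'rV[R]_n) : A \in unitmx -> vset C ->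
  vset [set c + u *m A | u in C]%R /\ volume [set c + u *m A | u in C]%R = `|\det A|%:E * volume C.
Proof.
move=> Au mC.
have iE : [set c + u *m A | u in C]%R = (fun x => x *m invmx A - c *m invmx A)%R @^-1` C.
  apply/seteqP; split => [_ [u Cu <-]|x /= Cx] /=.
    by rewrite mulmxDl mulmxK// [X in (X - _)%R]addrC addrK.
  by exists (x *m invmx A - c *m invmx A)%R => //; rewrite mulmxBl !mulmxKV// addrC subrK.
have mI : vset [set c + u *m A | u in C]%R.
  by rewrite iE; exact: vset_affine.
split => //; rewrite !volumeE//.
rewrite -(@vint_affine n A c _ Au (vmeas_indic mI)) => [|x]; last by rewrite lee_fin.
congr (_ * _); apply: eq_vint => x; congr _%:E.
rewrite !indicE; congr (_%:R); congr nat_of_bool.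
apply/idP/idP; rewrite !inE.
  move=> [u Cu]; rewrite addrC => /addIr/(can_inj (mulmxK Au)) <- //.
by move=> Cx; exists x => //; rewrite addrC.
Qed.

End linear_change_of_variables.

(** * The Brascamp-Lieb inequality *)

Section measurable_matrix.
Variable R : realType.
Context d (X : measurableType d).

Lemma measurable_det n (A : X -> 'M[R]_n) :
  (forall i j, measurable_fun setT (fun x => A x i j)) ->
  measurable_fun setT (fun x => \det (A x)).
Proof.
move=> mA; apply: measurable_sum => s; apply: measurable_funM => //.
by apply: measurable_prod => i _.
Qed.

(** Cramer's rule: the entries are cofactors times the power -1 of the determinant. *)
Lemma measurable_invmx n (A : X -> 'M[R]_n) :
  (forall i j, measurable_fun setT (fun x => A x i j)) ->
  (forall x, 0 < \det (A x)) ->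
  forall i j, measurable_fun setT (fun x => invmx (A x) i j).
Proof.
move=> mA dA i j.
have uA x : A x \in unitmx by rewrite unitmxE unitfE gt_eqF.
have E : (fun x => invmx (A x) i j) = (fun x => (\det (A x)) `^ (-1) * ((-1) ^+ (j + i) * \det (row' j (col' i (A x))))).
  by apply/funext => x; rewrite /invmx uA !mxE powR_inv1// ltW.
rewrite E; apply: measurable_funM.
  exact: (measurableT_comp (@measurable_powR R (-1)) (measurable_det mA)).
apply: measurable_funM => //; apply: measurable_det => k l.
by under eq_fun do rewrite !mxE; exact: mA.
Qed.

(** Tonelli for the positive and the negative part of the integrand separately. *)
Lemma measurable_wint d' (T : measurableType d') (mu : {sigma_finite_measure set T -> \bar R})
  (rho : T -> R) (G : X * T -> R) : measurable_fun setT rho -> measurable_fun setT G ->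
  measurable_fun setT (fun x => wint mu rho (fun s => G (x, s))).
Proof.
move=> mr mG.
pose H (z : X * T) := (rho z.2 * G z)%:E.
have mH : measurable_fun setT H.
  apply/measurable_EFinP; apply: measurable_funM => //.
  exact: (measurableT_comp mr).
suff : measurable_fun setT (fun x => (\int[mu]_s H (x, s))%E).
  by move=> h; exact: (measurableT_comp (@fine_measurable R _ measurableT) h).
have E : (fun x => (\int[mu]_s H (x, s))%E) =
  (fun x => (\int[mu]_s (H^\+ (x, s)) - \int[mu]_s (H^\- (x, s)))%E).
  apply/funext => x; rewrite [LHS]integralE; congr (_ - _)%E; apply: eq_integral => s _.
    by rewrite !funeposE.
  by rewrite !funenegE.
rewrite E; apply: emeasurable_funB.
- apply: (measurable_fun_fubini_tonelli_F (m2 := mu)) => //; first exact: measurable_funepos.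
- apply: (measurable_fun_fubini_tonelli_F (m2 := mu)) => //; first exact: measurable_funeneg.
Qed.

End measurable_matrix.

(** * The transport map Phi and its derivative *)

Section transport_map.
Context d (T : measurableType d) (R : realType).
Variable mu : {sigma_finite_measure set T -> \bar R}.
Variable rho : T -> R.
Hypothesis rho_ge0 : forall s, 0 <= rho s.
Hypothesis rho_int : mu.-integrable setT (EFin \o rho).
Variables (n : nat) (u : 'I_n -> T -> R).
Hypothesis mu_ : forall i, measurable_fun setT (u i).
Hypothesis u1 : forall s, \sum_i u i s ^+ 2 = 1.
Local Notation I := (wint mu rho).
Hypothesis iso : forall i j, I (fun s => u i s * u j s) = (i == j)%:R.
Variable r : R.
Hypothesis r1 : 1 <= r.
Local Notation ip := (ip u).
Local Notation bm := bounded_measurable.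
Notation tup n := (n.-tuple (measurableTypeR R)).

Lemma measurable_rho : measurable_fun setT rho.
Proof. by case/integrableP : rho_int => /measurable_EFinP. Qed.

Lemma measurable_ip : measurable_fun setT (fun z : tup n * T => ip (rowt z.1) z.2).
Proof.
apply: measurable_sum => i; apply: measurable_funM.
  exact: (measurableT_comp (measurable_coord i)).
exact: (measurableT_comp (mu_ i)).
Qed.

Lemma measurable_wint_ip (g : R -> R) (k : T -> R) : measurable_fun setT g -> measurable_fun setT k ->
  measurable_fun setT (fun t : tup n => I (fun s => g (ip (rowt t) s) * k s)).
Proof.
move=> mg mk.
apply: (@measurable_wint R _ (tup n) _ T mu rho (fun z => g (ip (rowt z.1) z.2) * k z.2)); first exact: measurable_rho.
apply: measurable_funM; first exact: (measurableT_comp mg measurable_ip).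
exact: (measurableT_comp mk).
Qed.

(** In Lewis' position, the r-th power of the norm of the subspace. *)
Definition Psi (x : 'rV[R]_n) := I (fun s => `|ip x s| `^ r).

Lemma cts_ip_bm (g : R -> R) (x : 'rV[R]_n) : continuous g -> bm (fun s => g (ip x s)).
Proof.
move=> cg; split.
  by apply: (measurableT_comp (continuous_measurable_fun cg)); have [] := bm_ip mu_ u1 x.
pose L := \sum_i `|x 0 i|.
have LL : - L <= L by rewrite ge0_cp// sumr_ge0.
have [t0 _ h0] := EVT_min LL (continuous_subspaceT cg).
have [t1 _ h1] := EVT_max LL (continuous_subspaceT cg).
exists (`|g t0| + `|g t1|) => s.
have ipL : ip x s \in `[- L, L] by rewrite in_itv/= -ler_norml; exact: ip_le.
have := h0 _ ipL; have := h1 _ ipL.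
have h3 := ler_norm (g t1); have h4 := ler_norm (- g t0); rewrite normrN in h4.
have h6 := normr_ge0 (g t1); have h7 := normr_ge0 (g t0).
by move=> h8 h9; rewrite ler_norml; apply/andP; split; lra.
Qed.

(** By isotropy the u_i are orthonormal in L_2 of the weight. With y the vector of coefficients of
    f, the inequality is that the integral of (f - <y,u>)^2 is nonnegative. *)
Lemma wint_bessel (f : T -> R) : bm f -> \sum_i I (fun s => f s * u i s) ^+ 2 <= I (fun s => f s ^+ 2).
Proof.
move=> bf; pose y : 'rV[R]_n := \row_i I (fun s => f s * u i s).
have bi : bm (ip y) := bm_ip mu_ u1 y.
have e1 : I (fun s => f s * ip y s) = \sum_i I (fun s => f s * u i s) ^+ 2.
  by rewrite wint_ip//; apply: eq_bigr => i _; rewrite mxE expr2.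
have e2 := wint_ip_sqr rho_ge0 rho_int mu_ u1 iso y.
rewrite (eq_bigr (fun i => I (fun s => f s * u i s) ^+ 2)) in e2; last by move=> i _; rewrite mxE.
have : 0 <= I (fun s => (f s ^+ 2 + ip y s ^+ 2) - 2 * (f s * ip y s)).
  rewrite -(wint0 rho_ge0 rho_int); apply: le_wint => //; first exact: bmC.
    by apply: bmB; [apply: bmD; exact: bmX|apply: bmZ; exact: bmM].
  by move=> s; have := sqr_ge0 (f s - ip y s); nra.
rewrite wintB//; [|by apply: bmD; exact: bmX|by apply: bmZ; exact: bmM].
rewrite wintD//; [|exact: bmX..].
by rewrite wintZ ?e1 ?e2//; [lra|exact: bmM].
Qed.

Section with_transport.
Variables (tau : R -> R) (c : R).
Let dtau x := c * (pexp r x / gauss_fun (tau x)).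
Hypothesis c0 : 0 < c.
Hypothesis dt : forall x : R, is_derive x (1 : R) tau (dtau x).

Lemma cts_tau : continuous tau.
Proof. by move=> x; apply/differentiable_continuous/derivable1_diffP; case: (dt x). Qed.

Lemma cts_dtau : continuous dtau.
Proof.
move=> x; apply: cvgM; first exact: cvg_cst.
apply: cvgM; first exact: (cts_pexp r1).
apply: cvgV; first by rewrite gt_eqF// expR_gt0.
by apply: (@continuous_comp _ _ _ tau (@gauss_fun R)); [exact: cts_tau|exact: continuous_gauss_fun].
Qed.

Lemma dtau_gt0 x : 0 < dtau x.
Proof. by rewrite mulr_gt0// divr_gt0// expR_gt0. Qed.

Definition Phi (x : 'rV[R]_n) : 'rV[R]_n := \row_i I (fun s => tau (ip x s) * u i s).
Definition DPhi (x : 'rV[R]_n) : 'M[R]_n := frame_mx mu rho u (fun s => dtau (ip x s)).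

(** First-order expansion of tau(<x + a, u>) in a; its moments against u form the first-order
    expansion Phi x + a DPhi x. *)
Definition linPhi (x a : 'rV[R]_n) s := tau (ip x s) + dtau (ip x s) * ip a s.

Lemma bm_linPhi x a : bm (linPhi x a).
Proof.
by apply: bmD; [exact: (cts_ip_bm x cts_tau)|apply: bmM; [exact: (cts_ip_bm x cts_dtau)|exact: bm_ip]].
Qed.

Lemma linPhiE x a i : (Phi x + a *m DPhi x) 0 i = I (fun s => linPhi x a s * u i s).
Proof.
have bt := cts_ip_bm x cts_tau.
have bd := cts_ip_bm x cts_dtau.
have bui := bmu mu_ u1 i.
transitivity (I (fun s => tau (ip x s) * u i s + (dtau (ip x s) * u i s) * ip a s)); last first.
  by congr wint; apply/funext => s; rewrite /linPhi; ring.
rewrite wintD//; [|exact: bmM|by apply: bmM; [exact: bmM|exact: bm_ip]].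
rewrite wint_ip//; last exact: bmM.
rewrite !mxE; congr (_ + _); apply: eq_bigr => j _; rewrite !mxE; congr (_ * wint _ _ _).
by apply/funext => s; ring.
Qed.

Lemma dtau_lower x : exists2 m, 0 < m & forall s, m <= dtau (ip x s).
Proof.
pose L := \sum_i `|x 0 i|.
have LL : - L <= L by rewrite ge0_cp// sumr_ge0.
have [t0 _ h0] := EVT_min LL (continuous_subspaceT cts_dtau).
exists (dtau t0) => [|s]; first exact: dtau_gt0.
by apply: h0; rewrite in_itv/= -ler_norml; exact: ip_le.
Qed.

(** The derivative equation gives ln tau' = ln c + tau^2 - |.|^r, which goes into [det_frame_mx_ge];
    the mass n of the weight turns ln c into the factor c ^+ n. *)
Lemma det_DPhi x : 0 < \det (DPhi x) /\
  c ^+ n * expR (I (fun s => tau (ip x s) ^+ 2) - Psi x) <= \det (DPhi x).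
Proof.
have [m m0 mh] := dtau_lower x.
have bt := cts_ip_bm x cts_tau.
have bd := cts_ip_bm x cts_dtau.
have bp := cts_ip_bm x (cts_abs_powR r1).
have [dp dl] := det_frame_mx_ge rho_ge0 rho_int mu_ u1 iso bd m0 mh.
split=> //.
have lnE s : ln (dtau (ip x s)) = (ln c + tau (ip x s) ^+ 2) - `|ip x s| `^ r.
  rewrite /dtau lnM ?posrE ?divr_gt0 ?expR_gt0// ln_div ?posrE ?expR_gt0//.
  by rewrite /pexp /gauss_fun !expRK; ring.
have : I (fun s => ln (dtau (ip x s))) = ln c * n%:R + I (fun s => tau (ip x s) ^+ 2) - Psi x.
  transitivity (I (fun s => (ln c + tau (ip x s) ^+ 2) - `|ip x s| `^ r)).
    by congr wint; apply/funext => s; rewrite lnE.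
  rewrite wintB//; last by apply: bmD; [exact: bmC|exact: bmX].
  rewrite wintD//; [|exact: bmC|exact: bmX].
  by rewrite wint_cst// (wint1 rho_ge0 rho_int mu_ u1 iso).
move=> E; rewrite E in dl.
have -> : c ^+ n = expR (ln c * n%:R) by rewrite expRM_natr lnK ?posrE.
rewrite -(@lnK _ (\det (DPhi x))) ?posrE// -!expRD ler_expR.
by rewrite /DPhi; lra.
Qed.

Lemma vmeas_Phi i : vmeas (fun x => Phi x 0 i : measurableTypeR R).
Proof.
have := measurable_wint_ip (continuous_measurable_fun cts_tau) (mu_ i).
by apply: eq_measurable_fun => t _; rewrite /= mxE.
Qed.

Lemma vmeas_DPhi i j : vmeas (fun x => DPhi x i j : measurableTypeR R).
Proof.
have := measurable_wint_ip (continuous_measurable_fun cts_dtau) (measurable_funM (mu_ i) (mu_ j)).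
by apply: eq_measurable_fun => t _; rewrite /= mxE.
Qed.

Lemma vmeas_Psi : vmeas (Psi : _ -> measurableTypeR R).
Proof.
have := measurable_wint_ip (continuous_measurable_fun (cts_abs_powR r1)) (@measurable_cst _ _ T R setT (1 : R)).
by apply: eq_measurable_fun => t _; congr wint; apply/funext => s; rewrite mulr1.
Qed.

End with_transport.
End transport_map.

(** * First-order estimates for Phi, uniform on cubes *)

Section local_estimates.
Context d (T : measurableType d) (R : realType).
Variable mu : {sigma_finite_measure set T -> \bar R}.
Variable rho : T -> R.
Hypothesis rho_ge0 : forall s, 0 <= rho s.
Hypothesis rho_int : mu.-integrable setT (EFin \o rho).
Variables (n : nat) (u : 'I_n -> T -> R).
Hypothesis mu_ : forall i, measurable_fun setT (u i).
Hypothesis u1 : forall s, \sum_i u i s ^+ 2 = 1.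
Local Notation I := (wint mu rho).
Hypothesis iso : forall i j, I (fun s => u i s * u j s) = (i == j)%:R.
Variable r : R.
Hypothesis r1 : 1 <= r.
Local Notation ip := (ip u).
Local Notation bm := bounded_measurable.
Notation tup n := (n.-tuple (measurableTypeR R)).
Variables (tau : R -> R) (c : R).
Let dtau x := c * (pexp r x / gauss_fun (tau x)).
Hypothesis c0 : 0 < c.
Hypothesis dt : forall x : R, is_derive x (1 : R) tau (dtau x).
Local Notation Phi := (Phi mu rho u tau).
Local Notation DPhi := (DPhi mu rho u r tau c).
Local Notation linPhi := (linPhi u r tau c).

Definition cube (B : R) : set 'rV[R]_n := [set x | forall i, `|x 0 i| <= B].

(** The summand 1 makes N a legitimate divisor for every n, and gives n <= N ^ 2. *)
Let N : R := n%:R + 1.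
Let N1 : 1 <= N. Proof. by rewrite lerDr. Qed.
Let N0 : 0 < N. Proof. exact: lt_le_trans N1. Qed.

Lemma ip_cube B x s : 0 <= B -> cube B x -> `|ip x s| <= N * B.
Proof.
move=> B0 xB; rewrite (le_trans (ip_le u1 x s))//.
rewrite (le_trans (ler_sum _ (fun i _ => xB i)))// sumr_const card_ord -mulr_natl.
by rewrite ler_wpM2r// lerDl.
Qed.

Lemma cubeD B1 B2 x y : cube B1 x -> cube B2 y -> cube (B1 + B2) (x + y).
Proof. by move=> h1 h2 i; rewrite mxE (le_trans (ler_normD _ _))// lerD. Qed.

(** The segment of radius N (B + 1) contains <x + a, u> for x in [cube B] and a in [cube 1]. *)
Let bounds (B e : R) : 0 <= B -> 0 < e -> exists m K dl : R, [/\ 0 < m, 0 < dl,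
   forall x, `|x| <= N * (B + 1) -> m <= dtau x <= K /\ `|tau x| <= K,
   forall x y : R, `|x| <= N * (B + 1) -> `|y| <= N * (B + 1) -> m * (y - x) ^+ 2 <= (tau y - tau x) * (y - x) &
   forall x y : R, `|x| <= N * (B + 1) -> `|y - x| < dl ->
     `|tau y - tau x - dtau x * (y - x)| <= e * `|y - x| ].
Proof.
move=> B0 e0; apply: transport_bounds => //.
- by apply: (cts_dtau r1 (c := c)) => //.
- by move=> x; exact: dtau_gt0.
- by rewrite mulr_ge0// ?ltW// ltr_wpDl.
Qed.

(** Bounds the Gaussian from below on the parallelepiped that linearizes Phi near x. Bessel's
    inequality bounds |Phi x + a DPhi x|^2 by the integral of linPhi^2, which exceeds that of tau^2
    by at most e when a is small, and exp(-e) >= 1 - e. *)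
Lemma linPhi_growth (B e : R) : 0 <= B -> 0 < e -> exists2 dl0 : R, 0 < dl0 &
  forall x a, cube B x -> cube dl0 a ->
   (1 - e) * expR (- I (fun s => tau (ip x s) ^+ 2)) <= expR (- \sum_i (Phi x + a *m DPhi x) 0 i ^+ 2).
Proof.
move=> B0 e0; have [m [K [dl [m0 dl0 hb _ _]]]] := bounds B0 ltr01.
have K0 : 0 < K.
  have [/andP[h1 h2] _] : m <= dtau 0 <= K /\ `|tau 0| <= K.
    by apply: hb; rewrite normr0 mulr_ge0// ?ltW// ltr_wpDl.
  by rewrite (lt_le_trans m0)// (le_trans h1).
(* From (A + D)^2 - A^2 = 2 A D + D^2 with |A| <= K and |D| <= K N dl', where dl' <= 1 allows dl' ^
   2 <= dl'; the weight has mass n. *)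
pose C := n%:R * (2 * K * (K * N) + (K * N) ^+ 2).
have C0 : 0 <= C by rewrite mulr_ge0// addr_ge0// ?mulr_ge0// ?sqr_ge0// ltW.
pose dl' := Num.min 1 (e / (C + 1)).
have d0 : 0 < dl' by rewrite lt_min ltr01 divr_gt0// ltr_wpDl.
have d1 : dl' <= 1 by rewrite ge_min lexx.
have dC : dl' * C <= e.
  have h : dl' <= e / (C + 1) by rewrite ge_min lexx orbT.
  rewrite (le_trans (ler_wpM2r C0 h))// mulrAC ler_pdivrMr ?ltr_wpDl//.
  by rewrite ler_wpM2l ?(ltW e0)// lerDl.
exists dl' => // x a xB ad.
have bl := bm_linPhi mu_ u1 r1 dt x a.
have bt := cts_ip_bm mu_ u1 x (cts_tau dt).
rewrite (eq_bigr (fun i => I (fun s => linPhi x a s * u i s) ^+ 2)); last first.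
  by move=> i _; rewrite (linPhiE rho_ge0 rho_int mu_ u1 r1 dt).
have h1 := wint_bessel rho_ge0 rho_int mu_ u1 iso bl.
have ipx s : `|ip x s| <= N * (B + 1).
  by rewrite (le_trans (ip_cube s B0 xB))// ler_wpM2l ?(ltW N0)// lerDl.
have h2 : I (fun s => linPhi x a s ^+ 2) <= I (fun s => tau (ip x s) ^+ 2 + dl' * (2 * K * (K * N) + (K * N) ^+ 2)).
  apply: le_wint => //; [exact: bmX|by apply: bmD; [exact: bmX|exact: bmC]|] => s.
  have [/andP[h3 h4] h5] := hb _ (ipx s).
  have h6 := ip_cube s (ltW d0) ad.
  have ht : `|dtau (ip x s) * ip a s| <= K * (N * dl').
    by rewrite normrM ler_pM// ger0_norm// ltW// (lt_le_trans m0).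
  rewrite /linPhi -/(dtau _) sqrrD -addrA lerD2l.
  set A := tau _ in h5 *; set D := dtau _ * _ in ht *.
  have hAD : A * D <= K * (K * (N * dl')).
    by rewrite (le_trans (ler_norm _))// normrM ler_pM.
  have hD : D ^+ 2 <= (K * N) ^+ 2 * dl'.
    rewrite -real_normK ?num_real// (@le_trans _ _ ((K * (N * dl')) ^+ 2))//.
      by rewrite ler_pXn2r ?nnegrE// mulr_ge0 ?mulr_ge0// ltW.
    rewrite mulrA exprMn ler_wpM2l ?sqr_ge0// expr2 ler_piMr// ltW//.
  rewrite mulr2n; nra.
rewrite wintD// in h2; [|exact: bmX|exact: bmC].
rewrite wint_cst// (wint1 rho_ge0 rho_int mu_ u1 iso) in h2.
apply: (@le_trans _ _ (expR (- e) * expR (- I (fun s => tau (ip x s) ^+ 2)))).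
  by rewrite ler_wpM2r ?expR_ge0// expR_ge1Dx.
rewrite -expRD ler_expR.
have : dl' * (2 * K * (K * N) + (K * N) ^+ 2) * n%:R <= e by rewrite -mulrA (mulrC _ n%:R).
lra.
Qed.

(** Injectivity of Phi at scale dl. Equal images mean equal moments of the two [linPhi] against u,
    so their difference is orthogonal to <w,u>, where w is the difference of the displaced points.
    On the other hand tau increases at rate at least m, and [linPhi] differs from tau at the
    displaced points by a small multiple of dl; hence so small is w. *)
Lemma Phi_separated (B e : R) : 0 <= B -> 0 < e -> exists2 dl0 : R, 0 < dl0 &
  forall dl x x' a a', 0 < dl <= dl0 -> cube B x -> cube B x' -> cube dl a -> cube dl a' ->
   Phi x + a *m DPhi x = Phi x' + a' *m DPhi x' ->
   cube (e * dl) ((x + a) - (x' + a')).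
Proof.
move=> B0 e0; have [m [K [dlx [m0 _ _ hm _]]]] := bounds B0 ltr01.
(* Chosen for the last estimate: 4 (q N dl)^2 n / m^2 = (e dl)^2 n / N^2 <= (e dl)^2. *)
pose q := e * m / (2 * N ^+ 2).
have q0 : 0 < q by rewrite divr_gt0 ?mulr_gt0// exprn_gt0.
have [m' [K' [dl1 [_ dl10 _ _ hlin]]]] := bounds B0 q0.
(* The bound 1 keeps the displaced points in [cube (B + 1)]; the other one makes N dl, a bound of
   |<a,u>|, strictly smaller than [dl1]. *)
exists (Num.min 1 (dl1 / (N + N))).
  by rewrite lt_min ltr01 divr_gt0// addr_gt0.
move=> dl x x' a a' /andP[dl0 dlm] xB xB' ad ad' E.
have Ei i : I (fun s => linPhi x a s * u i s) = I (fun s => linPhi x' a' s * u i s).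
  by rewrite -!(linPhiE rho_ge0 rho_int mu_ u1 r1 dt) E.
clear E.
have dle1 : dl <= 1 by apply: le_trans dlm _; rewrite ge_min lexx.
have Ndl : N * dl < dl1.
  have : dl <= dl1 / (N + N) by apply: le_trans dlm _; rewrite ge_min lexx orbT.
  rewrite ler_pdivlMr; last by apply: addr_gt0.
  move=> h; apply: lt_le_trans h; have -> : dl * (N + N) = N * dl + N * dl by ring.
  by rewrite ltrDl mulr_gt0.
set w := (x + a) - (x' + a').
have ipx y s : cube B y -> `|ip y s| <= N * (B + 1).
  by move=> yB; rewrite (le_trans (ip_cube s B0 yB))// ler_wpM2l ?(ltW N0)// lerDl.
have ipxa y a1 s : cube B y -> cube dl a1 -> `|ip (y + a1) s| <= N * (B + 1).
  move=> yB bd; apply: ip_cube; first by rewrite addr_ge0.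
  by apply: cubeD => // i; rewrite (le_trans (bd i)).
pose err y a1 s := tau (ip (y + a1) s) - linPhi y a1 s.
have errle y a1 s : cube B y -> cube dl a1 -> `|err y a1 s| <= q * (N * dl).
  move=> yB bd.
  have := hlin (ip y s) (ip (y + a1) s) (ipx y s yB).
  rewrite ipD (addrC (ip y s)) addrK => h.
  have hb := ip_cube s (ltW dl0) bd.
  rewrite /err /linPhi ipD (addrC (ip y s)) opprD addrA.
  by apply: le_trans (h (le_lt_trans hb Ndl)) _; apply: ler_wpM2l => //; exact: ltW.
have bt y := cts_ip_bm mu_ u1 y (cts_tau dt).
have bl y a1 := bm_linPhi mu_ u1 r1 dt y a1.
have bi y : bm (ip y) := bm_ip mu_ u1 y.
have Ew : I (fun s => (linPhi x a s - linPhi x' a' s) * ip w s) = 0.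
  rewrite wint_ip//; last exact: bmB.
  apply: big1 => i _; transitivity (w 0 i * (I (fun s => linPhi x a s * u i s) - I (fun s => linPhi x' a' s * u i s))).
    congr (_ * _); rewrite -wintB//; [|by apply: bmM => //; exact: (bmu mu_ u1)..].
    by congr wint; apply/funext => s'; rewrite mulrBl.
  by rewrite Ei subrr mulr0.
pose bb := q * (N * dl).
have bb0 : 0 < bb by apply: mulr_gt0 => //; exact: mulr_gt0.
(* Monotonicity of tau, then 2 bb |t| <= 2 bb^2 / m + (m / 2) t^2 for the error terms, whose
   quadratic part is half of the left-hand side and is absorbed by it. *)
have key : I (fun s => m * ip w s ^+ 2) <= I (fun s => (linPhi x a s - linPhi x' a' s) * ip w s + (2 * bb ^+ 2 / m + m / 2 * ip w s ^+ 2)).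
  apply: le_wint => //.
  - by apply: bmZ; exact: bmX.
  - apply: bmD; first by apply: bmM => //; exact: bmB.
    by apply: bmD; [exact: bmC|apply: bmZ; exact: bmX].
  move=> s; have e1 := errle x a s xB ad; have e2 := errle x' a' s xB' ad'.
  have hw : ip w s = ip (x + a) s - ip (x' + a') s by rewrite /w ipB.
  have := hm _ _ (ipxa x' a' s xB' ad') (ipxa x a s xB ad).
  rewrite -hw => h3; apply: (le_trans h3).
  have -> : tau (ip (x + a) s) - tau (ip (x' + a') s) =
    (linPhi x a s - linPhi x' a' s) + (err x a s - err x' a' s) by rewrite /err; ring.
  rewrite mulrDl lerD2l.
  have h4 : (err x a s - err x' a' s) * ip w s <= 2 * bb * `|ip w s|.
    rewrite (le_trans (ler_norm _))// normrM ler_wpM2r// (le_trans (ler_normB _ _))//.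
    by rewrite -/bb in e1 e2; lra.
  apply: (le_trans h4); rewrite -[ip w s ^+ 2]real_normK ?num_real//.
  set t := `|ip w s|.
  have : 0 <= (2 * bb - m * t) ^+ 2 / (2 * m) by rewrite divr_ge0 ?sqr_ge0// mulr_ge0// ltW.
  have -> : (2 * bb - m * t) ^+ 2 / (2 * m) = 2 * bb ^+ 2 / m - 2 * bb * t + m / 2 * t ^+ 2.
    by field; rewrite gt_eqF.
  lra.
have bw2 : bm (fun s => ip w s ^+ 2) by exact: bmX.
rewrite wintZ// in key.
rewrite wintD// in key; last first.
- by apply: bmD; [exact: bmC|exact: bmZ].
- by apply: bmM => //; exact: bmB.
rewrite Ew add0r wintD// in key; [|exact: bmC|exact: bmZ].
rewrite wint_cst// wintZ// (wint1 rho_ge0 rho_int mu_ u1 iso) (wint_ip_sqr rho_ge0 rho_int mu_ u1 iso) in key.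
have W : \sum_i w 0 i ^+ 2 <= (e * dl) ^+ 2.
  set S := \sum_i _ in key *.
  have h5 : S <= 4 * bb ^+ 2 * n%:R / m ^+ 2.
    have : m / 2 * S <= 2 * bb ^+ 2 / m * n%:R by lra.
    rewrite -ler_pdivlMl ?divr_gt0// => h; apply: (le_trans h).
    by rewrite le_eqVlt; apply/orP; left; apply/eqP; field; rewrite gt_eqF.
  apply: (le_trans h5).
  have -> : 4 * bb ^+ 2 * n%:R / m ^+ 2 = (e * dl) ^+ 2 * (n%:R / N ^+ 2).
    by rewrite /bb /q; field; rewrite !gt_eqF.
  rewrite ler_piMr ?sqr_ge0// ler_pdivrMr ?exprn_gt0// mul1r.
  have : n%:R <= N by rewrite lerDl.
  by move: N1; nra.
move=> i; rewrite -(@ler_pXn2r _ 2)// ?nnegrE ?mulr_ge0// ?(ltW e0) ?(ltW dl0)//.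
rewrite real_normK ?num_real// (le_trans _ W)// (bigD1 i)//= lerDl.
by apply: sumr_ge0 => j _; exact: sqr_ge0.
Qed.

End local_estimates.

Section cubes.
Variables (R : realType) (n : nat).
Notation tup n := (n.-tuple (measurableTypeR R)).

Lemma cube_boxE (B : R) : @rowt R n @^-1` (@cube R n B) = box (fun _ : 'I_n => `[- B, B]%classic).
Proof.
apply/seteqP; split => t h i; have := h i.
  by rewrite mxE ler_norml /= in_itv.
by rewrite mxE ler_norml /= in_itv.
Qed.

Lemma vset_cube (B : R) : vset (@cube R n B).
Proof. by rewrite /vset cube_boxE; apply: box_measurable. Qed.

Lemma volume_cube (B : R) : 0 <= B -> volume (@cube R n B) = ((2 * B) ^+ n)%:E.
Proof.
move=> B0; transitivity (lebesgue_tuple R n (box (fun _ : 'I_n => `[- B, B]%classic))).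
  by rewrite -cube_boxE.
rewrite lebesgue_tuple_box// (eq_bigr (fun=> (2 * B)%:E)) => [|i _].
  by rewrite prodEFin prodr_const card_ord.
rewrite lebesgue_measure_itv/= lte_fin; case: ifP => [|/negbT].
  by move=> _; rewrite -EFinB opprK mulr_natl mulr2n.
rewrite -leNgt => h; have -> : B = 0 by apply/eqP; rewrite eq_le B0; lra.
by rewrite mulr0.
Qed.

Lemma vint_prod_fin (f : R -> R) : (forall x, 0 < f x) -> measurable_fun setT (f : measurableTypeR R -> measurableTypeR R) ->
  (@lebesgue_measure R).-integrable setT (EFin \o f) ->
  vint (fun x : 'rV[R]_n => (\prod_i f (x 0 i))%:E) = (mass f ^+ n)%:E.
Proof.
move=> f0 mf If.
have mf' : measurable_fun setT (fun y : measurableTypeR R => (f y)%:E) by exact/measurable_EFinP.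
have f0' (y : R) : (0 <= (f y)%:E)%E by rewrite lee_fin ltW.
have H := @vint_prod R n (fun _ y => (f y)%:E) (fun=> mf') (fun _ => f0').
rewrite (eq_vint (g := fun x : 'rV[R]_n => \prod_(i < n) (f (x 0%R i))%:E)%E) => [|x]; last by rewrite prodEFin.
rewrite H.
rewrite (eq_bigr (fun=> (mass f)%:E)) => [|i _].
  by rewrite prodEFin prodr_const card_ord.
by rewrite /mass /Rintegral fineK//; exact: integrable_fin_num.
Qed.
End cubes.

(** * Comparison of integrals along Phi *)

Section change_of_variables.
Context d (T : measurableType d) (R : realType).
Variable mu : {sigma_finite_measure set T -> \bar R}.
Variable rho : T -> R.
Hypothesis rho_ge0 : forall s, 0 <= rho s.
Hypothesis rho_int : mu.-integrable setT (EFin \o rho).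
Variables (n : nat) (u : 'I_n -> T -> R).
Hypothesis mu_ : forall i, measurable_fun setT (u i).
Hypothesis u1 : forall s, \sum_i u i s ^+ 2 = 1.
Local Notation I := (wint mu rho).
Hypothesis iso : forall i j, I (fun s => u i s * u j s) = (i == j)%:R.
Variable r : R.
Hypothesis r1 : 1 <= r.
Local Notation ip := (ip u).
Notation tup n := (n.-tuple (measurableTypeR R)).
Local Notation Psi := (Psi mu rho u r).

Section with_transport.
Variables (tau : R -> R) (c : R).
Let dtau x := c * (pexp r x / gauss_fun (tau x)).
Hypothesis c0 : 0 < c.
Hypothesis dt : forall x : R, is_derive x (1 : R) tau (dtau x).
Local Notation Phi := (Phi mu rho u tau).
Local Notation DPhi := (DPhi mu rho u r tau c).

Let h (y : 'rV[R]_n) : R := \prod_i gauss_fun (y 0 i).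

Let hE y : h y = expR (- \sum_i y 0 i ^+ 2).
Proof. by rewrite -sumrN expR_sum; apply: eq_bigr. Qed.

Let h_ge0 y : 0 <= h y.
Proof. by rewrite hE expR_ge0. Qed.

(** The displacement that leads to y in the linearization of Phi at x. *)
Let back (x y : 'rV[R]_n) := (y - Phi x) *m invmx (DPhi x).

Let Du x : DPhi x \in unitmx.
Proof. by rewrite unitmxE unitfE gt_eqF//; have [] := det_DPhi rho_ge0 rho_int mu_ u1 iso r1 c0 dt x. Qed.

Let backK x y : Phi x + back x y *m DPhi x = y.
Proof. by rewrite /back mulmxKV// addrC subrK. Qed.

Let measurable_back i :
  measurable_fun setT (fun z : tup n * tup n => back (rowt z.1) (rowt z.2) 0 i).
Proof.
have mf1 : measurable_fun setT (fst : tup n * tup n -> tup n) by [].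
have mf2 : measurable_fun setT (snd : tup n * tup n -> tup n) by [].
rewrite (_ : (fun z => _) = (fun z : tup n * tup n => \sum_j ((rowt z.2 0 j - Phi (rowt z.1) 0 j) * invmx (DPhi (rowt z.1)) j i))); last first.
  by apply/funext => z; rewrite /back mxE; apply: eq_bigr => j _; rewrite !mxE.
apply: measurable_sum => j; apply: measurable_funM.
  apply: measurable_funB; first exact: (measurableT_comp (measurable_coord j) mf2).
  exact: (measurableT_comp (vmeas_Phi rho_int mu_ dt j) mf1).
have mi : measurable_fun setT (fun t : tup n => invmx (DPhi (rowt t)) j i).
  apply: measurable_invmx => [k l|t].
    exact: (vmeas_DPhi rho_int mu_ r1 dt k l).
  by have [] := det_DPhi rho_ge0 rho_int mu_ u1 iso r1 c0 dt (rowt t).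
exact: (measurableT_comp mi mf1).
Qed.

(* Integrating [F] in both orders replaces the change of variables [y = Phi x]:
   for fixed [x], [y] runs over a parallelepiped of volume
   [(2 dl)^n \det (DPhi x)] around [Phi x]; for fixed [y], the admissible [x]
   lie in a cube of side nearly [2 dl], see [Phi_separated]. *)
Let F (B dl : R) (z : tup n * tup n) : \bar R :=
  (\1_(cube B) (rowt z.1) * (h (rowt z.2) * \1_(cube dl) (back (rowt z.1) (rowt z.2))))%:E.

Let mh : measurable_fun setT (fun t : tup n => h (rowt t)).
Proof.
apply: measurable_prod => i _.
exact: (measurableT_comp (@measurable_gauss_fun R) (measurable_coord i)).
Qed.

Let mind B : measurable_fun setT (fun t : tup n => \1_(@cube R n B) (rowt t) : R).
Proof. by have := @measurable_indic _ (tup n) R setT _ (@vset_cube R n B). Qed.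

Let mind2 B : measurable_fun setT (fun z : tup n * tup n => \1_(@cube R n B) (back (rowt z.1) (rowt z.2)) : R).
Proof.
have m : measurable ((fun z : tup n * tup n => back (rowt z.1) (rowt z.2)) @^-1` (cube B)).
  by apply: measurable_vset_preimage; [exact: measurable_back|exact: vset_cube].
by have := @measurable_indic _ _ R setT _ m.
Qed.

Let mF B dl : measurable_fun setT (F B dl).
Proof.
apply/measurable_EFinP; apply: measurable_funM.
  exact: (measurableT_comp (mind B)).
apply: measurable_funM; last exact: mind2.
exact: (measurableT_comp mh).
Qed.

Let F0 B dl z : (0 <= F B dl z)%E.
Proof. by rewrite lee_fin !mulr_ge0. Qed.

(** On the parallelepiped the Gaussian is at least (1 - e) exp(- I tau^2) by [linPhi_growth]; in the
    product with the volume, [det_DPhi] supplies exp(I tau^2 - Psi) and the terms in tau^2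
    cancel. *)
Let lower (B e : R) : 0 <= B -> 0 < e < 1 -> exists2 dl0 : R, 0 < dl0 &
  forall dl, 0 < dl <= dl0 -> forall t : tup n,
  (((2 * dl) ^+ n * ((1 - e) * c ^+ n) * (\1_(cube B) (rowt t) * expR (- Psi (rowt t))))%:E <=
    \int[lebesgue_tuple R n]_t' F B dl (t, t'))%E.
Proof.
move=> B0 /andP[e0 e1].
have [dl0 dl00 hdl] := linPhi_growth rho_ge0 rho_int mu_ u1 iso r1 c0 dt B0 e0.
exists dl0 => // dl /andP[dp dle] t; set x := rowt t.
have [xB|xB] := pselect (cube B x); last first.
  by rewrite indicE memNset// mul0r mulr0; apply: integral_ge0 => t' _.
rewrite indicE mem_set// mul1r.
have [D0 Dge] := det_DPhi rho_ge0 rho_int mu_ u1 iso r1 c0 dt x.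
pose k := (1 - e) * expR (- I (fun s => tau (ip x s) ^+ 2)).
have k0 : 0 <= k by rewrite mulr_ge0 ?expR_ge0// subr_ge0 ltW.
have [mP vP] := volume_image (Phi x) (Du x) (@vset_cube R n dl).
rewrite (@volume_cube R n _ (ltW dp)) gtr0_norm// -EFinM (volumeE mP) in vP.
apply: (@le_trans _ _ (k%:E * (\det (DPhi x) * (2 * dl) ^+ n)%:E)%E).
  rewrite -EFinM lee_fin.
  have -> : (2 * dl) ^+ n * ((1 - e) * c ^+ n) * expR (- Psi x) =
    ((1 - e) * (2 * dl) ^+ n) * (c ^+ n * expR (- Psi x)) by ring.
  have -> : k * (\det (DPhi x) * (2 * dl) ^+ n) =
    ((1 - e) * (2 * dl) ^+ n) * (expR (- I (fun s => tau (ip x s) ^+ 2)) * \det (DPhi x)) by rewrite /k; ring.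
  apply: ler_wpM2l; first by rewrite mulr_ge0 ?subr_ge0 ?(ltW e1)// exprn_ge0// mulr_ge0// ltW.
  rewrite -ler_pdivrMl ?expR_gt0// -expRN opprK mulrCA -expRD.
  exact: Dge.
rewrite -vP /vint -ge0_integralZl//; last exact: (vmeas_indic mP).
apply: ge0_le_integral => //.
- by move=> t' _; rewrite -EFinM lee_fin mulr_ge0.
- by apply: measurable_funeM; exact: (vmeas_indic mP).
- have mt : measurable_fun setT (fun t' : tup n => (t, t')) by exact: measurable_fun_pair.
  exact: (measurableT_comp (mF B dl) mt).
move=> t' _; rewrite -EFinM lee_fin /=.
rewrite [X in _ <= X * _]indicE mem_set// mul1r.
rewrite indicE; case: (boolP (_ \in _)) => [|_]; last by rewrite mulr0 mulr_ge0.
rewrite inE => -[a ad <-]; rewrite mulr1.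
have -> : back x (Phi x + a *m DPhi x) = a by rewrite /back [Phi x + _]addrC addrK mulmxK.
rewrite indicE mem_set// mulr1 hE; apply: hdl => // i.
exact: le_trans (ad i) dle.
Qed.

(** If x0 is admissible for y, then for every admissible x the point x + back x y is within e dl of
    x0 + back x0 y, so x is within (1 + e) dl of this fixed point. If no x is admissible, the
    integral is 0. *)
Let upper (B e : R) : 0 <= B -> 0 < e -> exists2 dl0 : R, 0 < dl0 &
  forall dl, 0 < dl <= dl0 -> forall t' : tup n,
    (\int[lebesgue_tuple R n]_t F B dl (t, t') <= ((2 * ((1 + e) * dl)) ^+ n * h (rowt t'))%:E)%E.
Proof.
move=> B0 e0.
have [dl0 dl00 hdl] := Phi_separated rho_ge0 rho_int mu_ u1 iso r1 c0 dt B0 e0.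
exists dl0 => // dl dlp t'; set y := rowt t'.
have dp : 0 < dl by case/andP: dlp.
have d0 : 0 <= (1 + e) * dl by rewrite mulr_ge0 ?addr_ge0// ltW.
have [[x0 [x0B x0y]]|none] := pselect (exists x0, cube B x0 /\ cube dl (back x0 y)); last first.
  rewrite (eq_integral (cst 0%E)) => [|t _].
    by rewrite integral_cst//= mul0e lee_fin mulr_ge0// exprn_ge0// mulr_ge0.
  rewrite /F /=; congr _%:E; rewrite !indicE.
  case: (boolP (_ \in _)) => [/set_mem h1|_]; last by rewrite mul0r.
  case: (boolP (_ \in _)) => [/set_mem h2|_]; last by rewrite !mulr0.
  by exfalso; apply: none; exists (rowt t).
pose z0 := x0 + back x0 y.
have [mP vP] := volume_image z0 (unitmx1 R n) (@vset_cube R n ((1 + e) * dl)).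
rewrite volume_cube// det1 normr1 mul1e (volumeE mP) in vP.
rewrite EFinM muleC -vP /vint -ge0_integralZl//; last 2 first.
- exact: (vmeas_indic mP).
- by rewrite lee_fin; exact: h_ge0.
apply: ge0_le_integral => //.
- have mt : measurable_fun setT (fun t : tup n => (t, t')) by exact: measurable_fun_pair.
  exact: (measurableT_comp (mF B dl) mt).
- by apply: measurable_funeM; exact: (vmeas_indic mP).
move=> t _; rewrite -EFinM lee_fin /=.
rewrite mulrCA; apply: ler_wpM2l => //; rewrite !indicE.
case: (boolP (_ \in _)) => [/set_mem h2|_]; last by rewrite mul0r.
case: (boolP (_ \in _)) => [/set_mem h1|_]; last by rewrite mulr0.
rewrite mulr1 mem_set//.
exists (rowt t - z0); last by rewrite mulmx1 addrC subrK.
have := hdl dl _ _ _ _ dlp h2 x0B h1 x0y.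
rewrite !backK => /(_ erefl) hc i.
rewrite mulrDl mul1r [leRHS]addrC.
have -> : rowt t - z0 = ((rowt t + back (rowt t) y) - z0) - back (rowt t) y.
  by rewrite [X in _ = X - _]addrAC addrK.
rewrite mxE [X in _ + X]mxE; apply: le_trans (ler_normB _ _) _; apply: lerD.
  exact: hc.
exact: h1.
Qed.

(** [lower] and [upper] bound the same double integral, and the common factor (2 dl)^n cancels. This
    leaves (1 - e) J <= (1 + e)^n times the claimed bound, and e tends to 0. The restriction to a
    cube is what makes the local estimates uniform. *)
Lemma bl_cube (B : R) : 0 <= B ->
  (vint (fun x => (\1_(cube B) x * expR (- Psi x))%:E) <= ((mass (@gauss_fun R) / c) ^+ n)%:E)%E.
Proof.
move=> B0.
set J := vint _.
have J0 : (0 <= J)%E by apply: integral_ge0 => t _; rewrite lee_fin mulr_ge0 ?expR_ge0.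
have mJ : measurable_fun setT (fun t : tup n => (\1_(cube B) (rowt t) * expR (- Psi (rowt t)))%:E).
  apply/measurable_EFinP; apply: measurable_funM; first exact: mind.
  apply: (measurableT_comp (@measurable_expR R)).
  apply: measurableT_comp => //; exact: (vmeas_Psi rho_int mu_ r1).
have Zg0 : 0 < mass (@gauss_fun R).
  apply: mass_gt0; [exact: continuous_gauss_fun|by move=> x; exact: expR_gt0|exact: integrableT_gauss].
have step e : 0 < e < 1 -> ((1 - e)%:E * J <= ((1 + e) ^+ n * (mass (@gauss_fun R) / c) ^+ n)%:E)%E.
  move=> he; have e0 : 0 < e by case/andP: he.
  have e1 : 0 <= 1 - e by rewrite subr_ge0; case/andP: he => _ /ltW.
  have [dl1 dl10 h1] := lower B0 he.
  have [dl2 dl20 h2] := upper B0 e0.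
  pose dl := Num.min dl1 dl2.
  have dl0 : 0 < dl by rewrite lt_min dl10.
  have {}h1 := h1 dl _; have {}h2 := h2 dl _.
  have p0 : 0 < (2 * dl) ^+ n * c ^+ n by rewrite mulr_gt0// exprn_gt0// mulr_gt0.
  have : (((2 * dl) ^+ n * ((1 - e) * c ^+ n))%:E * J <= ((2 * ((1 + e) * dl)) ^+ n * mass (@gauss_fun R) ^+ n)%:E)%E.
    rewrite /J /vint -ge0_integralZl//; last first.
      by rewrite lee_fin !mulr_ge0// exprn_ge0// ?mulr_ge0// ltW.
    apply: (@le_trans _ _ (\int[lebesgue_tuple R n]_t \int[lebesgue_tuple R n]_t' F B dl (t, t'))%E).
      apply: ge0_le_integral => //.
      - by move=> t _; rewrite -EFinM lee_fin !mulr_ge0 ?expR_ge0// exprn_ge0// ?mulr_ge0// ltW.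
      - exact: measurable_funeM.
      - apply: (measurable_fun_fubini_tonelli_F (m2 := lebesgue_tuple R n)) => //.
      - by move=> t _; rewrite -EFinM; apply: h1; rewrite dl0 ge_min lexx.
    rewrite (fubini_tonelli (F B dl))//.
    rewrite EFinM -(@vint_prod_fin R n _ _ _ (@integrableT_gauss R)); last 2 first.
    - by move=> x; exact: expR_gt0.
    - exact: measurable_gauss_fun.
    rewrite /vint -ge0_integralZl//; last 3 first.
    - by apply/measurable_EFinP; exact: mh.
    - by move=> t _; rewrite lee_fin; exact: h_ge0.
    - by rewrite lee_fin exprn_ge0// !mulr_ge0// ?addr_ge0// ltW.
    apply: ge0_le_integral => //.
    - by move=> t' _; apply: integral_ge0.
    - apply: (measurable_fun_fubini_tonelli_G (m1 := lebesgue_tuple R n)) => //.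
    - by apply: measurable_funeM; apply/measurable_EFinP; exact: mh.
    - by move=> t' _; rewrite -EFinM; apply: h2; rewrite dl0 ge_min lexx orbT.
  have -> : (2 * dl) ^+ n * ((1 - e) * c ^+ n) = ((2 * dl) ^+ n * c ^+ n) * (1 - e) by ring.
  have -> : (2 * ((1 + e) * dl)) ^+ n * mass (@gauss_fun R) ^+ n =
      ((2 * dl) ^+ n * c ^+ n) * ((1 + e) ^+ n * (mass (@gauss_fun R) / c) ^+ n).
    rewrite -!exprMn; congr (_ ^+ _); field.
    by rewrite gt_eqF.
  by rewrite EFinM -muleA [leRHS]EFinM lee_pmul2l.
(* The case e = 1/2 already shows finiteness, so the limit can be taken in R. *)
have Jfin : J \is a fin_num.
  rewrite ge0_fin_numE//; have h3 : (0 < (2^-1 : R)) && ((2^-1 : R) < 1) by rewrite invr_gt0 ltr0n invf_lt1 ?ltr1n.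
  have := step _ h3; case: (J) J0 => [j _ _|_|//]; first by rewrite ltry.
  rewrite gt0_muley ?leye_eq// lte_fin subr_gt0.
  by case/andP: h3.
rewrite -(fineK Jfin) in step *; rewrite lee_fin.
set j := fine J in step *; set K := (_ / _) ^+ n in step *.
have {}step e : 0 < e < 1 -> (1 - e) * j <= (1 + e) ^+ n * K.
  by move=> /step; rewrite -EFinM lee_fin.
have c1 : (fun e : R => (1 - e) * j) e @[e --> 0^'+] --> (1 - 0) * j.
  by apply: cvg_at_right_filter; apply: cvgMl; apply: cvgB; [exact: cvg_cst|exact: cvg_id].
have c2 : (fun e : R => (1 + e) ^+ n * K) e @[e --> 0^'+] --> (1 + 0) ^+ n * K.
  apply: cvg_at_right_filter; apply: cvgMl.
  apply: (@continuous_comp _ _ _ (fun e : R => 1 + e) (fun x => x ^+ n)); last exact: exprn_continuous.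
  by apply: cvgD; [exact: cvg_cst|exact: cvg_id].
rewrite subr0 mul1r in c1; rewrite addr0 expr1n mul1r in c2.
apply: (ler_cvg_to c1 c2); near=> e; apply: step; apply/andP; split => //.
Unshelve. all: by end_near. Qed.

End with_transport.

(** The transport is onto the Gaussian, with c the quotient of the two masses, so that mass
    gauss_fun / c is the mass of [pexp r]; monotone convergence along growing cubes removes the
    restriction in [bl_cube]. *)
Lemma brascamp_lieb :
  (vint (fun x : 'rV[R]_n => (expR (- Psi x))%:E) <= (mass (pexp r) ^+ n)%:E)%E.
Proof.
have Zg0 : 0 < mass (@gauss_fun R).
  apply: mass_gt0; [exact: continuous_gauss_fun|by move=> x; exact: expR_gt0|exact: integrableT_gauss].
have Z0 : 0 < mass (pexp r).
  apply: mass_gt0; [exact: cts_pexp|by move=> x; exact: expR_gt0|exact: pexp_integrable].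
have [tau dt] := transport_exists (cts_pexp r1) (@pexp_gt0 R r) (pexp_integrable r1)
   (@continuous_gauss_fun R) (fun x => @expR_gt0 R _) (@integrableT_gauss R).
have c0 : 0 < mass (@gauss_fun R) / mass (pexp r) by rewrite divr_gt0.
have step (k : nat) := bl_cube c0 dt (ler0n R k).
have e : mass (@gauss_fun R) / (mass (@gauss_fun R) / mass (pexp r)) = mass (pexp r).
  by field; rewrite !gt_eqF.
rewrite e in step.
have mE : measurable_fun setT (fun t : tup n => (expR (- Psi (rowt t)))%:E).
  apply/measurable_EFinP; apply: (measurableT_comp (@measurable_expR R)).
  apply: measurableT_comp => //; exact: (vmeas_Psi rho_int mu_ r1).
pose G (k : nat) : set (tup n) := @rowt R n @^-1` (@cube R n k%:R).
have mG k : measurable (G k) := @vset_cube R n k%:R.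
have G1 : \bigcup_k G k = setT.
  apply/seteqP; split => // t _.
  exists (\sum_(i < n) Num.bound `|rowt t 0%R i|)%N => //= i.
  apply: le_trans (ltW (archi_boundP (normr_ge0 _))) _.
  by rewrite ler_nat (bigD1 i)//= leq_addr.
have ndG : nondecreasing_seq G.
  by move=> i j ij; rewrite subsetEset => t /= h k; apply: le_trans (h k) _; rewrite ler_nat.
have E0 (k : nat) (t : tup n) : G k t -> (0 <= (expR (- Psi (rowt t)))%:E)%E.
  by move=> _; rewrite lee_fin expR_ge0.
have cv := @ge0_nondecreasing_set_cvg_integral _ (tup n) R G (fun t : tup n => (expR (- Psi (rowt t)))%:E)
  (lebesgue_tuple R n) ndG mG (fun i => measurable_funTS mE) E0.
rewrite G1 in cv; rewrite /vint -(cvg_lim _ cv)//.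
apply: lime_le; first by apply/cvg_ex; eexists; exact: cv.
apply: nearW => k; apply: le_trans (step k).
rewrite integral_mkcond /vint le_eqVlt; apply/orP; left; apply/eqP.
apply: eq_integral => t _; rewrite patchE indicE.
rewrite (_ : (t \in G k) = (rowt t \in cube k%:R)).
  by case: ifP; rewrite ?mul1r ?mul0r.
by apply/idP/idP; rewrite !inE.
Qed.

End change_of_variables.

(** * Volumes of unit balls *)

Section layer_cake.
Variables (R : realType) (n : nat) (r : R).
Hypothesis r0 : 0 < r.
Notation tup n := (n.-tuple (measurableTypeR R)).

(** The properties of the r-th power of a norm that govern the volumes of sublevel sets. *)
Definition gauge (P : 'rV[R]_n -> R) := [/\ vmeas (P : _ -> measurableTypeR R),
  forall x, 0 <= P x & forall a x, 0 < a -> P (a *: x) = a `^ r * P x].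

Lemma vset_ball P e : gauge P -> vset [set x | P x <= e].
Proof.
move=> [mP _ _]; rewrite /vset.
have := mP measurableT _ (measurable_itv `]-oo, e]); rewrite setTI.
rewrite (_ : _ @^-1` _ = @rowt R n @^-1` [set x | P x <= e])//.
Qed.

Lemma volume_ball P e : gauge P -> 0 < e ->
  (volume [set x | (P x <= e)%R] = ((e `^ r^-1) ^+ n)%:E * volume [set x | (P x <= 1)%R])%E.
Proof.
move=> gP e0; have [mP P0 Ph] := gP.
pose a := e `^ r^-1.
have a0 : 0 < a by rewrite powR_gt0.
have au : (a%:M : 'M[R]_n) \in unitmx by rewrite unitmxE det_scalar unitfE expf_neq0// gt_eqF.
have [_] := volume_image 0 au (vset_ball 1 gP).
rewrite det_scalar normrX gtr0_norm// => <-; congr volume.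
have ar : a `^ r = e by rewrite -powRrM mulVf ?gt_eqF// powRr1// ltW.
apply/seteqP; split => [x /= Px|_ [x /= Px <-]].
  exists (a^-1 *: x); last by rewrite add0r mul_mx_scalar scalerA mulfV ?scale1r// gt_eqF.
  rewrite /= Ph ?invr_gt0// -powR_inv1 ?(ltW a0)// powRAC ar powR_inv1 ?(ltW e0)//.
  by rewrite ler_pdivrMl// mulr1.
by rewrite add0r mul_mx_scalar Ph// ar ler_piMr// ltW.
Qed.

(** Gamma(1 + n/r), after the substitution s = exp(-t). It depends on n and r only, hence cancels
    when two balls are compared. *)
Definition kappa := (\int[@lebesgue_measure R]_(s in `]0%R, 1%R[) (((- ln s) `^ r^-1) ^+ n)%:E)%E.

(** Tonelli for the region below the graph of exp(-P): its slice at height s is the set P <= - ln s,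
    a dilate of the unit ball by the factor (- ln s)^(1/r). *)
Lemma layer_cake P : gauge P ->
  (vint (fun x => (expR (- P x))%:E) = kappa * volume [set x | (P x <= 1)%R])%E.
Proof.
move=> gP; have [mP P0 Ph] := gP.
pose A : set (tup n * measurableTypeR R) := [set z | 0 < z.2 < 1 /\ z.2 <= expR (- P (rowt z.1))].
have mA : measurable A.
  have -> : A = (setT `*` `]0, 1[%classic) `&` [set z | z.2 <= expR (- P (rowt z.1))].
    by apply/seteqP; split => z /=; rewrite in_itv/=; [move=> [? ?]; do !split|move=> [[]]].
  apply: measurableI; first exact: measurableX.
  have m1 : measurable_fun setT (snd : tup n * measurableTypeR R -> measurableTypeR R) by [].
  have m2 : measurable_fun setT (fun z : tup n * measurableTypeR R => expR (- P (rowt z.1))).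
    apply: (measurableT_comp (@measurable_expR R)); apply: measurableT_comp => //.
    exact: (measurableT_comp mP).
  have := measurable_fun_ler m1 m2; move=> /(_ measurableT [set true]).
  rewrite setTI; apply => //.
have mf : measurable_fun setT (fun z : tup n * measurableTypeR R => (\1_A z : R)%:E).
  by apply/measurable_EFinP; exact: measurable_indic.
have f0 z : (0 <= (\1_A z : R)%:E)%E by rewrite lee_fin.
have := @fubini_tonelli _ _ _ _ R (lebesgue_tuple R n) (@lebesgue_measure R) _ mf f0.
set L := (\int[_]_x _)%E; set M := (\int[_]_x _)%E.
have -> : L = vint (fun x => (expR (- P x))%:E).
  apply: eq_integral => t _.
  set q := expR (- P (rowt t)).
  have q0 : 0 < q := expR_gt0 _.
  have q1 : q <= 1 by rewrite /q -expR0 ler_expR oppr_le0.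
  (* For q = 1 the slice lacks its end point, because A asks for s < 1, where - ln s is positive. *)
  rewrite (eq_integral (fun s : measurableTypeR R => (\1_(if q == 1 then `]0, 1[%classic else `]0, q]%classic) s : R)%:E)); last first.
    move=> s _; congr (_%:E); rewrite !indicE; congr (_%:R); congr nat_of_bool.
    apply/idP/idP; rewrite !inE /A/=; case: eqP => [q1'|/eqP qn]; rewrite /= !in_itv/= -/q.
    - by move=> [].
    - by move=> [/andP[-> _] ->].
    - by move=> s01; split=> //; rewrite q1' ltW//; case/andP: s01.
    - move=> /andP[-> sq]; split => //=; rewrite (le_lt_trans sq)// lt_neqAle qn//.
  rewrite integral_indic// ?setIT; last by case: ifP.
  case: eqP => [->|_] /=; rewrite lebesgue_measure_itv/= ?lte_fin ?ltr01 ?q0.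
    by rewrite -EFinB subr0.
  by rewrite -EFinB subr0.
move=> ->; rewrite /M /kappa.
transitivity (\int[@lebesgue_measure R]_(s in `]0%R, 1%R[) ((((- ln s) `^ r^-1) ^+ n)%:E * volume [set x | (P x <= 1)%R]))%E; last first.
  rewrite ge0_integralZr//.
  - apply/measurable_EFinP; apply: measurable_funX.
    apply: (measurableT_comp (@measurable_powR R r^-1)).
    apply: measurableT_comp => //; exact: measurable_funTS.
  - by move=> s _; rewrite lee_fin exprn_ge0// powR_ge0.
rewrite [RHS]integral_mkcond; apply: eq_integral => s _; rewrite patchE.
case: ifPn => sI.
  move: sI; rewrite inE/= in_itv/= => /andP[s0 s1].
  have ls : 0 < - ln s by rewrite oppr_gt0 ln_lt0// s0.
  rewrite -volume_ball// volumeE; last exact: vset_ball.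
  apply: eq_integral => t _; congr (_%:E); rewrite !indicE; congr (_%:R); congr nat_of_bool.
  have E : (P (rowt t) <= - ln s) = (s <= expR (- P (rowt t))).
    by rewrite lerNr -ler_expR lnK// posrE.
  apply/idP/idP => [/set_mem/= [_ sq]|/set_mem/= Ps]; apply/mem_set => /=; first by rewrite E.
  by split; [rewrite s0 s1|rewrite -E].
rewrite (eq_integral (cst 0%E)) => [|t _]; first by rewrite integral_cst//= mul0e.
rewrite /= indicE memNset// /A/= => -[h _].
by move: sI; rewrite mem_set//= in_itv/=.
Qed.

End layer_cake.

Section lp_ball.
Variables (R : realType) (n : nat) (r : R).
Hypothesis r1 : 1 <= r.
Let r0 : 0 < r. Proof. exact: lt_le_trans r1. Qed.
Notation tup n := (n.-tuple (measurableTypeR R)).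

Definition lp_pow (x : 'rV[R]_n) := \sum_i `|x 0 i| `^ r.

Lemma gauge_lp_pow : gauge r lp_pow.
Proof.
split.
- apply: measurable_sum => i.
  apply: (measurableT_comp (@measurable_powR R r)).
  by apply: measurableT_comp => //; exact: measurable_coord.
- by move=> x; apply: sumr_ge0 => i _; exact: powR_ge0.
- move=> a x a0; rewrite /lp_pow mulr_sumr; apply: eq_bigr => i _.
  by rewrite mxE normrM gtr0_norm// powRM// ltW.
Qed.

Definition lp_ball := [set x : 'rV[R]_n | lp_pow x <= 1].

Lemma vset_lp_ball : vset lp_ball.
Proof. exact: vset_ball gauge_lp_pow. Qed.

Lemma lp_ball_cube : lp_ball `<=` @cube R n 1.
Proof.
move=> x xB i; rewrite leNgt; apply/negP => xi.
have : `|x 0 i| <= 1.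
  rewrite (le_trans (le1r_powR (ltW xi) r1))// (le_trans _ xB)//.
  rewrite /lp_pow (bigD1 i)//= lerDl; apply: sumr_ge0 => j _; exact: powR_ge0.
by rewrite leNgt xi.
Qed.

Lemma cube_lp_ball : @cube R n (n%:R + 1)^-1 `<=` lp_ball.
Proof.
have N0 : 0 < n%:R + 1 :> R by rewrite ltr_wpDl.
move=> x xB; rewrite /lp_ball/= /lp_pow.
apply: (@le_trans _ _ (\sum_(i < n) (n%:R + 1)^-1)).
  apply: ler_sum => i _; have [->|xi] := eqVneq `|x 0 i| 0.
    by rewrite powR0 ?gt_eqF// invr_ge0 ltW.
  apply: le_trans (xB i); apply: ge1r_powR => //.
  rewrite lt_neqAle eq_sym xi normr_ge0/= (le_trans (xB i))// invf_le1// lerDr//.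
by rewrite sumr_const card_ord -[leLHS]mulr_natl ler_pdivrMr// mul1r lerDl.
Qed.

Lemma volume_lp_ball_gt0 : (0 < volume lp_ball)%E.
Proof.
have N0 : 0 < (n%:R + 1)^-1 :> R by rewrite invr_gt0 ltr_wpDl.
apply: (@lt_le_trans _ _ (volume (@cube R n (n%:R + 1)^-1))).
  by rewrite volume_cube ?(ltW N0)// lte_fin exprn_gt0// mulr_gt0.
apply: le_measure; rewrite ?inE; [exact: vset_cube|exact: vset_lp_ball|].
by move=> t; exact: cube_lp_ball.
Qed.

Lemma volume_lp_ball_cube : (volume lp_ball <= (2 ^+ n)%:E)%E.
Proof.
rewrite -[2]mulr1 -(@volume_cube R n 1)//.
apply: le_measure; rewrite ?inE; [exact: vset_lp_ball|exact: vset_cube|].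
by move=> t; exact: lp_ball_cube.
Qed.

Lemma vint_lp_pow : vint (fun x : 'rV[R]_n => (expR (- lp_pow x))%:E) = (mass (pexp r) ^+ n)%:E.
Proof.
rewrite -(@vint_prod_fin R n (pexp r)).
- by apply: eq_vint => x; rewrite /lp_pow -sumrN expR_sum.
- exact: pexp_gt0.
- exact: measurable_pexp.
- exact: pexp_integrable.
Qed.

(** For the l_r^n ball the hypothesis holds with equality, so kappa can be cancelled: its product
    with the positive volume of that ball is positive and finite, which makes kappa itself positive
    and finite. *)
Lemma volume_le_lp_ball (P : 'rV[R]_n -> R) : gauge r P ->
  (vint (fun x => (expR (- P x))%:E) <= (mass (pexp r) ^+ n)%:E)%E ->
  (volume [set x | (P x <= 1)%R] <= volume lp_ball)%E.
Proof.
move=> gP; rewrite -vint_lp_pow (layer_cake r0 gP) (layer_cake r0 gauge_lp_pow).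
have Z0 : 0 < mass (pexp r).
  apply: mass_gt0; [exact: cts_pexp|exact: pexp_gt0|exact: pexp_integrable].
have : (kappa n r * volume lp_ball = (mass (pexp r) ^+ n)%:E)%E.
  by rewrite -vint_lp_pow (layer_cake r0 gauge_lp_pow).
have k0 : (0 <= kappa n r)%E.
  by apply: integral_ge0 => s _; rewrite lee_fin exprn_ge0// powR_ge0.
have v0 := volume_lp_ball_gt0.
case: (kappa n r) k0 => [k k0|_|//].
  move=> E; have k1 : (0 < k%:E)%E.
    rewrite lt_neqAle k0 andbT; apply/eqP => k00; move: E; rewrite -k00 mul0e => /esym/eqP.
    by rewrite eqe gt_eqF// exprn_gt0.
  by rewrite lee_pmul2l.
by rewrite gt0_mulye.
Qed.

End lp_ball.

(** * Norms on R^n *)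

Section finite_dim_norm.
Variables (R : realType) (m : nat) (N : 'rV[R]_m -> R).
Hypothesis N_tri : forall x y, N (x + y) <= N x + N y.
Hypothesis NZ : forall a x, N (a *: x) = `|a| * N x.

Let N0 : N 0 = 0.
Proof. by rewrite -(scale0r 0) NZ normr0 mul0r. Qed.

Let NN x : N (- x) = N x.
Proof. by rewrite -scaleN1r NZ normrN1 mul1r. Qed.

Let N_ge0 x : 0 <= N x.
Proof. by have := N_tri x (- x); rewrite subrr N0 NN; lra. Qed.

Let nZ (a : R) (x : 'rV[R]_m) : `|a *: x| = `|a| * `|x|.
Proof. exact: mx_normZ. Qed.

Lemma coord_le_norm (x : 'rV[R]_m) i : `|x 0 i| <= `|x|.
Proof.
rewrite [leRHS]/Num.norm /= mx_normrE; apply/bigmax_geP; right.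
by exists (0, i).
Qed.

Lemma norm_le_coord : exists2 K, 0 < K & forall x, N x <= K * `|x|.
Proof.
exists (1 + \sum_i N (delta_mx 0 i)) => [|x].
  by rewrite ltr_pwDl// sumr_ge0.
have -> : x = \sum_i x 0 i *: delta_mx 0 i :> 'rV_m.
  by rewrite [LHS]row_sum_delta.
rewrite -row_sum_delta.
have big_tri (s : seq 'I_m) : N (\sum_(i <- s) x 0 i *: delta_mx 0 i) <= \sum_(i <- s) `|x| * N (delta_mx 0 i).
  elim: s => [|i s IH]; first by rewrite !big_nil N0.
  rewrite !big_cons (le_trans (N_tri _ _))// lerD// NZ ler_wpM2r//.
  exact: coord_le_norm.
rewrite {1}[x]row_sum_delta (le_trans (big_tri _))// -mulr_sumr mulrC ler_wpM2r//.
by rewrite lerDr.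
Qed.

Lemma norm_cts : continuous N.
Proof.
have [K K0 hK] := norm_le_coord.
move=> x; apply/(@cvgrPdist_le _ _ _ (nbhs x) (nbhs_filter x)) => e e0.
apply/nbhs_ballP; exists (e / K); first by rewrite /= divr_gt0.
move=> y; rewrite mx_norm_ball /ball_/= ltr_pdivlMr// mulrC => /ltW xy.
apply: le_trans xy.
have h1 : N x <= N (x - y) + N y by rewrite -{1}(subrK y x).
have h2 : N y <= N (x - y) + N x by rewrite -[N (x - y)]NN opprB -{1}(subrK x y).
have h3 := hK (x - y).
by rewrite ler_norml; apply/andP; split; lra.
Qed.

Hypothesis N_eq0 : forall x, N x = 0 -> x = 0.

(** The constant is the inverse of the minimum of N on the unit sphere of the sup norm, which is
    compact. *)
Lemma norm_coercive : exists2 c, 0 < c & forall x, `|x| <= c * N x.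
Proof.
pose S := [set x : 'rV[R]_m | `|x| = 1].
(* The sphere is empty only in dimension 0. *)
have [[x0 Sx0]|S0] := pselect (S !=set0); last first.
  exists 1 => // x; have [->|x0] := eqVneq x 0; first by rewrite normr0 mulr_ge0.
  exfalso; apply: S0; exists (`|x|^-1 *: x) => /=.
  by rewrite /S/= nZ normfV normr_id mulVf// normr_eq0.
have cS : compact S.
  apply: bounded_closed_compact.
    by exists 1; split; [exact: num_real|move=> y y1 x /= ->; exact: ltW].
  apply: (@closed_comp _ _ (fun x : 'rV[R]_m => `|x|) [set y | y = 1]); last exact: closed_eq.
  by move=> x _; exact: norm_continuous.
have [c cS' hc] := @compact_EVT_min _ R N S (ex_intro _ x0 Sx0) cS (continuous_subspaceT norm_cts).
rewrite inE in cS'.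
have Nc0 : 0 < N c.
  rewrite lt_neqAle N_ge0 andbT; apply/eqP => /esym/N_eq0 c0.
  by move: cS'; rewrite /S/= c0 normr0 => /esym/eqP; rewrite oner_eq0.
exists (N c)^-1; first by rewrite invr_gt0.
move=> x; have [->|x0'] := eqVneq x 0; first by rewrite normr0 mulr_ge0// invr_ge0.
have xn : 0 < `|x| by rewrite normr_gt0.
have := hc (`|x|^-1 *: x); rewrite inE => /(_ _).
rewrite NZ normfV normr_id => h.
rewrite ler_pdivlMl// mulrC -ler_pdivlMl//; apply: h => /=.
by rewrite /S/= nZ normfV normr_id mulVf// gt_eqF.
Qed.

Lemma norm_ball_compact e : compact [set x | N x <= e].
Proof.
have [c c0 hc] := norm_coercive.
apply: bounded_closed_compact.
  exists (c * e); split; first exact: num_real.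
  move=> y ey x /= xe; rewrite (le_trans (hc x))// (le_trans _ (ltW ey))//.
  by rewrite ler_wpM2l// ltW.
apply: (@closed_comp _ _ N [set y | y <= e]); last exact: closed_le.
by move=> x _; exact: norm_cts.
Qed.

End finite_dim_norm.

Section det_cts.
Variables (R : realType) (n : nat).

(** Matrices are taken as vectors of R^(n * n), where the compactness of norm balls is available. *)
Lemma det_cts : continuous (fun a : 'rV[R]_(n * n) => \det (vec_mx a : 'M[R]_n)).
Proof.
move=> a.
have E : (fun a : 'rV[R]_(n * n) => \det (vec_mx a : 'M[R]_n)) =
  (fun a => \sum_(s : 'S_n) (-1) ^+ s * \prod_i a 0 (mxvec_index i (s i))).
  apply/funext => b; apply: eq_bigr => s _; congr (_ * _); apply: eq_bigr => i _.
  by rewrite mxE.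
rewrite E.
have cp (s : 'S_n) (q : seq 'I_n) : continuous (fun a : 'rV[R]_(n * n) => \prod_(i <- q) a 0 (mxvec_index i (s i))).
  elim: q => [|i q IH].
    rewrite (_ : (fun a : 'rV[R]_(n * n) => _) = cst 1); first exact: cst_continuous.
    by apply/funext => b; rewrite big_nil.
  rewrite (_ : (fun a : 'rV[R]_(n * n) => _) = (fun a : 'rV[R]_(n * n) =>
    a 0 (mxvec_index i (s i)) * \prod_(i <- q) a 0 (mxvec_index i (s i)))); last first.
    by apply/funext => b; rewrite big_cons.
  by move=> b; apply: continuousM; [exact: coord_continuous|exact: IH].
have cs (q : seq 'S_n) : continuous (fun a : 'rV[R]_(n * n) => \sum_(s <- q) (-1) ^+ s * \prod_i a 0 (mxvec_index i (s i))).
  elim: q => [|s q IH].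
    rewrite (_ : (fun a : 'rV[R]_(n * n) => _) = cst 0); first exact: cst_continuous.
    by apply/funext => b; rewrite big_nil.
  rewrite (_ : (fun a : 'rV[R]_(n * n) => _) = (fun a : 'rV[R]_(n * n) =>
    (-1) ^+ s * \prod_i a 0 (mxvec_index i (s i)) + \sum_(s <- q) (-1) ^+ s * \prod_i a 0 (mxvec_index i (s i)))); last first.
    by apply/funext => b; rewrite big_cons.
  move=> b.
  have c1 : {for b, continuous (fun a : 'rV[R]_(n * n) => (-1) ^+ s * \prod_i a 0 (mxvec_index i (s i)))}.
    by apply: continuousM; [exact: cst_continuous|exact: cp].
  exact: (cvgD c1 (IH b)).
exact: cs.
Qed.
End det_cts.

Section euclid.
Variables (R : realType) (I : finType).

Lemma sqrt_sum_triangle (a b : I -> R) :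
  Num.sqrt (\sum_i (a i + b i) ^+ 2) <= Num.sqrt (\sum_i a i ^+ 2) + Num.sqrt (\sum_i b i ^+ 2).
Proof.
set A := \sum_i a i ^+ 2; set B := \sum_i b i ^+ 2.
have A0 : 0 <= A by apply: sumr_ge0 => i _; exact: sqr_ge0.
have B0 : 0 <= B by apply: sumr_ge0 => i _; exact: sqr_ge0.
pose al := Num.sqrt A; pose be := Num.sqrt B.
have al0 : 0 <= al := sqrtr_ge0 _; have be0 : 0 <= be := sqrtr_ge0 _.
have alE : al ^+ 2 = A := sqr_sqrtr A0; have beE : be ^+ 2 = B := sqr_sqrtr B0.
have zero (c : I -> R) : \sum_i c i ^+ 2 = 0 -> forall i, c i = 0.
  move=> /eqP; rewrite psumr_eq0 => [/allP h i|i _]; last exact: sqr_ge0.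
  by apply/eqP; have := h i; rewrite mem_index_enum sqrf_eq0 => /(_ isT).
have CS : \sum_i a i * b i <= al * be.
  have [a0|a0] := eqVneq al 0.
    rewrite a0 mul0r big1// => i _; rewrite (zero a) ?mul0r//.
    by rewrite -/A -alE a0 expr0n.
  have [b0|b0] := eqVneq be 0.
    rewrite b0 mulr0 big1// => i _; rewrite (zero b) ?mulr0//.
    by rewrite -/B -beE b0 expr0n.
  have ab0 : 0 < al * be by rewrite mulr_gt0// lt0r ?a0 ?b0.
  have : 0 <= \sum_i (be * a i - al * b i) ^+ 2 by apply: sumr_ge0 => i _; exact: sqr_ge0.
  have -> : \sum_i (be * a i - al * b i) ^+ 2 = be ^+ 2 * A + al ^+ 2 * B - 2 * (al * be) * \sum_i a i * b i.
    rewrite !mulr_sumr -big_split -sumrB; apply: eq_bigr => i _ /=; ring.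
  rewrite -alE -beE => h; rewrite -(ler_pM2l ab0); nra.
rewrite -(@ler_pXn2r _ 2)// ?nnegrE ?sqrtr_ge0// ?addr_ge0 ?sqrtr_ge0//.
rewrite sqr_sqrtr; last by apply: sumr_ge0 => i _; exact: sqr_ge0.
rewrite sqrrD -/al -/be alE beE.
have -> : \sum_i (a i + b i) ^+ 2 = A + (\sum_i a i * b i) *+ 2 + B.
  by rewrite -mulr_natl mulr_sumr -!big_split; apply: eq_bigr => i _ /=; ring.
by rewrite lerD2r lerD2l lerMn2r CS orbT.
Qed.
End euclid.

(** * Lewis' change of density *)

Section Lr_norm.
Context d (T : measurableType d) (R : realType).
Variable mu : {measure set T -> \bar R}.
Variable r : R.
Hypothesis r1 : 1 <= r.
Let r0 : 0 < r. Proof. exact: lt_le_trans r1. Qed.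
Notation Lf := (Lfun mu r%:E).

Definition pint (f : T -> R) := \int[mu]_s (`|f s| `^ r).
Definition nmr f := pint f `^ r^-1.

Lemma pint_ge0 f : 0 <= pint f.
Proof. by apply: Rintegral_ge0 => s _; exact: powR_ge0. Qed.

Lemma Lfun_measurable f : f \in Lf -> measurable_fun setT f.
Proof. by move=> /andP[]; rewrite inE. Qed.

Lemma Lfun_pow_integrable f : f \in Lf -> mu.-integrable setT (EFin \o (fun s => `|f s| `^ r)).
Proof. by move=> fL; have := Lfun_integrable r1 fL. Qed.

Lemma LnormE f : f \in Lf -> ('N[mu]_r%:E[EFin \o f] = (nmr f)%:E)%E.
Proof.
move=> fL; rewrite unlock /Lnorm /nmr -poweR_EFin; congr (_ `^ _)%E.
rewrite /pint /Rintegral fineK; last by apply: integrable_fin_num => //; exact: Lfun_pow_integrable.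
by apply: eq_integral => s _ /=; rewrite ?poweR_EFin.
Qed.

Lemma Lfun_le (f g : T -> R) : measurable_fun setT f -> g \in Lf -> (forall s, `|f s| <= `|g s|) -> f \in Lf.
Proof.
move=> mf gL fg; apply/andP; split; rewrite inE//=.
have := gL; rewrite /Lfun => /andP[_]; rewrite inE/= /finite_norm; apply: le_lt_trans.
rewrite unlock /Lnorm; apply: gt0_ler_poweR; rewrite ?invr_ge0 ?(ltW r0)//.
- by rewrite in_itv/= leey integral_ge0.
- by rewrite in_itv/= leey integral_ge0.
have mp (h : T -> R) : measurable_fun setT h -> measurable_fun setT (fun x : T => (`|(EFin \o h) x| `^ r)%E).
  move=> mh; apply: (measurableT_comp (measurable_poweR r)).
  by apply: measurableT_comp => //; exact/measurable_EFinP.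
apply: ge0_le_integral => //.
- by move=> s _; exact: poweR_ge0.
- exact: mp.
- by apply: mp; exact: Lfun_measurable.
move=> s _; rewrite /= lee_fin.
by rewrite ge0_ler_powR ?nnegrE// ltW.
Qed.

Lemma Lfun_abs f : f \in Lf -> (fun s => `|f s|) \in Lf.
Proof.
move=> fL; apply: Lfun_le (fL) _ => [|s]; last by rewrite normr_id.
by apply: measurableT_comp => //; exact: Lfun_measurable.
Qed.

Let r1' : (1 <= r%:E)%E. Proof. by rewrite lee_fin. Qed.

Let Lfun_linear a f g : f \in Lf -> g \in Lf -> (fun s => a * f s + g s) \in Lf.
Proof. exact: (Lfun_submod_closed mu r1').2. Qed.

Lemma LfunD f g : f \in Lf -> g \in Lf -> (fun s => f s + g s) \in Lf.
Proof. by move=> /(Lfun_linear 1)/[apply]; under eq_fun do rewrite mul1r. Qed.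

Lemma LfunZ a f : f \in Lf -> (fun s => a * f s) \in Lf.
Proof.
move=> /(Lfun_linear a)/(_ (Lfun_submod_closed mu r1').1).
by under eq_fun do rewrite addr0.
Qed.

Lemma Lfun_sum I (s : seq I) (f : I -> T -> R) : (forall i, f i \in Lf) ->
  (fun x => \sum_(i <- s) f i x) \in Lf.
Proof.
move=> fL; elim: s => [|i s IH].
  have [h0 _] := Lfun_submod_closed mu r1'.
  rewrite (_ : (fun x => _) = 0)//; by apply/funext => x; rewrite big_nil.
rewrite (_ : (fun x => _) = (fun x => f i x + \sum_(i <- s) f i x)); last by apply/funext => x; rewrite big_cons.
exact: LfunD.
Qed.

Lemma le_pint f g : f \in Lf -> g \in Lf -> (forall s, `|f s| <= `|g s|) -> pint f <= pint g.
Proof.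
move=> fL gL fg; apply: le_Rintegral => //; [exact: Lfun_pow_integrable..|].
by move=> s _; rewrite ge0_ler_powR ?nnegrE// ltW.
Qed.

Lemma le_nmr f g : f \in Lf -> g \in Lf -> (forall s, `|f s| <= `|g s|) -> nmr f <= nmr g.
Proof. by move=> fL gL fg; rewrite ge0_ler_powR ?nnegrE ?pint_ge0 ?invr_ge0 ?(ltW r0)//; exact: le_pint. Qed.

Lemma nmrD f g : f \in Lf -> g \in Lf -> nmr (fun s => f s + g s) <= nmr f + nmr g.
Proof.
move=> fL gL.
have h := minkowski_EFin mu (Lfun_measurable fL) (Lfun_measurable gL) r1.
have e : 'N[mu]_r%:E[EFin \o (f \+ g)%R]%E = (nmr (fun s => f s + g s))%:E := LnormE (LfunD fL gL).
by move: h; rewrite e (LnormE fL) (LnormE gL) -EFinD lee_fin.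
Qed.

Lemma pintZ a f : f \in Lf -> pint (fun s => a * f s) = `|a| `^ r * pint f.
Proof.
move=> fL; rewrite /pint -RintegralZl//; last exact: Lfun_pow_integrable.
by apply: eq_Rintegral => s _; rewrite normrM powRM.
Qed.

Lemma nmrZ a f : f \in Lf -> nmr (fun s => a * f s) = `|a| * nmr f.
Proof.
move=> fL; rewrite /nmr pintZ// powRM ?powR_ge0 ?pint_ge0//.
by rewrite -powRrM mulfV ?gt_eqF// powRr1.
Qed.

Lemma pint_nmr f : pint f = nmr f `^ r.
Proof. by rewrite /nmr -powRrM mulVf ?gt_eqF// powRr1// pint_ge0. Qed.

Lemma nmr_eq0 f : f \in Lf -> nmr f = 0 -> {ae mu, forall s, f s = 0}.
Proof.
move=> fL f0; have := LnormE fL; rewrite f0 => N0.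
have mf : measurable_fun setT (EFin \o f) by exact/measurable_EFinP/Lfun_measurable.
have := Lnorm_eq0_eq0 mf _ N0; rewrite lte_fin => /(_ r0).
by apply: filterS => s /(_ I)[].
Qed.

End Lr_norm.

(** * Elementary inequalities behind the first-order conditions *)

Section power_bounds.
Variable R : realType.

(** From ln(1 + t) >= t / (1 + t) and exp(y) >= 1 + y; it covers exponents on both sides of 1. *)
Lemma powR_ge_tangent (q t : R) : 0 <= q -> -1 < t -> 1 + q * (t / (1 + t)) <= (1 + t) `^ q.
Proof.
move=> q0 t1; have t0 : 0 < 1 + t by lra.
have h : t / (1 + t) <= ln (1 + t).
  have := @le_ln1Dx R ((1 + t)^-1 - 1).
  rewrite [1 + (_ - 1)]addrC subrK lnV ?posrE// ltrBrDl subrr invr_gt0 => /(_ t0).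
  have -> : (1 + t)^-1 - 1 = - (t / (1 + t)) by field; rewrite gt_eqF.
  by rewrite lerN2.
apply: (@le_trans _ _ (expR (q * (t / (1 + t))))); first exact: expR_ge1Dx.
by rewrite /powR gt_eqF// ler_expR ler_wpM2l.
Qed.

Lemma expR_le_quadratic (y : R) : y <= 2^-1 -> expR y <= 1 + y + 2 * y ^+ 2.
Proof.
move=> y2; have h : 0 < 1 - y by lra.
have : expR y <= (1 - y)^-1.
  by rewrite -[y in leLHS]opprK expRN lef_pV2 ?posrE ?expR_gt0// expR_ge1Dx.
move=> /le_trans; apply.
rewrite -div1r ler_pdivrMr//.
have -> : (1 + y + 2 * y ^+ 2) * (1 - y) = 1 + y ^+ 2 * (1 - 2 * y) by ring.
by rewrite lerDl mulr_ge0 ?sqr_ge0//; lra.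
Qed.

Lemma powR_le_quadratic (q z : R) : 0 <= q -> -1 < z -> q * z <= 2^-1 ->
  (1 + z) `^ q <= 1 + q * z + 2 * (q * z) ^+ 2.
Proof.
move=> q0 z1 qz; have z0 : 0 < 1 + z by lra.
apply: le_trans (expR_le_quadratic qz).
by rewrite /powR gt_eqF// ler_expR ler_wpM2l// le_ln1Dx.
Qed.

(** The first-order condition at an extremum, drawn from a two-sided expansion with quadratic error;
    it spares a differentiation under the integral sign. *)
Lemma quadratic_bound_eq0 (a C e : R) : 0 < e ->
  (forall t, `|t| <= e -> 0 <= a * t + C * t ^+ 2) -> a = 0.
Proof.
move=> e0 h; apply/eqP; rewrite eq_le; apply/andP.
have C1 : 0 < `|C| + 1 by rewrite ltr_wpDl.
have key (b : R) : (forall t, 0 <= t <= e -> 0 <= b * t + C * t ^+ 2) -> 0 <= b.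
  move=> hb; rewrite leNgt; apply/negP => b0.
  pose t := Num.min e (- b / (2 * (`|C| + 1))).
  have t0 : 0 < t by rewrite lt_min e0 divr_gt0 ?mulr_gt0// oppr_gt0.
  have te : t <= e by rewrite ge_min lexx.
  have tb : t * (2 * (`|C| + 1)) <= - b by rewrite -ler_pdivlMr ?mulr_gt0// ge_min lexx orbT.
  have := hb t; rewrite (ltW t0) te => /(_ isT).
  have -> : b * t + C * t ^+ 2 = t * (b + C * t) by ring.
  rewrite pmulr_rge0//; have := ler_norm C; nra.
split.
  rewrite -oppr_ge0; apply: key => t /andP[t0 te].
  by have := h (- t); rewrite normrN ger0_norm// sqrrN mulrN mulNr => /(_ te).
by apply: key => t /andP[t0 te]; apply: h; rewrite ger0_norm.
Qed.
End power_bounds.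

Section lewis.
Context d (T : measurableType d) (R : realType).
Variable mu : {measure set T -> \bar R}.
Variable r : R.
Hypothesis r1 : 1 <= r.
Let r0 : 0 < r. Proof. exact: lt_le_trans r1. Qed.
Notation Lf := (Lfun mu r%:E).
Variables (n : nat) (w : 'I_n -> T -> R).
Hypothesis n0 : (0 < n)%N.
Hypothesis wL : forall i, w i \in Lf.
Hypothesis indep : forall x : 'rV[R]_n, {ae mu, forall s, ip w x s = 0} -> x = 0.

Lemma Lfun_ip x : ip w x \in Lf.
Proof. by apply: Lfun_sum => // i; exact: LfunZ. Qed.

(** Euclidean length of the vector of functions given by the rows of A. Its L_r norm is Lewis' norm
    on matrices. *)
Definition ev (A : 'M[R]_n) s := Num.sqrt (\sum_k ip w (row k A) s ^+ 2).

Lemma ev_ge0 A s : 0 <= ev A s. Proof. exact: sqrtr_ge0. Qed.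

Lemma ev_le A s : ev A s <= \sum_k `|ip w (row k A) s|.
Proof.
set S := \sum_k _; have S0 : 0 <= S by apply: sumr_ge0.
rewrite -(@ler_pXn2r _ 2)// ?nnegrE ?sqrtr_ge0// sqr_sqrtr; last first.
  by apply: sumr_ge0 => k _; exact: sqr_ge0.
rewrite expr2 {1}/S mulr_suml; apply: ler_sum => k _.
rewrite -real_normK ?num_real// expr2 ler_wpM2l// /S (bigD1 k)//= lerDl.
exact: sumr_ge0.
Qed.

Lemma measurable_ev A : measurable_fun setT (ev A).
Proof.
rewrite (_ : ev A = fun s => (\sum_k ip w (row k A) s ^+ 2) `^ 2^-1); last first.
  by apply/funext => s; rewrite powR12_sqrt// sumr_ge0// => k _; exact: sqr_ge0.
apply: (measurableT_comp (@measurable_powR R 2^-1)).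
apply: measurable_sum => k; apply: measurable_funX.
exact: Lfun_measurable (Lfun_ip _).
Qed.

Lemma Lfun_ev A : ev A \in Lf.
Proof.
apply: (@Lfun_le _ _ _ mu r r1 _ (fun s => \sum_k `|ip w (row k A) s|)).
- exact: measurable_ev.
- by apply: Lfun_sum => // k; apply: Lfun_abs => //; exact: Lfun_ip.
- by move=> s; rewrite !ger0_norm ?ev_ge0 ?sumr_ge0// ev_le.
Qed.

Let N (a : 'rV[R]_(n * n)) := nmr mu r (ev (vec_mx a)).

Let ipE x s : ip w x s = \sum_i x 0 i * w i s. Proof. by []. Qed.

Let N_tri a b : N (a + b) <= N a + N b.
Proof.
rewrite /N raddfD/=; set A := vec_mx a; set B := vec_mx b.
apply: le_trans (nmrD r1 (Lfun_ev A) (Lfun_ev B)).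
apply: le_nmr => //; [exact: Lfun_ev|by apply: LfunD => //; exact: Lfun_ev|] => s.
rewrite !ger0_norm ?addr_ge0 ?ev_ge0//.
rewrite /ev; under eq_bigr do rewrite raddfD/= ipD.
exact: sqrt_sum_triangle.
Qed.

Let evZ c A s : ev (c *: A) s = `|c| * ev A s.
Proof.
rewrite /ev -sqrtr_sqr -sqrtrM ?sqr_ge0// mulr_sumr; congr Num.sqrt.
by apply: eq_bigr => k _; rewrite linearZ/= ipZ exprMn.
Qed.

Let NZ c a : N (c *: a) = `|c| * N a.
Proof.
have := nmrZ r1 `|c| (Lfun_ev (vec_mx a)); rewrite normr_id /N => <-.
by congr nmr; apply/funext => s; rewrite linearZ/= evZ.
Qed.

Let N_eq0 a : N a = 0 -> a = 0.
Proof.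
move=> /(nmr_eq0 r1 (Lfun_ev _)) h; apply: (can_inj (@vec_mxK _ n n)); rewrite raddf0.
apply/row_matrixP => k; rewrite row0; apply: indep.
apply: filterS h => s /eqP; rewrite sqrtr_eq0 => h.
apply/eqP; rewrite -sqrf_eq0 eq_le sqr_ge0 andbT (le_trans _ h)// (bigD1 k)//= lerDl.
by apply: sumr_ge0 => j _; exact: sqr_ge0.
Qed.

Let N_ge0 a : 0 <= N a. Proof. exact: powR_ge0. Qed.

(* [A0] maximizes the determinant over the unit ball of the norm
   [A |-> nmr mu r (ev A)] on matrices. *)
Lemma lewis_max : exists A0 : 'M[R]_n, [/\ 0 < \det A0, pint mu r (ev A0) = 1 &
  forall B : 'M[R]_n, 0 < \det B -> (\det B) `^ (r / n%:R) <= pint mu r (ev (B *m A0)) ].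
Proof.
have nR : 0 < n%:R :> R by rewrite ltr0n.
pose K := [set a : 'rV[R]_(n * n) | N a <= 1].
have cK : compact K by exact: (@norm_ball_compact _ _ _ N_tri NZ N_eq0).
have K0 : K 0 by rewrite /K/= -(scale0r (0 : 'rV[R]_(n * n))) NZ normr0 mul0r.
have [a0 a0K hmax] := compact_EVT_max (ex_intro _ _ K0) cK (continuous_subspaceT (@det_cts R n)).
rewrite inE in a0K.
pose A0 : 'M[R]_n := vec_mx a0.
have maxA (A : 'M[R]_n) : nmr mu r (ev A) <= 1 -> \det A <= \det A0.
  move=> h; have := hmax (mxvec A); rewrite mxvecK; apply.
  by rewrite inE /K/= /N mxvecK.
have nrm_gt0 (A : 'M[R]_n) : \det A != 0 -> 0 < nmr mu r (ev A).
  move=> dA; rewrite lt_neqAle powR_ge0 andbT eq_sym; apply/eqP => h.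
  have : N (mxvec A) = 0 by rewrite /N mxvecK.
  move=> /N_eq0 /(congr1 vec_mx); rewrite mxvecK raddf0 => A00.
  by move: dA; rewrite A00 -(scale0r (0 : 'M[R]_n)) detZ expr0n gtn_eqF// mul0r eqxx.
have nrmZ c (A : 'M[R]_n) : nmr mu r (ev (c *: A)) = `|c| * nmr mu r (ev A).
  by have := NZ c (mxvec A); rewrite /N linearZ/= mxvecK.
(* Homogeneous form of the maximality, by scaling A to norm 1. *)
have norml (A : 'M[R]_n) : 0 < \det A -> \det A <= nmr mu r (ev A) ^+ n * \det A0.
  move=> dA; have nA := nrm_gt0 A (lt0r_neq0 dA).
  have := maxA ((nmr mu r (ev A))^-1 *: A); rewrite nrmZ gtr0_norm ?invr_gt0// mulVf ?gt_eqF// => /(_ (lexx _)).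
  by rewrite detZ exprVn ler_pdivrMl// exprn_gt0.
have dA0 : 0 < \det A0.
  have := norml 1%:M; rewrite det1 => /(_ ltr01) h.
  have := lt_le_trans ltr01 h; rewrite pmulr_rgt0// exprn_gt0// nrm_gt0// det1 oner_neq0//.
have N0 := nrm_gt0 _ (lt0r_neq0 dA0).
have N1 : nmr mu r (ev A0) = 1.
  apply/eqP; rewrite eq_le a0K/=.
  have := norml A0 dA0; rewrite -[leLHS]mul1r ler_pM2r// => h.
  rewrite leNgt; apply/negP => N1.
  have : nmr mu r (ev A0) ^+ n < 1 by rewrite exprn_ilt1 ?(ltW N0)// -lt0n.
  by rewrite ltNge h.
exists A0; split => //; first by rewrite pint_nmr// N1 powR1.
move=> B dB; rewrite pint_nmr//.
have dBA : 0 < \det (B *m A0) by rewrite det_mulmx mulr_gt0.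
have NB := nrm_gt0 _ (lt0r_neq0 dBA).
have := norml _ dBA; rewrite det_mulmx ler_pM2r// => h.
move: NB h; move: (nmr mu r (ev (B *m A0))) => x x0 h.
have -> : x `^ r = (x ^+ n) `^ (r / n%:R).
  by rewrite -powR_mulrn ?(ltW x0)// -powRrM mulrC divfK// gt_eqF.
rewrite ge0_ler_powR ?nnegrE// ?(ltW dB) ?exprn_ge0 ?(ltW x0)//.
by rewrite divr_ge0// ltW.
Qed.

End lewis.

Lemma det_1_delta (R : comPzRingType) n (t : R) (i j : 'I_n) :
  \det (1%:M + t *: delta_mx i j) = 1 + t * (i == j)%:R.
Proof.
wlog ij : i j / (j <= i)%N => [H|].
  have [|/ltnW ij] := leqP j i; first exact: H.
  by rewrite -det_tr raddfD/= trmx1 linearZ/= trmx_delta H// eq_sym.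
rewrite det_trig; last first.
  apply/is_trig_mxP => k l kl; have /negbTE klF : k != l by rewrite neq_ltn kl.
  rewrite !mxE klF mulr0n add0r.
  have [ki|_] := eqVneq k i; last by rewrite mulr0.
  have [lj|_] := eqVneq l j; last by rewrite mulr0.
  by move: kl; rewrite ki lj ltnNge ij.
rewrite (bigD1 i)//= !mxE !eqxx big1 ?mulr1// => k ki.
by rewrite !mxE eqxx (negbTE ki) mulr0 addr0.
Qed.

Section lewis_position.
Context d (T : measurableType d) (R : realType).
Variable mu : {measure set T -> \bar R}.
Variable r : R.
Hypothesis r1 : 1 <= r.
Let r0 : 0 < r. Proof. exact: lt_le_trans r1. Qed.
Notation Lf := (Lfun mu r%:E).
Variables (n : nat) (w : 'I_n -> T -> R).
Hypothesis n0 : (0 < n)%N.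
Hypothesis wL : forall i, w i \in Lf.
Hypothesis indep : forall x : 'rV[R]_n, {ae mu, forall s, ip w x s = 0} -> x = 0.

(* The first-order conditions at [A0] in the directions [E_ij *m A0] say that
   the functions [u i] are orthonormal for the weight [n (ev A0)^r]. *)
Lemma lewis : exists (A : 'M[R]_n) (rho : T -> R) (u : 'I_n -> T -> R),
  [/\ A \in unitmx, forall s, 0 <= rho s, mu.-integrable setT (EFin \o rho) &
   [/\ forall i, measurable_fun setT (u i), forall s, \sum_i u i s ^+ 2 = 1,
    forall i j, wint mu rho (fun s => u i s * u j s) = (i == j)%:R &
    forall x s, `|ip w (x *m A) s| `^ r = rho s * `|ip u x s| `^ r]].
Proof.
have [A0 [dA0 pA0 hmax]] := lewis_max r1 n0 wL indep.
have nR : 0 < n%:R :> R by rewrite ltr0n.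
pose e := ev w A0.
pose v k s := ip w (row k A0) s.
pose k0 := Ordinal n0.
(* Where e vanishes, u is set to a basis vector: u then has length 1 everywhere, and the weight e^r
   vanishes there. *)
pose u k s := if e s == 0 then (k == k0)%:R else v k s / e s.
have e0 s : 0 <= e s by exact: ev_ge0.
have me : measurable_fun setT e by have := Lfun_measurable (Lfun_ev r1 wL A0).
have sv s : \sum_k v k s ^+ 2 = e s ^+ 2.
  by rewrite /e /ev sqr_sqrtr// sumr_ge0// => k _; exact: sqr_ge0.
have vu k s : v k s = e s * u k s.
  rewrite /u; case: eqP => [es|/eqP es]; last by rewrite mulrCA divff// mulr1.
  rewrite es mul0r; apply/eqP; rewrite -sqrf_eq0; apply/eqP.
  apply: (psumr_eq0P (P := xpredT) (F := fun j => v j s ^+ 2)) => //.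
    by move=> j _; exact: sqr_ge0.
  by rewrite sv es expr0n.
have mv k : measurable_fun setT (v k) by exact: Lfun_measurable (Lfun_ip r1 wL _).
have mu_ k : measurable_fun setT (u k).
  apply: measurable_fun_ifT => //; first by apply: measurable_fun_eqr.
  apply: measurable_funM => //.
  rewrite (_ : (fun x => (e x)^-1) = fun x => e x `^ (-1)).
    exact: (measurableT_comp (@measurable_powR R (-1))).
  by apply/funext => x; rewrite powR_inv1.
have u1 s : \sum_k u k s ^+ 2 = 1.
  rewrite /u; case: (boolP (e s == 0)) => es.
    rewrite (bigD1 k0)//= -/k0 ?eqxx ?mulr1n expr1n big1 ?addr0// => k /negbTE ->.
    by rewrite expr0n.
  under eq_bigr do rewrite expr_div_n.
  by rewrite -mulr_suml sv divff// sqrf_eq0.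
pose rho0 s := e s `^ r.
have rho0_ge0 s : 0 <= rho0 s by exact: powR_ge0.
have rho0_int : mu.-integrable setT (EFin \o rho0).
  have := Lfun_pow_integrable r1 (Lfun_ev r1 wL A0).
  by apply: eq_integrable => // s _; rewrite /= ger0_norm.
have ipA x s : ip w (x *m A0) s = e s * ip u x s.
  rewrite /ip; under eq_bigr do rewrite mxE mulr_suml.
  rewrite exchange_big mulr_sumr; apply: eq_bigr => k _.
  rewrite mulrCA -vu /v /ip mulr_sumr; apply: eq_bigr => i _.
  by rewrite mxE mulrA.
pose I0 := wint mu rho0.
have I01 : I0 (fun=> 1) = 1.
  rewrite -[RHS]pA0 /I0 /wint /pint; apply: eq_Rintegral => s _.
  by rewrite mulr1 ger0_norm ?ev_ge0.
have bu := bmu mu_ u1.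
have buu i j : bounded_measurable (fun s => u i s * u j s) by exact: bmM.
(* Adding t u_j to the i-th coordinate of the unit vector u changes its squared length to 1 + 2 t
   u_i u_j + t^2 u_j^2; the factor e^r becomes the weight. *)
have pB i j t : pint mu r (ev w ((1%:M + t *: delta_mx i j) *m A0)) =
    I0 (fun s => (1 + (2 * t * (u i s * u j s) + t ^+ 2 * u j s ^+ 2)) `^ (r / 2)).
  rewrite /I0 /wint /pint; apply: eq_Rintegral => s _.
  set B := 1%:M + _.
  have ipB k : ip w (row k (B *m A0)) s = e s * (u k s + t * (k == i)%:R * u j s).
    rewrite row_mul ipA; congr (_ * _).
    rewrite /ip /B raddfD/= linearZ/=.
    under eq_bigr do rewrite !mxE mulrDl.
    rewrite big_split/=; congr (_ + _).
      rewrite (bigD1 k)//= eqxx mul1r big1 ?addr0// => l /negbTE lk.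
      by rewrite eq_sym lk mul0r.
    rewrite (bigD1 j)//= eqxx andbT big1 ?addr0// => l /negbTE lj.
    by rewrite lj andbF mulr0 mul0r.
  rewrite ger0_norm ?ev_ge0// /ev.
  have -> : \sum_k ip w (row k (B *m A0)) s ^+ 2 =
      e s ^+ 2 * (1 + (2 * t * (u i s * u j s) + t ^+ 2 * u j s ^+ 2)).
    under eq_bigr do rewrite ipB exprMn.
    rewrite -mulr_sumr; congr (_ * _).
    under eq_bigr do rewrite sqrrD.
    rewrite !big_split/= u1 -addrA; congr (1 + (_ + _)).
      rewrite (bigD1 i)//= eqxx mulr1 big1 ?addr0; first by rewrite mulr2n; ring.
      by move=> k /negbTE ki; rewrite ki /= mulr0n; ring.
    rewrite (bigD1 i)//= eqxx mulr1 exprMn big1 ?addr0//.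
    by move=> k /negbTE ->; rewrite mulr0 mul0r expr0n.
  have z0 : 0 <= 1 + (2 * t * (u i s * u j s) + t ^+ 2 * u j s ^+ 2).
    have := sqr_ge0 (u i s + t * u j s).
    have h : u i s ^+ 2 <= 1.
      by rewrite -(u1 s) (bigD1 i)//= lerDl sumr_ge0// => k _; exact: sqr_ge0.
    by move=> h2; move: h h2; nra.
  rewrite sqrtrM ?sqr_ge0// sqrtr_sqr ger0_norm// powRM ?sqrtr_ge0//.
  congr (_ * _); rewrite -powR12_sqrt// -powRrM; congr (_ `^ _); exact: mulrC.
have I0uu i j : I0 (fun s => u i s * u j s) = (i == j)%:R / n%:R.
  pose q := r / 2.
  have q0 : 0 < q by rewrite divr_gt0.
  (* For |t| <= eps one has |t| <= 1/6 and 3 q |t| <= 1/2. As the perturbation z below satisfies |z|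
     <= 3 |t|, this is the range of [powR_le_quadratic]. *)
  pose eps := (6 * q + 6)^-1.
  have eps0 : 0 < eps by rewrite invr_gt0; lra.
  have epsE : eps * (6 * q + 6) = 1 by rewrite mulVf// gt_eqF//; lra.
  (* The summands come from t^2 u_j^2 <= t^2, from 2 (q z)^2 with z^2 <= 9 t^2, and from t / (1 + t)
     >= t - 2 t^2 in the lower bound. *)
  pose C := q + 18 * q ^+ 2 + 2 * (r / n%:R).
  suff : r * (I0 (fun s => u i s * u j s) - (i == j)%:R / n%:R) = 0.
    by move=> /eqP; rewrite mulf_eq0 gt_eqF//= subr_eq0 => /eqP.
  apply: (@quadratic_bound_eq0 _ _ C eps) => // t te.
  have t16 : `|t| <= 6^-1.
    apply: (le_trans te); rewrite /eps lef_pV2 ?posrE//; lra.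
  have tq : q * (3 * `|t|) <= 2^-1.
    have : `|t| * (6 * q + 6) <= 1 by rewrite -[leRHS]epsE ler_wpM2r//; lra.
    have := normr_ge0 t; lra.
  have t1 : -6^-1 <= t <= 6^-1 by rewrite -ler_norml.
  have tt : t ^+ 2 = `|t| ^+ 2 by rewrite real_normK// num_real.
  have := hmax (1%:M + t *: delta_mx i j); rewrite det_1_delta pB.
  have det0 : -6^-1 <= t * (i == j)%:R.
    by case: (i == j); rewrite ?mulr1 ?mulr0; lra.
  have -> : 0 < 1 + t * (i == j)%:R by lra.
  move=> /(_ isT) hm.
  have lower : 1 + (r / n%:R) * (t * (i == j)%:R - 2 * t ^+ 2) <= (1 + t * (i == j)%:R) `^ (r / n%:R).
    apply: le_trans (powR_ge_tangent _ _); [|by rewrite divr_ge0// ltW|lra].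
    rewrite lerD2l ler_wpM2l ?divr_ge0 ?(ltW r0)// ler_pdivlMr; last by lra.
    by case: (i == j); rewrite ?mulr1 ?mulr0; nra.
  have upper : I0 (fun s => (1 + (2 * t * (u i s * u j s) + t ^+ 2 * u j s ^+ 2)) `^ (r / 2)) <=
      I0 (fun s => (1 + (q + 18 * q ^+ 2) * t ^+ 2) + r * t * (u i s * u j s)).
    have hz s : let z := 2 * t * (u i s * u j s) + t ^+ 2 * u j s ^+ 2 in
       `|z| <= 3 * `|t| /\ z <= 2 * t * (u i s * u j s) + t ^+ 2.
      have ui := u_le1 u1 i s; have uj := u_le1 u1 j s.
      have uu : `|u i s * u j s| <= 1 by rewrite normrM mulr_ile1.
      have uj2 : 0 <= u j s ^+ 2 <= 1.
        by rewrite sqr_ge0 -real_normK ?num_real// exprn_ile1.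
      have ht : 0 <= t ^+ 2 by exact: sqr_ge0.
      split; last by rewrite lerD2l; nra.
      have h1 : `|2 * t * (u i s * u j s)| <= 2 * `|t|.
        by rewrite normrM [`|2 * t|]normrM ger0_norm// ler_piMr// mulr_ge0.
      have h2 : `|t ^+ 2 * u j s ^+ 2| <= `|t|.
        rewrite ger0_norm; last by rewrite mulr_ge0 ?sqr_ge0.
        rewrite tt.
        have := normr_ge0 t; nra.
      rewrite (le_trans (ler_normD _ _))//; lra.
    apply: le_wint => //.
    - apply: (@bm_comp _ _ _ (fun s => 1 + (2 * t * (u i s * u j s) + t ^+ 2 * u j s ^+ 2)) (fun y => y `^ (r / 2)) 2 (2 `^ (r / 2) + 1)).
      + apply: bmD; first exact: bmC.
        by apply: bmD; apply: bmZ => //; exact: bmX.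
      + exact: measurable_powR.
      + move=> s; rewrite (le_trans (ler_normD _ _))// normr1.
        by have [h _] := hz s; lra.
      + move=> x x2; rewrite ger0_norm ?powR_ge0//.
        have [x0|x0] := leP 0 x; last by rewrite lt0_powR1// lerDr powR_ge0.
        rewrite ler_wpDr// ge0_ler_powR ?nnegrE ?(ltW q0)//.
        by rewrite (le_trans (ler_norm _)).
    - apply: bmD; first exact: bmC.
      exact: bmZ.
    move=> s; have [] := hz s; set z := 2 * _ * _ + _ => za zb.
    have z1 : `|z| <= 2^-1 by lra.
    have zq : q * z <= 2^-1.
      by rewrite (le_trans _ tq)// ler_wpM2l ?(ltW q0)// (le_trans (ler_norm _)).
    have zm : -1 < z by move: z1; rewrite ler_norml => /andP[]; lra.
    apply: (le_trans (powR_le_quadratic (ltW q0) zm zq)).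
    have z2 : z ^+ 2 <= 9 * t ^+ 2.
      rewrite tt -real_normK ?num_real//.
      have := normr_ge0 z; nra.
    have -> : r = 2 * q by rewrite /q mulrC divfK.
    have h1 := ler_wpM2l (ltW q0) zb; have h2 := ler_wpM2l (sqr_ge0 q) z2.
    by move: h1 h2; rewrite [(q * z) ^+ 2]exprMn; lra.
  have := le_trans lower (le_trans hm upper).
  rewrite {1}/I0 wintD//; [|exact: bmC|exact: bmZ].
  rewrite wint_cst// wintZ// -/I0 I01 mulr1 /C.
  set a := I0 _; set dl := (i == j)%:R; move=> h.
  have : 0 <= (1 + (q + 18 * q ^+ 2) * t ^+ 2 + r * t * a) - (1 + r / n%:R * (t * dl - 2 * t ^+ 2)).
    by rewrite subr_ge0.
  congr (0 <= _); ring.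
(* So far the weight has mass 1 and isotropy constant 1/n; scaling [A0] by c, with c^r = n, turns
   the constant into 1. *)
pose c := n%:R `^ r^-1.
have cr : c `^ r = n%:R by rewrite -powRrM mulVf ?gt_eqF// powRr1// ltW.
have c0 : 0 < c by exact: powR_gt0.
have intn : mu.-integrable setT (EFin \o (fun s => n%:R * rho0 s)).
  have := @integrableZl _ _ _ mu _ measurableT n%:R _ rho0_int.
  by apply: eq_integrable => // s _.
exists (c *: A0), (fun s => n%:R * rho0 s), u; split => //.
- by rewrite unitmxE detZ unitfE mulf_neq0// ?expf_neq0 ?gt_eqF.
- by move=> s; rewrite mulr_ge0.
split => //.
- move=> i j; transitivity (n%:R * I0 (fun s => u i s * u j s)).
    rewrite /I0 -wintZ// /wint; apply: eq_Rintegral => s _; ring.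
  by rewrite I0uu mulrC divfK// gt_eqF.
- move=> x s; rewrite -scalemxAr ipZ ipA !normrM !powRM ?mulr_ge0//.
  by rewrite (gtr0_norm c0) cr (ger0_norm (e0 s)) mulrA.
Qed.

End lewis_position.

(** * Ellipsoids in the l_p^n ball *)

Section euclidean_ball.
Variables (R : realType) (n : nat).

Definition eball := [set u : 'rV[R]_n | \sum_i u ord0 i ^+ 2 <= 1].

Lemma eball_lp_ball : eball = lp_ball 2.
Proof.
rewrite /eball /lp_ball /lp_pow; apply/funext => u; congr (_ <= 1 : Prop).
by apply: eq_bigr => i _; rewrite powR_mulrn// real_normK// num_real.
Qed.

Let r2 : 1 <= 2 :> R. Proof. lra. Qed.

Lemma vset_eball : vset eball.
Proof. by rewrite eball_lp_ball; exact: vset_lp_ball. Qed.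

Lemma volume_eball_gt0 : (0 < volume eball)%E.
Proof. by rewrite eball_lp_ball; exact: volume_lp_ball_gt0. Qed.

Lemma volume_eball_fin : volume eball \is a fin_num.
Proof.
rewrite ge0_fin_numE ?ltW ?volume_eball_gt0// eball_lp_ball.
by rewrite (le_lt_trans (volume_lp_ball_cube _ r2))// ltry.
Qed.

End euclidean_ball.

Section tangent.
Variable R : realType.

(** The graph of the concave function a^q lies below its tangent at th; Young's inequality for (a /
    th)^q and 1 proves it. *)
Lemma powR_le_tangent (q a th : R) : 0 < q < 1 -> 0 <= a -> 0 < th ->
  a `^ q <= q * (a * th `^ (q - 1)) + (1 - q) * th `^ q.
Proof.
move=> /andP[q0 q1] a0 th0.
have b0 : 0 <= a / th by rewrite divr_ge0// ltW.
have h : (a / th) `^ q <= q * (a / th) + (1 - q).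
  have := @conjugate_powR R ((a / th) `^ q) 1 q^-1 (1 - q)^-1.
  rewrite powR_ge0 ler01 !invr_gt0 q0 subr_gt0 q1 !invrK addrC subrK mulr1 powR1 mul1r.
  move=> /(_ isT isT isT isT erefl).
  by rewrite -powRrM mulfV ?gt_eqF// powRr1// [_ * q]mulrC.
have tq : 0 < th `^ q by exact: powR_gt0.
have -> : th `^ (q - 1) = th `^ q / th by rewrite powRB ?powRr1 ?(ltW th0)// (gt_eqF th0) implybT.
have -> : a = a / th * th by rewrite divfK// gt_eqF.
rewrite powRM ?(ltW th0)//.
have := ler_wpM2r (ltW tq) h; move=> /le_trans; apply.
rewrite mulrDl lerD2r.
by rewrite le_eqVlt; apply/orP; left; apply/eqP; field; rewrite gt_eqF.
Qed.

Lemma powR_le_sqr (r a : R) : 2 <= r -> `|a| <= 1 -> `|a| `^ r <= a ^+ 2.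
Proof.
move=> r2 a1; have -> : a ^+ 2 = `|a| `^ 2 by rewrite powR_mulrn// real_normK// num_real.
have [->|a0] := eqVneq `|a| 0.
  by rewrite !powR0// gt_eqF//; lra.
rewrite /powR (negbTE a0) ler_expR; have := ln_le0 a1; nra.
Qed.

End tangent.

Section signs.
Variables (R : realType) (n : nat).

(* adding one column at a time, the sign that makes the cross term nonnegative *)
Lemma exists_signs m (a : 'I_m -> 'I_n -> R) : exists2 e : 'I_m -> R, (forall j, `|e j| = 1) &
  \sum_j \sum_i a j i ^+ 2 <= \sum_i (\sum_j e j * a j i) ^+ 2.
Proof.
elim: m a => [|m IH] a.
  exists (fun=> 1) => [j|]; first by rewrite normr1.
  by rewrite big_ord0; apply: sumr_ge0 => i _; exact: sqr_ge0.
have [e e1 he] := IH (fun j => a (lift ord0 j)).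
pose S i := \sum_j e j * a (lift ord0 j) i.
pose c := \sum_i a ord0 i * S i.
pose sg : R := if 0 <= c then 1 else -1.
have sc : 0 <= sg * c by rewrite /sg; case: (leP 0 c) => h; lra.
have sg2 : sg ^+ 2 = 1 by rewrite /sg; case: ifP; rewrite ?sqrrN expr1n.
exists (fun j => if unlift ord0 j is Some k then e k else sg).
  move=> j; case: (unliftP ord0 j) => [k _|_]; first exact: e1.
  by rewrite /sg; case: ifP; rewrite ?normrN1 ?normr1.
rewrite big_ord_recl.
have -> : \sum_i (\sum_j (if unlift ord0 j is Some k then e k else sg) * a j i) ^+ 2 =
   \sum_i a ord0 i ^+ 2 + (2 * (sg * c) + \sum_i S i ^+ 2).
  rewrite /c !mulr_sumr -!big_split/=; apply: eq_bigr => i _.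
  rewrite big_ord_recl unlift_none; under eq_bigr do rewrite liftK.
  by rewrite -/(S i) sqrrD exprMn sg2 mulr2n; ring.
by rewrite lerD2l (le_trans he)// lerDr mulr_ge0.
Qed.

End signs.

Section ball_position.
Variables (R : realType) (n : nat).
Hypothesis n0 : (0 < n)%N.
Let nR : 0 < n%:R :> R. Proof. by rewrite ltr0n. Qed.

(* the ratio between the maximal ellipsoid of the l_p^n ball, which is a
   Euclidean ball, and [eball] *)
Definition lp_radius (r : R) : R := if r < 2 then n%:R `^ (2^-1 - r^-1) else 1.

Lemma lp_radius_gt0 r : 0 < lp_radius r.
Proof. by rewrite /lp_radius; case: ifP => // _; exact: powR_gt0. Qed.

(** Tangent of s^(r/2) at s = n^(-2/r), the squared coordinate of the points of the l_r^n sphere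
    whose coordinates have equal modulus, where the inscribed Euclidean ball touches it. *)
Lemma powR_le_sqr_lt2 r a : 1 <= r < 2 ->
  `|a| `^ r <= (r / 2) * ((lp_radius r)^-2 * a ^+ 2) + (1 - r / 2) / n%:R.
Proof.
move=> /andP[r1 r2]; have r0 : 0 < r by lra.
have -> : `|a| `^ r = (a ^+ 2) `^ (r / 2).
  by rewrite -real_normK ?num_real// -powR_mulrn// -powRrM mulrC divfK.
pose th : R := n%:R `^ (- (2 / r)).
have th0 : 0 < th by exact: powR_gt0.
have q01 : 0 < r / 2 < 1 by rewrite divr_gt0//=; lra.
apply: (le_trans (powR_le_tangent q01 (sqr_ge0 a) th0)).
have -> : th `^ (r / 2) = n%:R^-1.
  rewrite /th -powRrM (_ : - (2 / r) * (r / 2) = -1) ?powR_inv1 ?ler0n//.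
  by field; rewrite gt_eqF.
have -> : th `^ (r / 2 - 1) = (lp_radius r)^-2.
  rewrite /lp_radius r2 -powR_mulrn ?powR_ge0// -powRrM -powRN.
  by rewrite /th -powRrM; congr (_ `^ _); field; rewrite gt_eqF.
by rewrite [a ^+ 2 * _]mulrC.
Qed.

Lemma lp_radius_eball r (u : 'rV[R]_n) : 1 <= r -> eball u -> lp_ball r (lp_radius r *: u).
Proof.
move=> r1 eu; rewrite /lp_ball/= /lp_pow.
have [r2|r2] := ltP r 2; last first.
  have -> : lp_radius r = 1 by rewrite /lp_radius ltNge r2.
  rewrite scale1r (le_trans _ eu)//; apply: ler_sum => i _; apply: powR_le_sqr => //.
  rewrite -(@expr_le1 _ 2)// real_normK ?num_real// (le_trans _ eu)// (bigD1 i)//= lerDl.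
  by apply: sumr_ge0 => j _; exact: sqr_ge0.
have r12 : 1 <= r < 2 by rewrite r1.
apply: (le_trans (ler_sum _ (fun i _ => powR_le_sqr_lt2 _ r12))).
rewrite big_split/= sumr_const card_ord -[_ *+ n]mulr_natr divfK ?gt_eqF//.
rewrite -!mulr_sumr; under eq_bigr do rewrite mxE exprMn.
rewrite -mulr_sumr mulKf ?expf_neq0 ?gt_eqF ?lp_radius_gt0//.
have : r / 2 * \sum_i u 0 i ^+ 2 <= r / 2 by rewrite ler_piMr// divr_ge0//; lra.
lra.
Qed.

(** Hölder's inequality against the vector of ones, by tangents of s^(1/r) at s = 1/n, the value of
    |y_i|^r in the case of equality. *)
Lemma sum_norm_le r (y : 'rV[R]_n) : 1 <= r -> lp_ball r y ->
  \sum_i `|y 0 i| <= n%:R `^ (1 - r^-1).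
Proof.
rewrite le_eqVlt => /predU1P[<- yr|r1 yr].
  rewrite invr1 subrr powRr0 (le_trans _ yr)//; apply: ler_sum => i _.
  by rewrite powRr1.
have r0 : 0 < r by lra.
pose th : R := n%:R^-1; have th0 : 0 < th by rewrite invr_gt0.
have q01 : 0 < r^-1 < 1 by rewrite invr_gt0 r0 invf_lt1.
have h i : `|y 0 i| <= r^-1 * (`|y 0 i| `^ r * th `^ (r^-1 - 1)) + (1 - r^-1) * th `^ r^-1.
  apply: le_trans (powR_le_tangent q01 (powR_ge0 _ _) th0).
  by rewrite -powRrM mulfV ?gt_eqF// powRr1.
apply: (le_trans (ler_sum _ (fun i _ => h i))).
rewrite big_split/= sumr_const card_ord -mulr_sumr -mulr_suml -[_ *+ n]mulr_natr.
have e1 : th `^ (r^-1 - 1) = n%:R `^ (1 - r^-1).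
  by rewrite /th -powR_inv1// -powRrM; congr (_ `^ _); ring.
have e2 : th `^ r^-1 * n%:R = n%:R `^ (1 - r^-1).
  rewrite /th -{1}powR_inv1// -powRrM mulN1r -{2}[n%:R]powRr1// -powRD 1?addrC//.
  by rewrite (gt_eqF nR) implybT.
rewrite e1 -[_ * th `^ _ * _]mulrA e2.
have p0 : 0 <= n%:R `^ (1 - r^-1) :> R := powR_ge0 _ _.
have : r^-1 * (\sum_i `|y 0 i| `^ r * n%:R `^ (1 - r^-1)) <= r^-1 * n%:R `^ (1 - r^-1).
  rewrite ler_wpM2l ?invr_ge0 ?(ltW r0)// -mulr_suml ler_piMl//.
rewrite -mulr_suml; lra.
Qed.

(** The support function in direction b of the image of the Euclidean ball under A is the length of
    A b^T, attained at the normalized A b^T. If this vector is 0, the convention 0^-1 = 0 yields u =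
    0. *)
Let dot_unit (A : 'M[R]_n) (b : 'rV[R]_n) : exists2 u : 'rV[R]_n, eball u &
  Num.sqrt (\sum_i (\sum_j b 0 j * A i j) ^+ 2) = \sum_j b 0 j * (u *m A) 0 j.
Proof.
pose s i := \sum_j b 0 j * A i j.
pose l := Num.sqrt (\sum_i s i ^+ 2).
have l2 : l ^+ 2 = \sum_i s i ^+ 2 by rewrite sqr_sqrtr// sumr_ge0// => i _; exact: sqr_ge0.
exists (l^-1 *: \row_i s i).
  rewrite /eball/=; under eq_bigr do rewrite !mxE exprMn.
  rewrite -mulr_sumr -l2 -exprMn; have [->|l0] := eqVneq l 0; first by rewrite mulr0 expr0n.
  by rewrite mulVf// expr1n.
transitivity (l^-1 * \sum_i s i ^+ 2).
  rewrite -/l -l2; have [->|l0] := eqVneq l 0; first by rewrite expr0n mulr0.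
  by rewrite expr2 mulKf.
rewrite mulr_sumr; under [RHS]eq_bigr do rewrite mxE mulr_sumr.
rewrite exchange_big; apply: eq_bigr => i _ /=.
rewrite expr2 {2}/s !mulr_sumr; apply: eq_bigr => j _.
by rewrite !mxE; ring.
Qed.

Let eballN u : eball u -> eball (- u : 'rV[R]_n).
Proof. by rewrite /eball/=; under [X in _ -> X <= _]eq_bigr do rewrite mxE sqrrN. Qed.

Let det_le (A : 'M[R]_n) (h : R) : 0 <= h -> \sum_i \sum_j A i j ^+ 2 <= h ^+ 2 * n%:R -> `|\det A| <= h ^+ n.
Proof.
move=> h0 hA; rewrite -(@ler_pXn2r _ 2) ?nnegrE ?exprn_ge0// real_normK ?num_real//.
rewrite (le_trans (det_gram_le A))// -exprM mulnC exprM lerXn2r ?nnegrE ?sqr_ge0//.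
  by rewrite divr_ge0// sumr_ge0// => i _; rewrite sumr_ge0// => j _; exact: sqr_ge0.
by rewrite ler_pdivrMr.
Qed.

(** The extent of the ellipsoid in the j-th coordinate is the length of the j-th column of A, so all
    columns have length at most 1. Using u and -u together eliminates the centre. *)
Lemma cube_ellipsoid_det (A : 'M[R]_n) (c : 'rV[R]_n) :
  (forall u, eball u -> @cube R n 1 (c + u *m A)) -> `|\det A| <= 1.
Proof.
move=> hA; rewrite -(expr1n _ n); apply: det_le => //.
rewrite exchange_big expr1n mul1r /=.
rewrite (_ : n%:R = \sum_(j < n) 1); last by rewrite sumr_const card_ord.
apply: ler_sum => j _.
have [u eu hu] := dot_unit A (delta_mx 0 j).
have sel (F : 'I_n -> R) : \sum_k (delta_mx 0 j : 'rV[R]_n) 0 k * F k = F j.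
  rewrite (bigD1 j)//= mxE !eqxx mul1r big1 ?addr0// => k kj.
  by rewrite mxE (negbTE kj) andbF mul0r.
have h1 := hA u eu j; have h2 := hA _ (eballN eu) j.
rewrite sel in hu; move: hu.
have -> : \sum_i (\sum_k (delta_mx 0 j : 'rV[R]_n) 0 k * A i k) ^+ 2 = \sum_i A i j ^+ 2.
  by apply: eq_bigr => i _; rewrite (sel (A i)).
move=> hu; have s1 : Num.sqrt (\sum_i A i j ^+ 2) <= 1.
  rewrite hu; move: h1 h2; rewrite mulNmx !mxE -/((u *m A) 0 j) !ler_norml.
  by move=> /andP[? ?] /andP[? ?]; lra.
rewrite -[leLHS]sqr_sqrtr ?expr_le1//.
by rewrite sumr_ge0// => i _; exact: sqr_ge0.
Qed.

(** For r >= 2 the ball lies in the cube. For r < 2, signs e are chosen so that the Hilbert-Schmidt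
    norm of A is at most the length of A e^T. This is the support function of the centred ellipsoid
    in direction e, bounded by the l_1 norm on the ball, hence by n^(1 - 1/r); the centre again
    disappears by averaging over u and -u. *)
Lemma lp_ellipsoid_det r (A : 'M[R]_n) (c : 'rV[R]_n) : 1 <= r ->
  (forall u, eball u -> lp_ball r (c + u *m A)) -> `|\det A| <= lp_radius r ^+ n.
Proof.
move=> r1 hA; rewrite /lp_radius; have [r2|r2] := ltP r 2; last first.
  by rewrite expr1n; apply: (cube_ellipsoid_det (c := c)) => u /hA/(lp_ball_cube r1).
have r0 : 0 < r by lra.
apply: det_le; first exact: powR_ge0.
have [e e1 he] := exists_signs (fun j i => A i j).
rewrite exchange_big (le_trans he)//.
have [u eu hu] := dot_unit A (\row_j e j).
have hs : Num.sqrt (\sum_i (\sum_j e j * A i j) ^+ 2) <= n%:R `^ (1 - r^-1).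
  have -> : \sum_i (\sum_j e j * A i j) ^+ 2 = \sum_i (\sum_j (\row_j e j : 'rV[R]_n) 0 j * A i j) ^+ 2.
    by apply: eq_bigr => i _; congr (_ ^+ 2); apply: eq_bigr => j _; rewrite mxE.
  rewrite hu.
  have h1 := sum_norm_le r1 (hA _ eu); have h2 := sum_norm_le r1 (hA _ (eballN eu)).
  suff : 2 * \sum_j (\row_j e j : 'rV[R]_n) 0 j * (u *m A) 0 j <=
     \sum_i `|(c + u *m A) 0 i| + \sum_i `|(c + - u *m A) 0 i| by lra.
  rewrite -big_split mulr_sumr; apply: ler_sum => j _ /=.
  rewrite mulNmx ![(c + _) 0 j]mxE [(- (u *m A)) 0 j]mxE [(\row_j e j) 0 j]mxE.
  move: (u *m A) (e1 j) => y ej.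
  have hy : e j * y 0 j <= `|y 0 j| by rewrite (le_trans (ler_norm _))// normrM ej mul1r.
  have := ler_norm (c 0 j + y 0 j); have := ler_norm (- (c 0 j + y 0 j)).
  have := ler_norm (c 0 j - y 0 j); have := ler_norm (- (c 0 j - y 0 j)).
  rewrite !normrN; case: (lerP 0 (y 0 j)) => hy0; move: hy.
    by rewrite (ger0_norm hy0); lra.
  by rewrite (ltr0_norm hy0); lra.
have s0 : 0 <= \sum_i (\sum_j e j * A i j) ^+ 2 by rewrite sumr_ge0// => i _; exact: sqr_ge0.
rewrite -[leLHS](sqr_sqrtr s0).
have -> : (n%:R `^ (2^-1 - r^-1)) ^+ 2 * n%:R = (n%:R `^ (1 - r^-1)) ^+ 2 :> R.
  rewrite -!powR_mulrn ?powR_ge0// -!powRrM -{2}[n%:R]powRr1// -powRD ?(gt_eqF nR) ?implybT//.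
  by congr (_ `^ _); field; rewrite gt_eqF.
by rewrite lerXn2r ?nnegrE ?sqrtr_ge0 ?powR_ge0.
Qed.

End ball_position.

(** * Volume ratios *)

Lemma vr_body_volume0 (R : realType) n (C : set 'rV[R]_n) : (0 < n)%N ->
  fine (volume C) = 0 -> vr_body C = 0.
Proof.
by move=> n0; rewrite /vr_body => ->; rewrite mul0r powR0// invr_eq0 pnatr_eq0 -lt0n.
Qed.

Section ratio.
Variables (R : realType) (n : nat) (K : set 'rV[R]_n) (c : R).
Hypothesis n0 : (0 < n)%N.
Hypothesis mK : vset K.
Hypothesis K0 : (0 < volume K)%E.
Hypothesis Kfin : volume K \is a fin_num.
Hypothesis c0 : 0 < c.

(** The volume ratio of K if c times the Euclidean ball is its maximal ellipsoid. K is the l_p^n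
    ball for finite p and the cube for p = oo. *)
Definition ratio_bound : R :=
  (fine (volume K) / (c ^+ n * fine (volume (@eball R n)))) `^ n%:R^-1.

Let B0 : 0 < fine (volume (@eball R n)).
Proof. by rewrite fine_gt0// volume_eball_gt0 ltey_eq volume_eball_fin. Qed.

Let nV0 : n%:R^-1 != 0 :> R. Proof. by rewrite invr_eq0 pnatr_eq0 -lt0n. Qed.

Let ellP (A : 'M[R]_n) (x : 'rV[R]_n) : A \in unitmx ->
  let E := [set x + u *m A | u in @eball R n] in
  ellipsoid E /\ volume E = (`|\det A| * fine (volume (@eball R n)))%:E.
Proof.
move=> Au E; split; first by exists A, x.
have [_ ->] := volume_image x Au (@vset_eball R n).
by rewrite EFinM fineK// volume_eball_fin.
Qed.

Let ellipsoidE E : ellipsoid E -> exists (A : 'M[R]_n) (x : 'rV[R]_n),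
  A \in unitmx /\ E = [set x + u *m A | u in @eball R n].
Proof. by move=> [A [x [Au EE]]]; exists A, x; exact: (conj Au EE). Qed.

Let scaled (A : 'M[R]_n) : A \in unitmx -> c *: A \in unitmx.
Proof. by rewrite !unitmxE detZ !unitfE mulf_eq0 expf_eq0 (gt_eqF c0) andbF. Qed.

(** The maximal ellipsoid of C is at least as large as the image of c times the Euclidean ball under
    A, and |det A| cancels against the volume bound. *)
Lemma vr_body_le (C : set 'rV[R]_n) (A : 'M[R]_n) : A \in unitmx ->
  (forall u, eball u -> C ((c *: u) *m A)) ->
  (volume C <= `|\det A|%:E * volume K)%E -> vr_body C <= ratio_bound.
Proof.
move=> Au cA hC; rewrite /vr_body.
set E := xget _ _; have [[E1 hE1]|noE] := pselect (exists E1, max_volume_ellipsoid C E1); last first.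
  (* Without a maximal ellipsoid, the default has volume 0 and the quotient is 0 by convention. *)
  have -> : E = set0 by apply: xgetPN => E1 hE1; apply: noE; exists E1.
  by rewrite /volume /= measure0 invr0 mulr0 powR0// powR_ge0.
have [EE EC maxE] : max_volume_ellipsoid C E by exact: (xgetPex set0 (ex_intro _ _ hE1)).
have dA : 0 < `|\det A| by rewrite normr_gt0 -unitfE -unitmxE.
have [eE' vE'] := ellP 0 (scaled Au).
have := maxE _ eE'; rewrite vE' => h.
have {}h : (`|\det (c *: A)| * fine (volume (@eball R n)) <= fine (volume E)).
  have [A1 [x1 [A1u EA1]]] := ellipsoidE EE.
  have [_ v1] := ellP x1 A1u.
  move: h; rewrite EA1 v1 lee_fin; apply => _ [u eu <-].
  by rewrite add0r -scalemxAr scalemxAl; exact: cA.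
rewrite detZ normrM normrX (gtr0_norm c0) in h.
have V0 : 0 < c ^+ n * `|\det A| * fine (volume (@eball R n)).
  by rewrite !mulr_gt0// exprn_gt0.
have Cfin : volume C \is a fin_num.
  rewrite ge0_fin_numE ?measure_ge0// (le_lt_trans hC)//.
  by rewrite -(fineK Kfin) -EFinM ltry.
have hC' : fine (volume C) <= `|\det A| * fine (volume K).
  by rewrite -lee_fin EFinM !fineK.
have K0' : 0 < fine (volume K) by rewrite fine_gt0// K0 ltey_eq Kfin.
apply: ge0_ler_powR; rewrite ?nnegrE ?invr_ge0 ?divr_ge0 ?fine_ge0 ?measure_ge0//.
  by rewrite mulr_ge0 ?exprn_ge0 ?(ltW c0) ?(ltW B0).
apply: (@le_trans _ _ ((`|\det A| * fine (volume K)) / (c ^+ n * `|\det A| * fine (volume (@eball R n))))).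
  rewrite ler_pM ?fine_ge0 ?measure_ge0// ?invr_ge0 ?fine_ge0 ?measure_ge0//.
  by rewrite lef_pV2// posrE (lt_le_trans V0).
rewrite le_eqVlt; apply/orP; left; apply/eqP; field.
by rewrite !gt_eqF// ?exprn_gt0.
Qed.

(** An ellipsoid in C is pulled back by M to one in K, so the image of c times the Euclidean ball is
    maximal in C. The one picked by [xget] has the same volume. *)
Lemma vr_body_ge (C : set 'rV[R]_n) (M : 'M[R]_n) : M \in unitmx ->
  (forall u, eball u -> K (c *: u)) ->
  (forall (A : 'M[R]_n) (x : 'rV[R]_n), (forall u, eball u -> K (x + u *m A)) -> `|\det A| <= c ^+ n) ->
  C = [set u *m M | u in K] -> ratio_bound <= vr_body C.
Proof.
move=> Mu cK dK CE.
have dM : 0 < `|\det M| by rewrite normr_gt0 -unitfE -unitmxE.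
have vC : volume C = (`|\det M| * fine (volume K))%:E.
  have [_] := volume_image 0 Mu mK; rewrite EFinM fineK// => <-; congr volume.
  by rewrite CE; apply/seteqP; split => _ [u Ku <-]; exists u => //; rewrite add0r.
have [eE vE] := ellP 0 (scaled Mu).
set E := [set _ | _ in _] in eE vE.
have maxE : max_volume_ellipsoid C E.
  split => //.
    by move=> _ [u eu <-]; rewrite CE add0r; exists (c *: u); [exact: cK|rewrite -scalemxAr scalemxAl].
  move=> E' /ellipsoidE[A [x [Au ->]]] sub; rewrite vE; have [_ ->] := ellP x Au.
  rewrite lee_fin ler_wpM2r ?(ltW B0)// detZ normrM normrX (gtr0_norm c0) -ler_pdivrMr//.
  have := dK (A *m invmx M) (x *m invmx M).
  rewrite det_mulmx normrM det_inv normfV; apply => u eu.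
  rewrite mulmxA -mulmxDl.
  have : C (x + u *m A) by apply: sub; exists u.
  by rewrite CE => -[v Kv <-]; rewrite mulmxK.
have := @xgetPex _ set0 (max_volume_ellipsoid C) (ex_intro _ _ maxE).
rewrite /vr_body; set F := xget _ _ => -[eF FC maxF].
have FE : (volume F <= volume E)%E by have [_ _ h] := maxE; exact: h.
have EF : (volume E <= volume F)%E by have [eE1 EC _] := maxE; exact: maxF.
have -> : volume F = volume E by apply/eqP; rewrite eq_le FE.
rewrite vC vE /= detZ normrM normrX (gtr0_norm c0) /ratio_bound le_eqVlt; apply/orP; left; apply/eqP; congr powR.
by field; rewrite !gt_eqF// ?exprn_gt0.
Qed.

End ratio.

Section linear_image.
Variables (R : realType) (n : nat).

Lemma lin1_mx_unit (f : {linear 'rV[R]_n -> 'rV[R]_n}) : injective f -> lin1_mx f \in unitmx.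
Proof.
move=> fi; rewrite -row_free_unit -kermx_eq0; apply/eqP/row_matrixP => i.
rewrite row0; apply: fi; rewrite raddf0 -mul_rV_lin1.
by apply: sub_kermxP; exact: row_sub.
Qed.

(** The representation picked by [xget] comes from some automorphism f of R^n, so the ball is the
    image of K under the inverse of the matrix of f. *)
Lemma vr_lp_ge (N : 'rV[R]_n -> R) (K : set 'rV[R]_n) (c : R) : (0 < n)%N -> vset K ->
  (0 < volume K)%E -> volume K \is a fin_num -> 0 < c ->
  (forall u, eball u -> K (c *: u)) ->
  (forall (A : 'M[R]_n) (x : 'rV[R]_n), (forall u, eball u -> K (x + u *m A)) -> `|\det A| <= c ^+ n) ->
  K = [set v | N v <= 1] -> ratio_bound K c <= vr N [set: 'rV[R]_n] n.
Proof.
move=> n0 mK K0 Kfin c0 cK dK KE; rewrite /vr.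
have rep : represents_unit_ball N [set: 'rV[R]_n] K.
  exists idfun; split => //; first by apply/seteqP; split => // x _; exists x.
have := @xgetPex _ set0 _ (ex_intro _ _ rep).
move=> [f [fi _ ->]].
have fu := lin1_mx_unit fi.
have Mu : invmx (lin1_mx f) \in unitmx by rewrite unitmx_inv.
apply: vr_body_ge Mu cK dK _ => //.
rewrite KE; apply/seteqP; split => [v /= h|_ [u /= h <-]].
  by exists (f v) => //; rewrite -mul_rV_lin1 mulmxK.
by rewrite /= -mul_rV_lin1 mulmxKV.
Qed.

Lemma lp_norm_ballE (r : R) : 0 < r -> @lp_ball R n r = [set v | lp_norm r%:E v <= 1].
Proof.
have p1 (q : R) : 1 `^ q = 1 by rewrite powR1.
move=> r0; apply/seteqP; split => v; rewrite /lp_ball /= /lp_norm /lp_pow => h.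
  rewrite -[leRHS](p1 r^-1); apply: ge0_ler_powR; rewrite ?nnegrE ?invr_ge0 ?(ltW r0)//.
  by rewrite sumr_ge0// => i _; exact: powR_ge0.
have S0 : 0 <= \sum_i `|v ord0 i| `^ r by rewrite sumr_ge0// => i _; exact: powR_ge0.
rewrite -[leLHS](powRr1 S0) -[X in _ `^ X](mulVf (lt0r_neq0 r0)) powRrM -[leRHS](p1 r).
by apply: ge0_ler_powR; rewrite ?nnegrE ?powR_ge0 ?(ltW r0).
Qed.

Lemma cube_ballE : @cube R n 1 = [set v | lp_norm +oo%E v <= 1].
Proof.
apply/seteqP; split => v /= h; first by apply: bigmax_le => // i _; exact: h.
by move=> i; rewrite (le_trans _ h)//; apply: (le_bigmax _ (fun i => `|v ord0 i|) i).
Qed.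

End linear_image.

(** * Unit balls of subspaces of L_p *)

Section lewis_ball.
Context d (T : measurableType d) (R : realType).
Variable mu : {sigma_finite_measure set T -> \bar R}.
Variable r : R.
Hypothesis r1 : 1 <= r.
Let r0 : 0 < r. Proof. exact: lt_le_trans r1. Qed.
Variable n : nat.
Hypothesis n0 : (0 < n)%N.

Section Psi_gauge.
Variable rho : T -> R.
Hypothesis rho_ge0 : forall s, 0 <= rho s.
Hypothesis rho_int : mu.-integrable setT (EFin \o rho).
Variables (u : 'I_n -> T -> R).
Hypothesis mu_ : forall i, measurable_fun setT (u i).
Hypothesis u1 : forall s, \sum_i u i s ^+ 2 = 1.
Hypothesis iso : forall i j, wint mu rho (fun s => u i s * u j s) = (i == j)%:R.
Local Notation Psi := (Psi mu rho u r).

Let bm_pow x : bounded_measurable (fun s => `|ip u x s| `^ r).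
Proof. exact: (cts_ip_bm mu_ u1 x (cts_abs_powR r1)). Qed.

Lemma gauge_Psi : gauge r Psi.
Proof.
split; first exact: (vmeas_Psi rho_int mu_ r1).
  by move=> x; apply: Rintegral_ge0 => s _; rewrite mulr_ge0// powR_ge0.
move=> a x a0; rewrite /Psi -wintZ//; congr wint; apply/funext => s.
by rewrite ipZ normrM powRM// gtr0_norm.
Qed.

(** The pointwise inequalities used for the l_r^n ball, integrated against the weight: isotropy and
    the mass n take the place of the sum over the n coordinates. *)
Lemma Psi_le1 v : eball v -> Psi (lp_radius n r *: v) <= 1.
Proof.
move=> ev; have ip2 x : bounded_measurable (fun s => ip u x s ^+ 2).
  by apply: bmX; exact: bm_ip.
have [r2|r2] := ltP r 2; last first.
  have -> : lp_radius n r = 1 by rewrite /lp_radius ltNge r2.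
  rewrite scale1r; apply: (@le_trans _ _ (wint mu rho (fun s => ip u v s ^+ 2))).
    apply: le_wint => // s; apply: powR_le_sqr => //.
    rewrite -(@expr_le1 _ 2)// real_normK ?num_real//.
    exact: (le_trans (ip_sqr_le u1 v s)).
  by rewrite (wint_ip_sqr rho_ge0 rho_int mu_ u1 iso).
have r12 : 1 <= r < 2 by rewrite r1.
set c := lp_radius n r; have c0 : 0 < c := lp_radius_gt0 n0 r.
have bC k : bounded_measurable (fun=> k : R) := bmC T k.
have bZ k : bounded_measurable (fun s => k * (c^-2 * ip u (c *: v) s ^+ 2)).
  by do 2 apply: bmZ.
apply: (@le_trans _ _ (wint mu rho (fun s => (r / 2) * (c^-2 * ip u (c *: v) s ^+ 2) + (1 - r / 2) / n%:R))).
  apply: le_wint => //; first exact: bmD.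
  by move=> s; exact: powR_le_sqr_lt2.
rewrite wintD// wintZ//; last by apply: bmZ.
rewrite wintZ// (wint_ip_sqr rho_ge0 rho_int mu_ u1 iso) wint_cst// (wint1 rho_ge0 rho_int mu_ u1 iso).
under eq_bigr do rewrite mxE exprMn.
rewrite -mulr_sumr mulKf ?expf_neq0 ?gt_eqF// divfK ?pnatr_eq0 -?lt0n//.
have : r / 2 * \sum_i v 0 i ^+ 2 <= r / 2 by rewrite ler_piMr// divr_ge0// ltW.
lra.
Qed.

End Psi_gauge.

Variable w : 'I_n -> T -> R.
Hypothesis wL : forall i, w i \in Lfun mu r%:E.
Hypothesis indep : forall x : 'rV[R]_n, {ae mu, forall s, ip w x s = 0} -> x = 0.

Definition pint_ball := [set y : 'rV[R]_n | pint mu r (ip w y) <= 1].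

(** The ball is the image under A of the set Psi <= 1, so [Psi_le1] and the Brascamp-Lieb inequality
    give both estimates with the same matrix. *)
Lemma lewis_ball : exists A : 'M[R]_n, [/\ A \in unitmx, vset pint_ball,
  forall v, eball v -> pint_ball ((lp_radius n r *: v) *m A) &
  (volume pint_ball <= `|\det A|%:E * volume (@lp_ball R n r))%E].
Proof.
have [A [rho [u [Au rho0 rho_int [mu_ u1 iso AE]]]]] := lewis r1 n0 wL indep.
have PE x : pint mu r (ip w (x *m A)) = Psi mu rho u r x.
  by apply: eq_Rintegral => s _; exact: AE.
have gP := gauge_Psi rho0 rho_int mu_ u1.
have CE : pint_ball = [set 0 + x *m A | x in [set x | Psi mu rho u r x <= 1]].
  apply/seteqP; split => [y /= h|_ [x /= h <-]]; last by rewrite add0r /pint_ball/= PE.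
  exists (y *m invmx A); rewrite ?add0r ?mulmxKV//= -PE mulmxKV//.
have [m1 v1] := volume_image 0 Au (vset_ball 1 gP).
exists A; split => //.
- by rewrite CE.
- by move=> v ev; rewrite /pint_ball/= PE; exact: Psi_le1.
- rewrite CE v1 lee_wpmul2l// ?lee_fin//.
  apply: volume_le_lp_ball => //.
  exact: (brascamp_lieb rho0 rho_int mu_ u1 iso r1).
Qed.

End lewis_ball.

(** * The case p = oo: power means for a probability measure *)

Section power_means.
Context d (T : measurableType d) (R : realType).
Variable mu : {measure set T -> \bar R}.
Hypothesis mu1 : mu setT = 1%E.
Let mufin : mu setT \is a fin_num. Proof. by rewrite mu1. Qed.

Lemma Lfun_oo_finite (f : T -> R) q : 1 <= q -> f \in Lfun mu +oo%E -> f \in Lfun mu q%:E.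
Proof.
move=> q1 fL; have q1' : (1 <= q%:E)%E by rewrite lee_fin.
exact: (@Lfun_subset _ _ _ mu q%:E +oo%E q1' (leey _) mufin (leey _) f fL).
Qed.

Let cst_int (c : R) : mu.-integrable setT (EFin \o cst c).
Proof.
apply/integrableP; split; first exact/measurable_EFinP.
by rewrite /= (@integral_cst _ _ _ mu _ measurableT (`|c|%R%:E)) mu1 mule1 ltry.
Qed.

Let int_cst (c : R) : \int[mu]_s c = c.
Proof. by rewrite /Rintegral integral_cst// mu1 mule1. Qed.

(** Integration of the tangent inequality |f|^p <= (p/q) |f|^q + 1 - p/q over a space of measure
    1. *)
Lemma pint_le1_mono (f : T -> R) (p q : R) : 1 <= p -> p <= q -> f \in Lfun mu p%:E ->
  f \in Lfun mu q%:E -> pint mu q f <= 1 -> pint mu p f <= 1.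
Proof.
move=> p1 pq fp fq; have q0 : 0 < q by lra.
have q1 : 1 <= q by lra.
move: pq; rewrite le_eqVlt => /predU1P[->//|pq] f1.
have t01 : 0 < p / q < 1 by rewrite divr_gt0 ?ltr_pdivrMr// ?mul1r//; lra.
have fqi := Lfun_pow_integrable q1 fq.
have Zi : mu.-integrable setT (EFin \o (fun s => p / q * `|f s| `^ q)).
  have := @integrableZl _ _ _ mu _ measurableT (p / q) _ fqi.
  by apply: eq_integrable => // s _.
apply: (@le_trans _ _ (\int[mu]_s (p / q * `|f s| `^ q + (1 - p / q)))).
  apply: le_Rintegral => //; first exact: Lfun_pow_integrable.
    have := integrableD measurableT Zi (cst_int (1 - p / q)).
    by apply: eq_integrable => // s _.
  move=> s _; have := powR_le_tangent t01 (powR_ge0 `|f s| q) ltr01.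
  by rewrite !powR1 !mulr1 -powRrM mulrC divfK ?gt_eqF.
rewrite RintegralD// ?int_cst; last exact: cst_int.
rewrite RintegralZl// -/(pint mu q f).
move: t01 => /andP[t0 t1]; have := ler_wpM2l (ltW t0) f1; lra.
Qed.

(** If |f| >= t > 1 on a set of measure F, then t^k F <= 1 for all k, and F = 0 because t^k grows at
    least linearly by Bernoulli's inequality. *)
Lemma pint_le1P (f : T -> R) : f \in Lfun mu +oo%E ->
  {ae mu, forall s, `|f s| <= 1} <-> forall k : nat, pint mu k.+2%:R f <= 1.
Proof.
move=> fL; have fk k : f \in Lfun mu (k.+2%:R)%:E.
  by apply: Lfun_oo_finite fL; rewrite ler1n.
have fi k : mu.-integrable setT (EFin \o (fun s => `|f s| `^ k.+2%:R)).
  by apply: Lfun_pow_integrable; rewrite ?ler1n.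
have mfi k : measurable_fun setT (EFin \o (fun s => `|f s| `^ k.+2%:R)).
  by have /integrableP[] := fi k.
have mf := Lfun_measurable (fk 0%N).
split=> [f1 k|h].
  rewrite -[leRHS]int_cst /pint /Rintegral fine_le//.
  - by apply: integrable_fin_num => //; exact: fi.
  - by apply: integrable_fin_num => //; exact: cst_int.
  apply: ae_ge0_le_integral => //.
  - exact: (mfi k).
  apply: filterS f1 => s f1 _; rewrite lee_fin.
  have e1 : 1 = 1 `^ k.+2%:R :> R by rewrite powR1.
  by rewrite {2}e1 ge0_ler_powR ?nnegrE ?ler0n.
pose D m := [set s | 1 + m.+1%:R^-1 <= `|f s|].
have mD m : measurable (D m).
  have ma : measurable_fun setT (fun s => `|f s|) by exact: measurableT_comp.
  have := ma.
  move=> /(_ measurableT _ (measurable_itv `[1 + m.+1%:R^-1, +oo[)); rewrite setTI.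
  by congr measurable; apply/seteqP; split => s /=; rewrite in_itv/= andbT.
have D0 m : mu (D m) = 0%E.
  pose t : R := 1 + m.+1%:R^-1.
  have t1 : 1 < t by rewrite ltrDl invr_gt0 ltr0n.
  have Dfin : mu (D m) \is a fin_num.
    rewrite ge0_fin_numE ?measure_ge0// (@le_lt_trans _ _ (mu setT))//.
      by apply: le_measure; rewrite ?inE.
    by rewrite mu1 ltry.
  have bound k : t ^+ k * fine (mu (D m)) <= 1.
    apply: (@le_trans _ _ (t `^ k.+2%:R * fine (mu (D m)))).
      rewrite ler_wpM2r ?fine_ge0 ?measure_ge0// powR_mulrn; last by lra.
      by rewrite ler_weXn2l ?(ltW t1)// -addn2 leq_addr.
    rewrite -lee_fin EFinM fineK//.
    apply: (@le_trans _ _ (\int[mu]_s (`|f s| `^ k.+2%:R)%:E)%E); last first.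
      have := h k; rewrite -lee_fin /pint /Rintegral fineK//.
      by apply: integrable_fin_num => //; exact: fi.
    have -> : ((t `^ k.+2%:R)%:E * mu (D m) = \int[mu]_(s in D m) (t `^ k.+2%:R)%:E)%E.
      by rewrite integral_cst.
    apply: (@le_trans _ _ (\int[mu]_(s in D m) (`|f s| `^ k.+2%:R)%:E)%E).
      apply: ge0_le_integral => //.
      - by move=> s _; rewrite lee_fin powR_ge0.
      - exact: (measurable_funTS (mfi k)).
      - move=> s Ds; rewrite lee_fin ge0_ler_powR ?nnegrE ?ler0n//.
        by rewrite ltW// (lt_trans _ t1).
    apply: ge0_subset_integral => //; exact: (mfi k).
  suff : fine (mu (D m)) <= 0.
    rewrite -lee_fin fineK// => h0; apply/eqP; rewrite eq_le h0.
    exact: measure_ge0.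
  rewrite leNgt; apply/negP => F0.
  have t0 : 0 < t - 1 by lra.
  have bern k : 1 + k%:R * (t - 1) <= t ^+ k.
    elim: k => [|k IH]; first by rewrite mul0r addr0 expr0.
    rewrite exprS -natr1; apply: (@le_trans _ _ (t * (1 + k%:R * (t - 1)))); last first.
      by rewrite ler_wpM2l//; lra.
    by have := mulr_ge0 (ler0n R k) (sqr_ge0 (t - 1)); lra.
  have F' : 0 <= (fine (mu (D m)))^-1 / (t - 1) by rewrite divr_ge0 ?invr_ge0 ?(ltW F0)// ltW.
  have := archi_boundP F'; set k := Num.bound _; rewrite ltr_pdivrMr// => hk.
  have := bound k; have := bern k; set F := fine _ in F0 hk *.
  have FF : F^-1 * F = 1 by rewrite mulVf// gt_eqF.
  move=> h1 h2; have h3 : (1 + k%:R * (t - 1)) * F <= t ^+ k * F by rewrite ler_wpM2r// ltW.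
  have h4 : F^-1 * F < k%:R * (t - 1) * F by rewrite ltr_pM2r.
  lra.
have : mu.-negligible (\bigcup_m D m).
  apply: negligible_bigcup => m; apply/negligibleP => //; exact: D0.
apply: negligibleS => s /= /negP; rewrite -ltNge => fs.
have [k hk] := ltr_add_invr fs.
by exists k => //; rewrite /D/= ltW.
Qed.

End power_means.

Section sup_ball.
Context d (T : measurableType d) (R : realType).
Variable mu : {sigma_finite_measure set T -> \bar R}.
Hypothesis mu1 : mu setT = 1%E.
Variable n : nat.
Hypothesis n0 : (0 < n)%N.
Variable w : 'I_n -> T -> R.
Hypothesis wL : forall i, w i \in Lfun mu +oo%E.
Hypothesis indep : forall x : 'rV[R]_n, {ae mu, forall s, ip w x s = 0} -> x = 0.

Definition sup_ball := [set y : 'rV[R]_n | {ae mu, forall s, `|ip w y s| <= 1}].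

(** Exponents from 2 on, for which [lp_radius] has its value 1 for p = oo. *)
Let q (k : nat) : R := k.+2%:R.
Let q1 k : 1 <= q k. Proof. by rewrite ler1n. Qed.
Let q0 k : 0 < q k. Proof. exact: lt_le_trans (q1 k). Qed.
Let wk k i : w i \in Lfun mu (q k)%:E. Proof. exact: Lfun_oo_finite. Qed.
Let ipk k y : ip w y \in Lfun mu (q k)%:E. Proof. exact: Lfun_ip. Qed.

Let ip_oo y : ip w y \in Lfun mu +oo%E.
Proof.
have [h0 h] := @Lfun_submod_closed _ T R mu +oo%E (leey _).
rewrite /ip; elim: (index_enum _) => [|i s IH].
  by rewrite (_ : (fun s => _) = 0)//; apply/funext => x; rewrite big_nil.
rewrite (_ : (fun x => _) = (fun x => y 0 i * w i x + \sum_(i <- s) y 0 i * w i x)).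
  exact: h.
by apply/funext => x; rewrite big_cons.
Qed.

Let pint_nmr_le1 k f : pint mu (q k) f <= 1 -> nmr mu (q k) f <= 1.
Proof.
move=> h; have e1 : 1 = 1 `^ (q k)^-1 by rewrite powR1.
by rewrite e1 /nmr ge0_ler_powR ?nnegrE ?invr_ge0 ?pint_ge0 ?(ltW (q0 k)).
Qed.

Let nmr_pint_le1 k f : nmr mu (q k) f <= 1 -> pint mu (q k) f <= 1.
Proof.
move=> h; have e1 : 1 = 1 `^ q k by rewrite powR1.
by rewrite e1 pint_nmr// ge0_ler_powR ?nnegrE ?powR_ge0 ?(ltW (q0 k)).
Qed.

Let sup_ballE : sup_ball = \bigcap_k pint_ball mu (q k) w.
Proof.
apply/seteqP; split => y.
  by move=> /(pint_le1P mu1 (ip_oo y)) h k _; exact: h.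
by move=> h; apply/(pint_le1P mu1 (ip_oo y)) => k; exact: h.
Qed.

Let radius k : lp_radius n (q k) = 1.
Proof. by rewrite /lp_radius ltNge ler_nat. Qed.

Let N k (v : 'rV[R]_n) (a : 'rV[R]_(n * n)) := nmr mu (q k) (ip w (v *m vec_mx a)).

Let N_tri k v a b : N k v (a + b) <= N k v a + N k v b.
Proof.
have := nmrD (q1 k) (ipk k (v *m vec_mx a)) (ipk k (v *m vec_mx b)).
have -> : N k v (a + b) =
    nmr mu (q k) (fun s => ip w (v *m vec_mx a) s + ip w (v *m vec_mx b) s).
  by congr nmr; apply/funext => s; rewrite raddfD/= mulmxDr ipD.
exact.
Qed.

Let NZ k v c a : N k v (c *: a) = `|c| * N k v a.
Proof.
rewrite -[RHS](nmrZ (q1 k) c (ipk k (v *m vec_mx a))).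
by congr nmr; apply/funext => s; rewrite linearZ/= -scalemxAr ipZ.
Qed.

Lemma vset_sup_ball : vset sup_ball.
Proof.
rewrite sup_ballE /vset preimage_bigcap; apply: bigcap_measurable => [|k _].
  by exists 0%N.
by have [A [_ + _ _]] := lewis_ball (q1 k) n0 (wk k) indep.
Qed.

(* [A] is a cluster point of the matrices given by [lewis_ball] for the
   exponents [k + 2]. *)
Lemma sup_ball_position : fine (volume sup_ball) = 0 \/
  exists A : 'M[R]_n, [/\ A \in unitmx, forall v, eball v -> sup_ball (v *m A) &
    (volume sup_ball <= `|\det A|%:E * volume (@cube R n 1))%E].
Proof.
have [->|V0] := eqVneq (fine (volume sup_ball)) 0; [by left|right].
have vcube : volume (@cube R n 1) = (2 ^+ n)%:E by rewrite volume_cube// mulr1.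
have /choice[A_ hA] : forall k, exists A : 'M[R]_n,
    (forall v, eball v -> pint_ball mu (q k) w (v *m A)) /\ 
    (volume sup_ball <= `|\det A|%:E * (2 ^+ n)%:E)%E.
  move=> k; have [A [Au mC hv hvol]] := lewis_ball (q1 k) n0 (wk k) indep.
  exists A; split=> [v ev|].
    by have := hv v ev; rewrite radius scale1r.
  apply: (@le_trans _ _ (volume (pint_ball mu (q k) w))).
    apply: le_measure; rewrite ?inE//; first exact: vset_sup_ball.
    by move=> t; rewrite sup_ballE; exact.
  by rewrite (le_trans hvol)// lee_wpmul2l ?lee_fin// volume_lp_ball_cube.
have Vfin : volume sup_ball \is a fin_num.
  rewrite ge0_fin_numE ?measure_ge0//; have [_ h] := hA 0%N.
  by rewrite (le_lt_trans h)// -EFinM ltry.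
have Vpos : 0 < fine (volume sup_ball) by rewrite lt0r V0 fine_ge0// measure_ge0.
(* A lower bound for |det A_k|, since all finite-exponent balls contain [sup_ball] and the l_q^n
   balls lie in a cube of volume 2^n. *)
pose e := fine (volume sup_ball) / 2 ^+ n.
have e0 : 0 < e by rewrite divr_gt0// exprn_gt0.
(* Closed conditions on a matrix that hold for [A_ j] as soon as j >= k, because power means
   increase with the exponent; a cluster point therefore satisfies all of them. *)
pose K k := [set a : 'rV[R]_(n * n) | forall v, eball v -> N k v a <= 1] `&`
  [set a : 'rV[R]_(n * n) | e <= `|\det (vec_mx a)|].
have closedK k : closed (K k).
  apply: closedI.
    rewrite (_ : [set a | _] = \bigcap_(v in @eball R n) (N k v @^-1` [set y | y <= 1])).
      apply: closed_bigI => v _; apply: closed_comp; last exact: closed_le.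
      by move=> x _; exact: (norm_cts (N_tri k v) (NZ k v)).
    by apply/seteqP; split => a h v; exact: h.
  apply: (@closed_comp _ _ (fun a : 'rV[R]_(n * n) => `|\det (vec_mx a : 'M[R]_n)|) [set y | e <= y]).
    move=> x _; apply: (@continuous_comp _ _ _ (fun a : 'rV[R]_(n * n) => \det (vec_mx a : 'M[R]_n))).
      exact: det_cts.
    exact: norm_continuous.
  exact: closed_ge.
have ed i : eball (delta_mx 0 i : 'rV[R]_n).
  rewrite /eball/= (bigD1 i)//= !mxE !eqxx expr1n big1 ?addr0// => j ji.
  by rewrite mxE (negbTE ji) andbF expr0n.
(* A norm on matrices, bounded by n on [K 0] since basis vectors belong to the Euclidean ball; this
   makes [K 0] compact. *)
pose S (a : 'rV[R]_(n * n)) := \sum_i N 0%N (delta_mx 0 i) a.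
have cS : compact [set a | S a <= n%:R].
  apply: norm_ball_compact => [a b|c a|a].
  - by rewrite /S -big_split/=; apply: ler_sum => i _; exact: N_tri.
  - by rewrite /S mulr_sumr; apply: eq_bigr => i _; exact: NZ.
  - move=> /eqP; rewrite psumr_eq0 => [/allP h|i _]; last exact: powR_ge0.
    apply: (can_inj (@vec_mxK _ n n)); rewrite raddf0.
    apply/row_matrixP => i; rewrite row0 rowE; apply: indep.
    have /eqP := h i (mem_index_enum i).
    exact: (nmr_eq0 (q1 0%N) (ipk 0%N _)).
have cK : compact (K 0%N).
  apply: (subclosed_compact (closedK 0%N) cS) => a [h _] /=.
  rewrite (_ : n%:R = \sum_(i < n) 1); last by rewrite sumr_const card_ord.
  by apply: ler_sum => i _; exact: h.
have monoK j k : (k <= j)%N -> K k (mxvec (A_ j)).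
  move=> kj; have [h1 h2] := hA j; split => [v ev|]; rewrite /= ?/N mxvecK.
    apply: pint_nmr_le1; apply: (@pint_le1_mono _ _ _ _ mu1 _ _ (q j)) => //.
      by rewrite ler_nat.
    exact: h1.
  by rewrite /e ler_pdivrMr ?exprn_gt0// -lee_fin EFinM fineK.
have FK k : ((fun j => mxvec (A_ j)) @ \oo) (K k).
  by exists k => // j /= kj; exact: monoK.
have [a [Ka cla]] := cK _ _ (FK 0%N).
have Kall k : K k a.
  rewrite (closure_id (K k)).1; last exact: closedK.
  by move=> B nB; exact: (cla _ _ (FK k) nB).
exists (vec_mx a); have [_ /= he] := Ka; split.
- by rewrite unitmxE unitfE -normr_gt0 (lt_le_trans e0).
- move=> v ev; rewrite sup_ballE => k _; have [h _] := Kall k.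
  exact: (nmr_pint_le1 (h v ev)).
- rewrite vcube -(fineK Vfin) -EFinM lee_fin -ler_pdivrMr// exprn_gt0//.
Qed.

End sup_ball.

(** * Subspaces of L_p[0,1] in coordinates *)

Section leb01.
Variable R : realType.

(* [Lebesgue01 R], with the finite measure structure that it lacks *)
Definition leb01 : set (measurableTypeR R) -> \bar R := Measure.sort (Lebesgue01 R).

HB.instance Definition _ := Measure.on leb01.

Lemma leb01T : leb01 setT = 1%E.
Proof.
by rewrite /leb01 /Lebesgue01 /= /mrestr setTI lebesgue_measure_itv /= lte01 oppr0 addr0.
Qed.

Let leb01_fin : fin_num_fun leb01.
Proof. by apply: lty_fin_num_fun; rewrite [X in (X < _)%E]leb01T ltry. Qed.

HB.instance Definition _ := @Measure_isFinite.Build _ _ _ leb01 leb01_fin.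

End leb01.
Arguments leb01 : clear implicits.
Arguments leb01T : clear implicits.

Section Lp_coordinates.
Variables (R : realType) (p : \bar R) (p1 : (1 <= p)%E) (n : nat).
Local Notation L := (Lp01 p1).
Local Notation T := (measurableTypeR R).
Local Notation mu := (leb01 R).
Variable f : {linear 'rV[R]_n -> L}.
Hypothesis fi : injective f.

Definition coord_fun (i : 'I_n) : T -> R := f (delta_mx 0 i).

Lemma coord_fun_Lfun i : coord_fun i \in Lfun mu p.
Proof. exact: Lspace_Lfun. Qed.

Lemma Lp_ip x : {ae mu, forall s, (f x : T -> R) s = ip coord_fun x s}.
Proof.
have -> : f x = \sum_i x 0 i *: f (delta_mx 0 i).
  by rewrite {1}[x]row_sum_delta linear_sum; apply: eq_bigr => i _; rewrite linearZ.
rewrite /ip; elim: (index_enum _) => [|i s IH].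
  rewrite big_nil -(scale0r (0 : L)).
  by apply: filterS (LspaceZE 0 (0 : L)) => t ->//; rewrite mul0r big_nil.
rewrite big_cons.
have h1 := LspaceDE (x 0 i *: f (delta_mx 0 i)) (\sum_(j <- s) x 0 j *: f (delta_mx 0 j)).
have h2 := LspaceZE (x 0 i) (f (delta_mx 0 i)).
near=> t.
rewrite (near h1 t)// (near h2 t)// (near IH t)// big_cons.
by [].
Unshelve. all: by end_near. Qed.

Lemma Lp_indep x : {ae mu, forall s, ip coord_fun x s = 0} -> x = 0.
Proof.
move=> h; apply: fi; rewrite raddf0; apply: Lspace_eqP.
have h1 := Lp_ip x.
have h2 := LspaceZE 0 (0 : L); rewrite scale0r in h2.
near=> t => _.
by rewrite (near h1 t)// (near h t)// (near h2 t)// mul0r.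
Unshelve. all: by end_near. Qed.

End Lp_coordinates.

Section Lp_balls.
Variables (R : realType) (n : nat).
Local Notation T := (measurableTypeR R).
Local Notation mu := (leb01 R).

Lemma Lp_ballE (r : R) (r1 : (1 <= r%:E)%E) (f : {linear 'rV[R]_n -> Lp01 r1}) :
  [set v | Lspace_norm (f v) <= 1] = pint_ball mu r (coord_fun f).
Proof.
have r1' : 1 <= r by rewrite -lee_fin.
have r0 : 0 < r by lra.
have e1 (q : R) : 1 = 1 `^ q by rewrite powR1.
have E v : Lspace_norm (f v) = nmr mu r (ip (coord_fun f) v).
  rewrite /Lspace_norm.
  have fL : (f v : T -> R) \in Lfun mu r%:E by exact: Lspace_Lfun.
  have -> : ('N[Lebesgue01 R]_r%:E[EFin \o (f v : T -> R)] = (nmr mu r (f v))%:E)%E by exact: LnormE.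
  rewrite [LHS]/= /nmr; suff -> : pint mu r (f v) = pint mu r (ip (coord_fun f) v) by [].
  rewrite /pint /Rintegral; congr fine.
  have gL : ip (coord_fun f) v \in Lfun mu r%:E.
    by apply: Lfun_ip => // i; exact: coord_fun_Lfun.
  apply: ae_eq_integral => //.
  - by case/integrableP: (Lfun_pow_integrable r1' fL).
  - by case/integrableP: (Lfun_pow_integrable r1' gL).
  - by apply: filterS (Lp_ip f v) => s hs _; rewrite hs.
apply/seteqP; split => v /=; rewrite E /pint_ball/= => h.
  rewrite [leRHS](e1 r) pint_nmr// ge0_ler_powR ?nnegrE ?powR_ge0 ?(ltW r0)//.
by rewrite [leRHS](e1 r^-1) /nmr ge0_ler_powR ?nnegrE ?invr_ge0 ?pint_ge0 ?(ltW r0).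
Qed.

Lemma Loo_ballE (p1 : (1 <= +oo :> \bar R)%E) (f : {linear 'rV[R]_n -> Lp01 p1}) :
  [set v | Lspace_norm (f v) <= 1] = sup_ball mu (coord_fun f).
Proof.
have E v : Lspace_norm (f v) <= 1 <-> {ae mu, forall s, `|(f v : T -> R) s| <= 1}.
  rewrite /Lspace_norm.
  have fL : (f v : T -> R) \in Lfun mu +oo%E by exact: Lspace_Lfun.
  have fin : ('N[mu]_+oo[EFin \o (f v : T -> R)] < +oo)%E.
    by move: fL => /andP[_]; rewrite inE.
  have fn : ('N[mu]_+oo[EFin \o (f v : T -> R)] \is a fin_num)%E.
    by rewrite ge0_fin_numE// Lnorm_ge0.
  transitivity ('N[mu]_+oo[EFin \o (f v : T -> R)] <= 1%:E)%E.
    by rewrite -(fineK fn) lee_fin.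
  (* The norm for p = oo is defined as the essential supremum when the space has positive
     measure. *)
  rewrite unlock /Lnorm [X in (0 < X)%E](leb01T R) lte01.
  split => [/ess_supP|h]; first by apply: filterS => s; rewrite lee_fin.
  by apply/ess_supP; apply: filterS h => s h; rewrite lee_fin.
apply/seteqP; split => v /=.
  move=> /E h; have h1 := Lp_ip f v; rewrite /sup_ball /=.
  by apply: filterS2 h h1 => s h1 <-.
move=> h; apply/E; have h1 := Lp_ip f v.
by apply: filterS2 h h1 => s h1 ->.
Qed.

End Lp_balls.

Theorem theorem6 (R : realType) (p : \bar R) (p1 : (1 <= p)%E)
    (n : nat) (n_gt0 : (0 < n)%N)
    (X : set (Lp01 p1)) (subX : is_subspace X) (dimX : has_dim X n) :
  vr Lspace_norm X n <=
  vr (lp_norm p) [set: 'rV[R]_n] n.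
Proof.
rewrite /vr; set C := xget set0 _.
(* The default value of [xget] has volume ratio 0. Otherwise the ball picked comes with some
   isomorphism f, and the estimate is proved for every f. *)
have [[C0 hC0]|noC] := pselect (exists C0, represents_unit_ball Lspace_norm X (n := n) C0); last first.
  have -> : C = set0 by apply: xgetPN => C1 hC1; apply: noC; exists C1.
  rewrite vr_body_volume0 ?powR_ge0//.
  by rewrite /volume /= measure0.
have := xgetPex set0 (ex_intro _ _ hC0); rewrite -/C.
move=> [f [fi _ ->]] {C hC0 C0 X subX dimX}.
case: p p1 f fi => [r|//|//] p1 f fi.
- have r1 : 1 <= r by rewrite -lee_fin.
  have r0 : 0 < r by lra.
  rewrite Lp_ballE.
  have [A [Au mC hA hv]] := lewis_ball r1 n_gt0 (coord_fun_Lfun f) (Lp_indep fi).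
  have K0 := volume_lp_ball_gt0 n r1.
  have Kfin : volume (@lp_ball R n r) \is a fin_num.
    by rewrite ge0_fin_numE ?ltW// (le_lt_trans (volume_lp_ball_cube n r1))// ltry.
  have c0 := lp_radius_gt0 n_gt0 r.
  apply: le_trans (vr_body_le n_gt0 K0 Kfin c0 Au hA hv) _.
  apply: vr_lp_ge => //.
  + exact: vset_lp_ball.
  + by move=> u; exact: lp_radius_eball.
  + by move=> B x; exact: lp_ellipsoid_det.
  + exact: lp_norm_ballE.
- rewrite Loo_ballE.
  have [V0|[A [Au hA hv]]] := sup_ball_position (leb01T R) n_gt0 (coord_fun_Lfun f) (Lp_indep fi).
    (* A ball whose volume is read as 0 has ratio 0, which is below any value of [vr]. *)
    by rewrite (vr_body_volume0 n_gt0 V0) powR_ge0.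
  have vK : volume (@cube R n 1) = (2 ^+ n)%:E by rewrite volume_cube// mulr1.
  have K0 : (0 < volume (@cube R n 1))%E by rewrite vK lte_fin exprn_gt0.
  have Kfin : volume (@cube R n 1) \is a fin_num by rewrite vK.
  have hA' u : eball u -> sup_ball (leb01 R) (coord_fun f) ((1 *: u) *m A).
    by rewrite scale1r; exact: hA.
  apply: le_trans (vr_body_le n_gt0 K0 Kfin ltr01 Au hA' hv) _.
  apply: vr_lp_ge => //.
  + exact: vset_cube.
  + move=> u eu; rewrite scale1r => i; rewrite -(@expr_le1 _ 2)// real_normK ?num_real//.
    by rewrite (le_trans _ eu)// (bigD1 i)//= lerDl sumr_ge0// => j _; exact: sqr_ge0.
  + by move=> B x h; rewrite expr1n; exact: cube_ellipsoid_det h.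
  + exact: cube_ballE.
Qed.
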